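(* Let $S\in\Gamma_{1,2}$ with $\operatorname{tr}S>2$, let $N\ge1$ be an integer and let $\kappa\in[0,1)^2$. If $|\psi\rangle_{N,\kappa}\in\mathcal H_{N,\kappa}$ is a pure theta state whose corresponding affine string $\Lambda\subset(\mathbb R/N\mathbb Z)^2$ is invariant under $S$ (i.e. $S\Lambda=\Lambda$ modulo $N$), then $|\psi\rangle_{N,\kappa}$ is an eigenstate of $U_S$, and $\mathcal H_{N,\kappa}$ is one of the spaces on which $U_S$ acts as an endomorphism (i.e. $U_S\mathcal H_{N,\kappa}\subset\mathcal H_{N,\kappa}$). Besides, the invariance of $\Lambda$ under $S$ implies the invariance under $S$ of its linear part $\Lambda_{\rm lin}\subset(\mathbb Z/N\mathbb Z)^2$.
   Context: Let $\Gamma_{1,2}\subset \mathrm{SL}(2,\mathbb Z)$ be the subgroup of matrices congruent mod 2 to $\begin{pmatrix}1&0\\ 0&1\end{pmatrix}$ or $\begin{pmatrix}0&1\\ 1&0\end{pmatrix}$. Put $\hbar=1/(2\pi N)$ and $T_{\mathbb C}=\mathbb C/\tfrac1{\sqrt2}(\mathbb Z+i\mathbb Z)$. For $S=\begin{pmatrix}a&b\\ c&d\end{pmatrix}\in\mathrm{SL}(2,\mathbb R)$, $z\in\mathbb C$, $q\in\mathbb R$, set $$\langle z|U_S|q\rangle=\frac{1}{(\pi\hbar)^{1/4}}\frac1{j_S}\exp\Big\{\frac{1}{2\hbar(ib+d)}\big(-(d-ib)z^2-(a-ic)q^2+2\sqrt2\,zq\big)\Big\},$$ where $j_S$ is a fixed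 square root of $ib+d$ (so $U_S$ is defined up to sign); for $S$ the identity (with $j_S=1$) this is $\langle z|q\rangle=(\pi\hbar)^{-1/4}e^{-\frac1{2\hbar}(z^2+q^2)+\frac{\sqrt2}{\hbar}zq}$. For $\kappa=\kappa_1+i\kappa_2$ with $(\kappa_1,\kappa_2)\in[0,1)^2$ and $q_j=(\kappa_2+j)/N$, $j=0,\dots,N-1$, let $\langle z|q_j\rangle_{N,\kappa}=\sum_{m\in\mathbb Z}e^{2i\pi m\kappa_1}\langle z|q_j+m\rangle$. These $N$ entire functions form an orthonormal basis of the $N$-dimensional Hilbert space $\mathcal H_{N,\kappa}$ (states are identified with their Bargmann functions $z\mapsto\langle z|\psi\rangle_{N,\kappa}$). For $S\in\mathrm{SL}(2,\mathbb Z)$, $U_S$ acts linearly on $\mathcal H_{N,\kappa}$ by $\langle z|U_S|q_j\rangle_{N,\kappa}=\sum_{m\in\mathbb Z}e^{2i\pi m\kappa_1}\langle z|U_S|q_j+m\rangle$; it maps $\mathcal H_{N,\kappa}$ unitarily onto $\mathcal H_{N,\kappa'}$, where $\begin{pmatrix}\kappa_2'\\ \kappa_1'\end{pmatrix}=S\begin{pmatrix}\kappa_2\\ \kappa_1\end{pmatrix}+\frac12\begin{pmatrix}Nab\\ Ncd\end{pmatrix}$ mod $1$. One has $U_{S'}U_{S''}=\pm U_{S'S''}$. Every nonzero element of $\mathcal H_{N,\kappa}$ has exactly $N$ zeros in $T_{\mathbb C}$ (with multiplicity). A pure theta state is a state that is (up to a nonzero scalar) of the form $U_{S'}|q_j\rangle_{N,\kappa''}$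 for some $S'\in\mathrm{SL}(2,\mathbb Z)$, $\kappa''\in[0,1)^2$, $0\le j\le N-1$. The zeros of a pure theta state in $T_{\mathbb C}$ have the form $z_k=z_0+k(n+im)/(N\sqrt2)$, $k=0,\dots,N-1$, with $n,m$ coprime integers. Its affine string is $\Lambda=\{N\sqrt2\,\bar z_k\}_{k}$, viewed as a subset of $(\mathbb R/N\mathbb Z)^2$ via $x+iy\leftrightarrow\begin{pmatrix} x \\ y \end{pmatrix}$; thus $\Lambda=\vec v_0+\Lambda_{\rm lin}$, with $\Lambda_{\rm lin}$ the subgroup of $(\mathbb Z/N\mathbb Z)^2$ generated by $\begin{pmatrix} n \\ -m \end{pmatrix}$. *)

(* Defs.v *)
(* MathComp / MathComp-Analysis, with complex numbers R[i] from real-closed. *)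
From HB Require Import structures.
From mathcomp Require Import all_boot all_order all_algebra.
From mathcomp Require Import all_classical all_reals all_analysis.
From mathcomp Require Import complex.

Set Implicit Arguments.
Unset Strict Implicit.
Unset Printing Implicit Defensive.

Import Order.TTheory GRing.Theory Num.Theory.
Import numFieldNormedType.Exports.
Local Open Scope classical_set_scope.
Local Open Scope ring_scope.
Local Open Scope complex_scope.

Definition congr_mod2 (A B : 'M[int]_2) : Prop :=
  forall i j, (A i j = B i j %[mod 2])%Z.

Definition in_SL2Z (S : 'M[int]_2) : Prop := \det S = 1.

(* tperm_mx 0 1 is the matrix with rows (0, 1) and (1, 0). *)
Definition in_Gamma12 (S : 'M[int]_2) : Prop :=
  in_SL2Z S /\ (congr_mod2 S 1%:M \/ congr_mod2 S (tperm_mx 0 1)).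

Section Bargmann.
Variable R : realType.
Implicit Types (z w j : R[i]) (psi : R[i] -> R[i]) (kappa : R * R).

Definition cexp z : R[i] :=
  (expR (complex.Re z))%:C * (cos (complex.Im z) +i* sin (complex.Im z)).

(* Sum over all integers, as the sum over m >= 0 plus the sum over m < 0;
   the topology on R[i] is the one induced by its norm. All the series to which
   this is applied below converge absolutely. *)
Definition sumZ (u : int -> R[i]) : R[i] :=
  limn (series (fun k : nat => u k%:Z : R[i]^o)) +
  limn (series (fun k : nat => u (- k.+1%:Z) : R[i]^o)).

Definition intmx (S : 'M[int]_2) : 'M[R]_2 := map_mx intr S.

Definition hbar (N : nat) : R := (2 * pi * N%:R)^-1.

Definition i_b_plus_d (S : 'M[R]_2) : R[i] := 'i%C * (S 0 1)%:C + (S 1 1)%:C.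

(* j ranges over the two square roots of ib + d, whence the sign ambiguity. *)
Definition is_jS (S : 'M[R]_2) j : Prop := j ^+ 2 = i_b_plus_d S.

(* <z|U_S|q> *)
Definition kernel_U (N : nat) (S : 'M[R]_2) j z (q : R) : R[i] :=
  let a := (S 0 0)%:C in let b := (S 0 1)%:C in
  let c := (S 1 0)%:C in let d := (S 1 1)%:C in
  ((pi * hbar N) `^ (4^-1))%:C^-1 * j^-1 *
  cexp ((2 * (hbar N)%:C * i_b_plus_d S)^-1 *
        (- (d - 'i%C * b) * z ^+ 2 - (a - 'i%C * c) * q%:C ^+ 2
         + 2 * (Num.sqrt 2)%:C * z * q%:C)).

(* [kappa = (kappa_1, kappa_2)] *)
Definition in_unit_square kappa : Prop :=
  (0 <= kappa.1 < 1) /\ (0 <= kappa.2 < 1).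

Definition qpt (N : nat) kappa (k : 'I_N) : R := (kappa.2 + k%:R) / N%:R.

(* z |-> <z|U_S|q_k>_{N,kappa} *)
Definition U_basis (N : nat) kappa (S : 'M[R]_2) j (k : 'I_N) : R[i] -> R[i] :=
  fun z => sumZ (fun m : int =>
    cexp (2 * 'i%C * pi%:C * m%:~R * kappa.1%:C) *
    kernel_U N S j z (qpt kappa k + m%:~R)).

(* z |-> <z|q_k>_{N,kappa} *)
Definition basis (N : nat) kappa (k : 'I_N) : R[i] -> R[i] :=
  U_basis kappa 1%:M 1 k.

Definition lincomb (N : nat) (c : 'I_N -> R[i]) (f : 'I_N -> R[i] -> R[i]) :
    R[i] -> R[i] :=
  fun z => \sum_(k < N) c k * f k z.

(* H_{N,kappa}, its elements being identified with their Bargmann functions. *)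
Definition Hspace (N : nat) kappa : set (R[i] -> R[i]) :=
  [set psi | exists c : 'I_N -> R[i], psi = lincomb c (basis kappa)].

(* The coordinates of an element of H_{N,kappa} in the basis of the
   <z|q_k>_{N,kappa}; they are unique because these functions are linearly
   independent. The value is irrelevant outside H_{N,kappa}. *)
Definition coords (N : nat) kappa psi : 'I_N -> R[i] :=
  xget (fun=> 0) [set c : 'I_N -> R[i] | psi = lincomb c (basis kappa)].

(* U_S on H_{N,kappa}: the linear extension of its values on the basis. *)
Definition U_op (N : nat) kappa (S : 'M[int]_2) j psi : R[i] -> R[i] :=
  lincomb (coords (N := N) kappa psi) (U_basis kappa (intmx S) j).

Definition eigenstate (U : (R[i] -> R[i]) -> (R[i] -> R[i])) psi : Prop :=
  psi <> (fun=> 0) /\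
  exists lambda : R[i], U psi = (fun z => lambda * psi z).

Definition pure_theta (N : nat) psi : Prop :=
  exists (S' : 'M[int]_2) (j' : R[i]) (kappa'' : R * R) (k : 'I_N) (mu : R[i]),
  [/\ in_SL2Z S', is_jS (intmx S') j', in_unit_square kappa'', mu != 0 &
      psi = (fun z => mu * U_basis kappa'' (intmx S') j' k z)].

(* Equality in T_C = C / (1/sqrt 2)(Z + iZ). *)
Definition eq_TC z w : Prop :=
  exists u v : int, z = w + (u%:~R + 'i%C * v%:~R) / (Num.sqrt 2)%:C.

(* The zeros of psi in T_C are the N (pairwise distinct) points
   z0 + k (n + i m) / (N sqrt 2), 0 <= k < N, with n and m coprime. *)
Definition zeros_on_string (N : nat) psi z0 (n m : int) : Prop :=
  coprimez n m /\
  forall z, psi z = 0 <->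
    exists k : 'I_N,
      eq_TC z (z0 + k%:R * (n%:~R + 'i%C * m%:~R) / (N%:R * (Num.sqrt 2)%:C)).

Definition vec_of_complex z : 'cV[R]_2 :=
  \col_i (if i == 0 then complex.Re z else complex.Im z).

(* A subset of (R/NZ)^2 is represented by its preimage in R^2, which is stable
   under translation by NZ^2; multiplication by a matrix of SL(2,Z) acts on such
   preimages, and equality of the preimages is equality modulo N. This is the
   set of the N sqrt 2 * conj z, z a zero of psi. *)
Definition affine_string (N : nat) psi : set 'cV[R]_2 :=
  [set v | exists z (u : 'cV[int]_2), psi z = 0 /\
     v = vec_of_complex (N%:R * (Num.sqrt 2)%:C * z^*%C) +
         N%:R *: map_mx intr u].

End Bargmann.

(* The subgroup of (Z/NZ)^2 generated by (n, -m), represented likewise by its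
   preimage in Z^2. *)
Definition linear_string (N : nat) (n m : int) : set 'cV[int]_2 :=
  [set v | exists (k : int) (u : 'cV[int]_2),
     v = k *: (\col_i (if i == 0 then n else - m)) + N%:R *: u].

Definition mx_invariant (A : pzRingType) (M : 'M[A]_2) (L : set 'cV[A]_2) : Prop :=
  [set M *m v | v in L] = L.

(* Main.v *)
Require Import Defs.
From HB Require Import structures.
From mathcomp Require Import all_boot all_order all_algebra.
From mathcomp Require Import all_classical all_reals all_analysis.
From mathcomp Require Import complex.
From mathcomp Require Import ring lra zify.

(**
Put T_v f(z) = e^{-pi N (sqrt 2 conj(zeta) z + |zeta|^2 / 2)} f(z + zeta / sqrt 2) with
zeta = v_0 - i v_1, and let W_{S,q}(z) = sum_m e^{2 pi i m kappa_1} <z|U_S|q + m> without its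
scalar prefactor. Comparing exponents, T_{S(y,p)} shifts q by y in W_{S,q} up to a phase which
does not depend on S. Hence U_S intertwines T_v with T_{Sv}, and W_{S,q} is a joint eigenvector
of the operators T_{Sv}, v in Z x Z/N, with explicit eigenvalues chi(v).

By the Jacobi triple product the zeros of U_{S'}|q> form the string S'(w0 + N Z x Z), where
w0 = (N q - N/2, kappa_1 - 1/2). Invariance under S says that M = S'^-1 S S' preserves N Z x Z
and fixes w0 modulo N Z x Z; this is exactly what is needed for chi(M v) = chi(v). Therefore
U_S psi and psi = U_{S'}|q> are eigenvectors of the same T_{S'v} with the same eigenvalues, and
similarly U_S maps H_{N,kappa} to functions with the quasi-periodicity that defines H_{N,kappa}.

It remains to see that such functions are unique up to a scalar. After multiplication by a
Gaussian they become F with F(w + 1) = F(w) and F(w) e^{-2 pi i k w} = b_k F(w + k tau). With A_l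
the average over the translates by r/l, 0 <= r < l, discrete Fourier inversion gives F(w) =
sum_k b_k e^{2 pi i k w} A_l F(w + k tau), the sum being over |k| <= l/2. As l grows, A_l F
becomes constant and the k-th term is O(1/k^2) uniformly in l, so F(w) is close to
A_l F(0) sum_{|k| <= K} b_k e^{2 pi i k w}, whose second factor does not depend on F. No integral
and no Cauchy theorem is used.
*)

Import Order.TTheory GRing.Theory Num.Theory.
Import numFieldNormedType.Exports.
Local Open Scope classical_set_scope.
Local Open Scope ring_scope.

Set Implicit Arguments.
Unset Strict Implicit.

(** * Complex modulus and exponential *)


(** The operators T_v compose only up to the phase e^{-i pi N det(v, w)}, so their joint eigenvalues
    are not characters. For v = (y, s/N) one has chi(v) = (-1)^{y + s + ys} e^{2 pi i det(v, w0)}.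
    The sign is 1 exactly when y and s are both even, hence unimodular matrices preserve it; the
    halves in w0 are what separates it from the linear phase. This is why a condition on the zeros,
    which see only w0, controls the eigenvalues completely.

    The other obstacle is that H_{N,kappa} is given as a span, with U_S prescribed on a basis; its
    description by quasi-periodicity has to be proved. A finite Fourier transform over the
    translations by (0, t/N) splits a quasi-periodic function into joint eigenfunctions, and
    uniqueness makes each of them a multiple of one basis wave. One state psi with invariant string
    then decides about the whole space: integer translations act on H_{N,kappa} by scalars, and
    these scalars can be read off from psi. *)

Section Modulus.
Local Open Scope complex_scope.
Import Normc.
Variable R : realType.
Implicit Types z w : R[i].

Lemma normc_ge0 z : 0 <= normc z.
Proof. by case: z => a b; apply: sqrtr_ge0. Qed.

Lemma normc_eq0 z : (normc z == 0) = (z == 0).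
Proof.
by apply/eqP/eqP => [/eq0_normc//|->]; rewrite normc0.
Qed.

Lemma normc_gt0 z : (0 < normc z) = (z != 0).
Proof. by rewrite lt_def normc_eq0 normc_ge0 andbT. Qed.

Lemma normc_le_add z w : normc (z + w) <= normc z + normc w.
Proof. exact: le_normcD. Qed.

Lemma normc_opp z : normc (- z) = normc z.
Proof. exact: normcN. Qed.

Lemma normc_le_sub z w : normc (z - w) <= normc z + normc w.
Proof. by rewrite -(normc_opp w); apply: normc_le_add. Qed.

Lemma normc_sub_ge z w : normc z - normc w <= normc (z - w).
Proof. by have := normc_le_add (z - w) w; rewrite subrK; lra. Qed.

Lemma normc_distrC z w : normc (z - w) = normc (w - z).
Proof. by rewrite -normc_opp opprB. Qed.

Lemma normc_sum (I : Type) (r : seq I) (P : pred I) (F : I -> R[i]) :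
  normc (\sum_(i <- r | P i) F i) <= \sum_(i <- r | P i) normc (F i).
Proof.
elim/big_rec2: _ => [|i y x _ le_xy]; first by rewrite normc0.
by apply: le_trans (normc_le_add _ _) _; rewrite lerD2l.
Qed.

Lemma normcX z n : normc (z ^+ n) = normc z ^+ n.
Proof. by elim: n => [|n IH]; rewrite ?expr0 ?normc1// !exprS normcM IH. Qed.

Lemma normc_real (x : R) : normc x%:C = `|x|.
Proof. by rewrite /= expr0n addr0 sqrtr_sqr. Qed.

Lemma normc_nat n : normc (n%:R : R[i]) = n%:R.
Proof. by rewrite -(rmorph_nat (real_complex R)) normc_real ger0_norm. Qed.

Lemma normc_int (m : int) : normc (m%:~R : R[i]) = `|m%:~R|.
Proof. by rewrite -(rmorph_int (real_complex R)) normc_real. Qed.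

Lemma normc_i : normc ('i : R[i]) = 1.
Proof. by rewrite /= expr0n expr1n add0r sqrtr1. Qed.

Lemma abs_Re_le_normc z : `|complex.Re z| <= normc z.
Proof. by case: z => a b /=; rewrite -sqrtr_sqr ler_wsqrtr// lerDl sqr_ge0. Qed.

Lemma abs_Im_le_normc z : `|complex.Im z| <= normc z.
Proof. by case: z => a b /=; rewrite -sqrtr_sqr ler_wsqrtr// lerDr sqr_ge0. Qed.

Lemma normc_le_ReIm z : normc z <= `|complex.Re z| + `|complex.Im z|.
Proof.
rewrite {1}[z]complexE; apply: le_trans (normc_le_add _ _) _.
by rewrite normcM normc_i mul1r !normc_real.
Qed.

Lemma eq0_of_normc_le z : (forall e, 0 < e -> normc z <= e) -> z = 0.
Proof.
move=> small; apply/eqP; rewrite -normc_eq0 eq_le normc_ge0 andbT.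
by apply/ler_addgt0Pl => e /small; rewrite addr0.
Qed.

End Modulus.

Section ComplexExponential.
Local Open Scope complex_scope.
Import Normc.
Variable R : realType.
Implicit Types z w : R[i].

Lemma cexpD z w : cexp (z + w) = cexp z * cexp w.
Proof.
case: z w => [a b] [c d]; rewrite /cexp /= expRD cosD sinD rmorphM/=.
by apply/eqP; rewrite eq_complex /=; apply/andP; split; apply/eqP; ring.
Qed.

Lemma cexp0 : cexp (0 : R[i]) = 1.
Proof. by rewrite /cexp /= expR0 cos0 sin0 mul1r. Qed.

Lemma normc_cexp z : normc (cexp z) = expR (complex.Re z).
Proof.
rewrite /cexp normcM normc_real ger0_norm ?expR_ge0//.
by rewrite /= cos2Dsin2 sqrtr1 mulr1.
Qed.

Lemma cexp_neq0 z : cexp z != 0.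
Proof. by rewrite -normc_gt0 normc_cexp expR_gt0. Qed.

Lemma cexpN z : cexp (- z) = (cexp z)^-1.
Proof.
by apply: (mulIf (cexp_neq0 z)); rewrite -cexpD addNr cexp0 mulVf ?cexp_neq0.
Qed.

Lemma cexpB z w : cexp (z - w) = cexp z / cexp w.
Proof. by rewrite cexpD cexpN. Qed.

Lemma cexpMn z n : cexp (z *+ n) = cexp z ^+ n.
Proof. by elim: n => [|n IH]; rewrite ?cexp0// mulrS exprS cexpD IH. Qed.

Lemma cexpMz z (m : int) : cexp (z *~ m) = cexp z ^ m.
Proof.
case: m => n; first by rewrite -pmulrn cexpMn.
by rewrite NegzE mulrNz cexpN -pmulrn cexpMn.
Qed.

Lemma cexp_imaginary (y : R) : cexp ('i * y%:C) = cos y +i* sin y.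
Proof.
have -> : 'i * y%:C = 0 +i* y.
  by apply/eqP; rewrite eq_complex /=; apply/andP; split; apply/eqP; ring.
by rewrite /cexp /= expR0 mul1r.
Qed.

Lemma cexp_pii : cexp ('i * (pi : R)%:C) = -1.
Proof.
rewrite cexp_imaginary cospi sinpi.
by apply/eqP; rewrite eq_complex /= oppr0 !eqxx.
Qed.

Lemma cexp_2pii : cexp (2 * 'i * (pi : R)%:C) = 1.
Proof.
have -> : 2 * 'i * (pi : R)%:C = ('i * (pi : R)%:C) *+ 2 by ring.
by rewrite cexpMn cexp_pii sqrrN expr1n.
Qed.

Lemma cexp_2pii_int (m : int) : cexp (2 * 'i * (pi : R)%:C * m%:~R) = 1.
Proof. by rewrite mulrzr cexpMz cexp_2pii exp1rz. Qed.

Lemma cexpD_2pii_int z (m : int) :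
  cexp (z + 2 * 'i * (pi : R)%:C * m%:~R) = cexp z.
Proof. by rewrite cexpD cexp_2pii_int mulr1. Qed.

Lemma cexp_eq1 z : cexp z = 1 -> exists m : int, z = 2 * 'i * (pi : R)%:C * m%:~R.
Proof.
move=> z1; have Re0 : complex.Re z = 0.
  by apply: expR_inj; rewrite -normc_cexp z1 normc1 expR0.
move: z1; have -> : z = 'i * (complex.Im z)%:C by rewrite {1}[z]complexE Re0 add0r.
move: (complex.Im z) => {Re0}y z1.
have pi0 : 0 < pi :> R := pi_gt0 R.
pose m : int := Num.floor (y / (2 * pi)).
pose t := y - 2 * pi * m%:~R.
have t0 : 0 <= t.
  by rewrite subr_ge0 mulrC -ler_pdivlMr ?floor_le// mulr_gt0.
have t2 : t < 2 * pi.
  rewrite ltrBlDr -[X in X + _]mulr1 -mulrDr addrC -ltr_pdivrMl ?mulr_gt0//.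
  rewrite mulrC -(intrD _ m 1).
  by have /andP[] := floor_itv (y / (2 * pi)).
have y_t : 'i * y%:C = 'i * t%:C + 2 * 'i * (pi : R)%:C * m%:~R.
  rewrite /t !(rmorphB, rmorphM, rmorph_int, rmorph_nat)/=; ring.
have ct : cos t = 1.
  by move: z1; rewrite y_t cexpD_2pii_int cexp_imaginary => -[].
suff t_0 : t = 0 by exists m; rewrite y_t t_0 mulr0 add0r.
(* [cos] is strictly decreasing on [0, pi], and the reflection t -> 2 pi - t carries the other half
   of the period there. *)
have [tpi|pit] := leP t pi.
  apply/eqP; rewrite eq_le t0 andbT leNgt; apply/negP => h.
  have : cos t < cos 0 by rewrite ltr_cos// in_itv/= ?lexx ?t0 ?tpi ?ltW.
  by rewrite ct cos0 ltxx.
clear y_t z1; have c1 : cos (2 * pi - t) = 1.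
  have -> : 2 * pi - t = - (t - pi *+ 2) by ring.
  by rewrite cosN -ct -[in RHS](subrK (pi *+ 2) t) cosD2pi.
have : cos (2 * pi - t) < cos 0.
  by rewrite ltr_cos ?in_itv/= ?lexx; [lra|apply/andP; split; lra|lra].
by rewrite c1 cos0 ltxx.
Qed.

Lemma cexp_inj z w : cexp z = cexp w ->
  exists m : int, z = w + 2 * 'i * (pi : R)%:C * m%:~R.
Proof.
move=> zw; have [|m e] := @cexp_eq1 (z - w).
  by rewrite cexpB zw divff ?cexp_neq0.
by exists m; rewrite -e addrC subrK.
Qed.

End ComplexExponential.


Section TrigonometricBounds.
Variable R : realType.
Implicit Types x y : R.

Lemma mvt_sin x : 0 <= x -> exists2 c, 0 <= c <= x & sin x = cos c * x.
Proof.
move=> x0; have ds y : y \in `]0, x[ -> is_derive y 1 sin (cos y).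
  by move=> _; apply: is_derive_sin.
have cs : {within `[0, x], continuous (@sin R)}.
  by exact/continuous_subspaceT/continuous_sin.
have [c] := MVT_segment x0 ds cs.
by rewrite in_itv/= sin0 !subr0 => c0x ->; exists c.
Qed.

Lemma abs_sin_le x : `|sin x| <= `|x|.
Proof.
wlog x0 : x / 0 <= x.
  move=> H; have [/H//|x0] := leP 0 x.
  by have := H (- x); rewrite sinN !normrN oppr_ge0; apply; exact: ltW.
have [c _ ->] := mvt_sin x0.
by rewrite normrM ler_piMl// cos_max.
Qed.

Lemma one_sub_cos x : 1 - cos x = 2 * sin (x / 2) ^+ 2.
Proof.
have -> : cos x = cos ((x / 2) *+ 2) by congr cos; field.
by rewrite cos_mulr2n sin2cos2; ring.
Qed.

Lemma one_sub_cos_le x : 0 <= 1 - cos x <= x ^+ 2 / 2.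
Proof.
rewrite one_sub_cos mulr_ge0 ?sqr_ge0//=.
have : sin (x / 2) ^+ 2 <= (x / 2) ^+ 2.
  by rewrite -real_normK ?num_real// -[leRHS]real_normK ?num_real// ler_sqr ?nnegrE// abs_sin_le.
by rewrite expr_div_n; lra.
Qed.

Lemma one_sub_cos_le_abs x : 1 - cos x <= `|x|.
Proof.
rewrite one_sub_cos -real_normK ?num_real//.
have h := abs_sin_le (x / 2); have := sin_max (x / 2).
have := normr_ge0 (sin (x / 2)).
rewrite normrM (ger0_norm (_ : 0 <= 2^-1)) ?invr_ge0// in h.
move: `|sin _| `|x| h => s u; nra.
Qed.

(** By the mean value theorem x - sin x = (1 - cos c) x with 0 <= c <= x, and 1 - cos c <= c. The
    quadratic order is all that [cexp_taylor1] requires. *)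
Lemma abs_sub_sin_le x : `|sin x - x| <= x ^+ 2.
Proof.
wlog x0 : x / 0 <= x.
  move=> H; have [/H//|x0] := leP 0 x.
  have := H (- x); rewrite sinN oppr_ge0 sqrrN -opprD normrN; apply; exact: ltW.
have [c /andP[c0 cx] ->] := mvt_sin x0.
have := one_sub_cos_le_abs c; rewrite ger0_norm// => h.
have -> : cos c * x - x = - ((1 - cos c) * x) by ring.
have cos1 := cos_le1 c; rewrite normrN ger0_norm ?mulr_ge0 ?subr_ge0// expr2.
by rewrite ler_wpM2r// (le_trans h).
Qed.

(** A crude Jordan inequality: x / 2 <= sin x up to 1, and from 1 to pi / 2 < 2 monotonicity keeps
    sin x above 1 / 2. *)
Lemma sin_ge_quarter x : 0 <= x <= pi / 2 -> x / 4 <= sin x.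
Proof.
have small y : 0 <= y <= 1 -> y / 2 <= sin y.
  move=> /andP[y0 y1]; have [c /andP[c0 cx] ->] := mvt_sin y0.
  have /andP[_] := one_sub_cos_le c.
  nra.
move=> /andP[x0 xpi]; have [x1|x1] := leP x 1.
  by have := small x; rewrite x0 x1 => /(_ isT); lra.
have pi2 := pihalf_lt2 R.
have s1 : 1 / 2 <= sin 1 :> R by apply: small; lra.
have : sin 1 < sin x :> R.
  by rewrite ltr_sin ?in_itv/=//; apply/andP; split; lra.
lra.
Qed.

End TrigonometricBounds.

Section ExponentialBounds.
Local Open Scope complex_scope.
Import Normc.
Variable R : realType.
Implicit Types (x y : R) (z w : R[i]).

Lemma expR_sub1_le x : `|expR x - 1| <= `|x| * expR `|x|.
Proof.
(* Multiplied by [expR x], [dn] becomes (1 - x) e^x <= 1, the upper estimate for e^x - 1. *)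
have up := expR_ge1Dx x; have dn := expR_ge1Dx (- x).
have e0 := expR_gt0 x.
rewrite expRN -(ler_pM2r e0) mulVf ?gt_eqF// in dn.
have [x0|x0] := leP 0 x.
  by rewrite (ger0_norm x0) ger0_norm; nra.
rewrite (ltr0_norm x0); have := expR_ge1Dx (- x).
by rewrite ler0_norm; nra.
Qed.

Lemma expR_sub1_sub_le x : `|expR x - 1 - x| <= x ^+ 2 * expR `|x|.
Proof.
have up := expR_ge1Dx x; have dn := expR_ge1Dx (- x).
have e0 := expR_gt0 x.
rewrite expRN -(ler_pM2r e0) mulVf ?gt_eqF// in dn.
rewrite ger0_norm; last by lra.
have [x0|x0] := leP 0 x.
  by rewrite (ger0_norm x0); nra.
by rewrite (ltr0_norm x0); have := expR_ge1Dx (- x); nra.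
Qed.

Lemma normc_cexp_le z : normc (cexp z) <= expR (normc z).
Proof.
by rewrite normc_cexp ler_expR (le_trans (ler_norm _))// abs_Re_le_normc.
Qed.

Lemma cexp_taylor1 z :
  normc (cexp z - 1 - z) <= 4 * normc z ^+ 2 * expR (normc z).
Proof.
case: z => x y; set z := x +i* y.
have xz : `|x| <= normc z := abs_Re_le_normc z.
have yz : `|y| <= normc z := abs_Im_le_normc z.
have n0 := normc_ge0 z.
(* The three summands isolate the errors of cos and sin, of e^x - 1 - x, and the cross term y (e^x -
   1); they contribute 2, 1 and 1 to the constant 4. *)
have -> : cexp z - 1 - z = (expR x)%:C * ((cos y - 1) +i* (sin y - y))
    + (expR x - 1 - x)%:C + 'i * (y * (expR x - 1))%:C.
  apply/eqP; rewrite eq_complex /=; apply/andP; split; apply/eqP; ring.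
apply: le_trans (normc_le_add _ _) _.
apply: le_trans (lerD (normc_le_add _ _) (lexx _)) _.
rewrite !normcM normc_i mul1r !normc_real (ger0_norm (expR_ge0 x)).
have h1 : normc ((cos y - 1) +i* (sin y - y)) <= 2 * normc z ^+ 2.
  apply: le_trans (normc_le_ReIm _) _; rewrite [complex.Re _]/= [complex.Im _]/=.
  have /andP[c0 c1] := one_sub_cos_le y.
  have s1 := abs_sub_sin_le y.
  have y2 : y ^+ 2 <= normc z ^+ 2.
    by rewrite -[y ^+ 2]real_normK ?num_real// ler_sqr ?nnegrE.
  have -> : `|cos y - 1| = 1 - cos y by rewrite -normrN opprB ger0_norm.
  lra.
have ex : expR x <= expR (normc z).
  by rewrite ler_expR (le_trans (ler_norm _)).
have ex' : expR `|x| <= expR (normc z) by rewrite ler_expR.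
have h2 : `|expR x - 1 - x| <= normc z ^+ 2 * expR (normc z).
  apply: le_trans (expR_sub1_sub_le x) _.
  rewrite -[x ^+ 2]real_normK ?num_real//; apply: ler_pM => //.
  by rewrite ler_sqr ?nnegrE.
have h3 : `|y * (expR x - 1)| <= normc z ^+ 2 * expR (normc z).
  rewrite normrM expr2 -mulrA; apply: ler_pM => //.
  apply: le_trans (expR_sub1_le x) _; exact: ler_pM.
have h4 : expR x * normc ((cos y - 1) +i* (sin y - y)) <=
    expR (normc z) * (2 * normc z ^+ 2).
  by apply: ler_pM => //; rewrite ?expR_ge0 ?normc_ge0.
move: h2 h3 h4; lra.
Qed.

End ExponentialBounds.

(** * Bilateral series *)


Section ComplexSeries.
Local Open Scope complex_scope.
Import Normc.
Variable R : realType.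

Lemma real_abs_series (v : nat -> R) (M : R) :
  (forall n, \sum_(k < n) `|v k| <= M) ->
  exists l, forall e, 0 < e ->
    exists n0, forall n, (n0 <= n)%N -> `|l - \sum_(k < n) v k| <= e.
Proof.
move=> vM; have cvg_abs : cvgn (series (fun k => `|v k|)).
  apply: nondecreasing_is_cvgn.
    apply/nondecreasing_seqP => n; rewrite /series /= big_nat_recr//=.
    by rewrite lerDl.
  exists M => _ [n _ <-]; by rewrite /series /= big_mkord.
have cv : cvgn (series v) by apply: normed_cvg.
exists (limn (series v)) => e e0.
have /cvgrPdist_le/(_ e e0)[n0 _ near0] : series v @ \oo --> limn (series v) by [].
by exists n0 => n n0n; have := near0 n n0n; rewrite /series /= big_mkord.
Qed.

Lemma limn_normc (s : nat -> R[i]) (l : R[i]) :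
  (forall e, 0 < e -> exists n0, forall n, (n0 <= n)%N -> normc (l - s n) <= e) ->
  limn (s : nat -> R[i]^o) = l.
Proof.
move=> sl; apply: cvg_lim => //.
apply/cvgrPdist_le => e e0.
(* In the order of [R[i]] a positive element is real, so real radii suffice. *)
have eR : e = (complex.Re e)%:C by rewrite RRe_real// gtr0_real.
have [|n0 h] := sl (complex.Re e); first by rewrite -ltcR -eR.
by exists n0 => // n /= /h; rewrite -lecR -eR.
Qed.

Lemma complex_abs_series (v : nat -> R[i]) (M : R) :
  (forall n, \sum_(k < n) normc (v k) <= M) ->
  forall e, 0 < e -> exists n0, forall n, (n0 <= n)%N ->
    normc (limn (series (v : nat -> R[i]^o)) - \sum_(k < n) v k) <= e.
Proof.
move=> vM.
have [|lr hr] := @real_abs_series (fun k => complex.Re (v k)) M.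
  move=> n; apply: le_trans (vM n); apply: ler_sum => k _; exact: abs_Re_le_normc.
have [|li hi] := @real_abs_series (fun k => complex.Im (v k)) M.
  move=> n; apply: le_trans (vM n); apply: ler_sum => k _; exact: abs_Im_le_normc.
have hl : forall e, 0 < e -> exists n0, forall n, (n0 <= n)%N ->
    normc (lr +i* li - \sum_(k < n) v k) <= e.
  move=> e e0; have e2 : 0 < e / 2 by rewrite divr_gt0.
  have [n1 h1] := hr _ e2; have [n2 h2] := hi _ e2.
  exists (maxn n1 n2) => n; rewrite geq_max => /andP[/h1 {}h1 /h2 {}h2].
  have -> : \sum_(k < n) v k =
      (\sum_(k < n) complex.Re (v k)) +i* (\sum_(k < n) complex.Im (v k)).
    elim: n {h1 h2} => [|n IH]; first by rewrite !big_ord0.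
    by rewrite !big_ord_recr/= IH; case: (v n) => a b.
  by apply: le_trans (normc_le_ReIm _) _ => /=; lra.
have -> : limn (series (v : nat -> R[i]^o)) = lr +i* li.
  apply: limn_normc => e /hl[n0 h]; exists n0 => n /h.
  by rewrite /series /= big_mkord.
exact: hl.
Qed.

End ComplexSeries.

Section BilateralSeries.
Local Open Scope complex_scope.
Import Normc.
Variable R : realType.
Implicit Types (u v : int -> R[i]) (b : int -> R).

(** The window is [-n, n), without the index n. *)
Definition psumZ (V : nmodType) (u : int -> V) (n : nat) : V :=
  \sum_(k < n) (u k%:Z + u (- k.+1%:Z)).

Definition abs_summableZ u :=
  exists M : R, forall n, psumZ (fun m => normc (u m)) n <= M.

Lemma sumZ_approx u : abs_summableZ u -> forall e, 0 < e ->
  exists n0, forall n, (n0 <= n)%N -> normc (sumZ u - psumZ u n) <= e.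
Proof.
move=> [M uM] e e0; have e2 : 0 < e / 2 by rewrite divr_gt0.
have [|n1 h1] := @complex_abs_series _ (fun k => u k%:Z) M _ (e / 2) e2.
  move=> n; apply: le_trans (uM n); apply: ler_sum => k _.
  by rewrite lerDl normc_ge0.
have [|n2 h2] := @complex_abs_series _ (fun k => u (- k.+1%:Z)) M _ (e / 2) e2.
  move=> n; apply: le_trans (uM n); apply: ler_sum => k _.
  by rewrite lerDr normc_ge0.
exists (maxn n1 n2) => n; rewrite geq_max => /andP[/h1 {}h1 /h2 {}h2].
rewrite /psumZ big_split/= /sumZ opprD addrACA.
apply: le_trans (normc_le_add _ _) _; lra.
Qed.

Lemma sumZ_unique u s : abs_summableZ u ->
  (forall e, 0 < e -> exists n0, forall n, (n0 <= n)%N ->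
    normc (s - psumZ u n) <= e) -> sumZ u = s.
Proof.
move=> su h; apply/eqP; rewrite -subr_eq0; apply/eqP/eq0_of_normc_le => e e0.
have e2 : 0 < e / 2 by rewrite divr_gt0.
have [n1 h1] := sumZ_approx su e2; have [n2 h2] := h _ e2.
pose n := maxn n1 n2.
have {}h1 := h1 n (leq_maxl _ _); have {}h2 := h2 n (leq_maxr _ _).
have -> : sumZ u - s = (sumZ u - psumZ u n) - (s - psumZ u n) by ring.
apply: le_trans (normc_le_sub _ _) _; lra.
Qed.

Lemma eq_sumZ u v : u =1 v -> sumZ u = sumZ v.
Proof. by move=> /funext->. Qed.

Lemma eq_psumZ (V : nmodType) (f g : int -> V) n : f =1 g -> psumZ f n = psumZ g n.
Proof. by move=> /funext->. Qed.

Lemma abs_summableZ_le u b (M : R) : (forall m, normc (u m) <= b m) ->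
  (forall n, psumZ b n <= M) -> abs_summableZ u.
Proof.
move=> ub bM; exists M => n; apply: le_trans (bM n).
by apply: ler_sum => k _; apply: lerD.
Qed.

Lemma psumZ_le b b' n : (forall m, b m <= b' m) -> psumZ b n <= psumZ b' n.
Proof. by move=> h; apply: ler_sum => k _; apply: lerD. Qed.

Lemma normc_psumZ u n : normc (psumZ u n) <= psumZ (fun m => normc (u m)) n.
Proof.
apply: le_trans (normc_sum _ _ _) _; apply: ler_sum => k _; exact: normc_le_add.
Qed.

Lemma normc_sumZ_le u b (M : R) : (forall m, normc (u m) <= b m) ->
  (forall n, psumZ b n <= M) -> normc (sumZ u) <= M.
Proof.
move=> ub bM; apply/ler_addgt0Pl => e e0.
have [n h] := sumZ_approx (abs_summableZ_le ub bM) e0.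
have {}h := h n (leqnn _).
have := le_trans (normc_psumZ u n) (le_trans (psumZ_le n ub) (bM n)).
have := normc_sub_ge (sumZ u) (psumZ u n); lra.
Qed.

Lemma psumZ_mull (c : R[i]) u n : psumZ (fun m => c * u m) n = c * psumZ u n.
Proof. by rewrite mulr_sumr; apply: eq_bigr => k _; rewrite mulrDr. Qed.

Lemma psumZ_mullr (c : R) b n : psumZ (fun m => c * b m) n = c * psumZ b n.
Proof. by rewrite mulr_sumr; apply: eq_bigr => k _; rewrite mulrDr. Qed.

Lemma abs_summableZ_mull (c : R[i]) u : abs_summableZ u ->
  abs_summableZ (fun m => c * u m).
Proof.
move=> [M uM]; apply: (@abs_summableZ_le _ (fun m => normc c * normc (u m)) (normc c * M)).
  by move=> m; rewrite normcM.
by move=> n; rewrite psumZ_mullr ler_wpM2l ?normc_ge0.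
Qed.

Lemma sumZ_mull (c : R[i]) u : abs_summableZ u ->
  sumZ (fun m => c * u m) = c * sumZ u.
Proof.
move=> su; apply: sumZ_unique; first exact: abs_summableZ_mull.
move=> e e0; have c1 : 0 < normc c + 1 by have := normc_ge0 c; lra.
have [n0 h] := sumZ_approx su (divr_gt0 e0 c1).
exists n0 => n /h {}h; rewrite psumZ_mull -mulrBr normcM.
apply: le_trans (ler_wpM2l (normc_ge0 c) h) _.
by rewrite mulrA ler_pdivrMr// mulrC ler_wpM2l ?ltW//; lra.
Qed.

Lemma abs_summableZ_add u v : abs_summableZ u -> abs_summableZ v ->
  abs_summableZ (fun m => u m + v m).
Proof.
move=> [M uM] [M' vM]; apply: (@abs_summableZ_le _ (fun m => normc (u m) + normc (v m)) (M + M')).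
  by move=> m; apply: normc_le_add.
move=> n; have := lerD (uM n) (vM n); rewrite /psumZ -big_split/=.
by under eq_bigr do rewrite addrACA.
Qed.

Lemma sumZ_add u v : abs_summableZ u -> abs_summableZ v ->
  sumZ (fun m => u m + v m) = sumZ u + sumZ v.
Proof.
move=> su sv; apply: sumZ_unique; first exact: abs_summableZ_add.
move=> e e0; have e2 : 0 < e / 2 by rewrite divr_gt0.
have [n1 h1] := sumZ_approx su e2; have [n2 h2] := sumZ_approx sv e2.
exists (maxn n1 n2) => n; rewrite geq_max => /andP[/h1 {}h1 /h2 {}h2].
have -> : psumZ (fun m => u m + v m) n = psumZ u n + psumZ v n.
  by rewrite /psumZ -big_split/=; under eq_bigr do rewrite addrACA.
rewrite opprD addrACA; apply: le_trans (normc_le_add _ _) _; lra.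
Qed.

Lemma psumZ_recr (V : nmodType) (f : int -> V) n :
  psumZ f n.+1 = psumZ f n + (f n%:Z + f (- n.+1%:Z)).
Proof. by rewrite /psumZ big_ord_recr. Qed.

(** Moving the window by one step changes only its two end terms. *)
Lemma psumZ_succ (V : comNzRingType) (f : int -> V) n :
  psumZ (fun m => f (m + 1)) n.+1 = psumZ f n.+1 + f n.+1%:Z - f (- n.+1%:Z).
Proof.
elim: n => [|n IH].
  rewrite /psumZ !big_ord_recr !big_ord0/= !add0r.
  by rewrite (_ : -1 + 1 = 0 :> int)//; ring.
rewrite psumZ_recr IH [in RHS]psumZ_recr.
have -> : n.+1%:Z + 1 = n.+2%:Z by lia.
have -> : - n.+2%:Z + 1 = - n.+1%:Z by lia.
ring.
Qed.

Lemma abs_summableZ_lim0 u : abs_summableZ u -> forall e, 0 < e ->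
  exists n0, forall n, (n0 <= n)%N ->
    normc (u n%:Z) <= e /\ normc (u (- n.+1%:Z)) <= e.
Proof.
move=> [M uM] e e0.
have [|l h] := @real_abs_series _ (fun k => normc (u k%:Z) + normc (u (- k.+1%:Z))) M.
  move=> n; apply: le_trans (uM n); apply: ler_sum => k _.
  by rewrite ger0_norm// addr_ge0 ?normc_ge0.
have e2 : 0 < e / 2 by rewrite divr_gt0.
have [n0 {}h] := h _ e2; exists n0 => n n0n.
have h1 := h n n0n; have h2 := h n.+1 (leqW n0n).
rewrite big_ord_recr/= in h2.
have p1 := normc_ge0 (u n%:Z); have p2 := normc_ge0 (u (- n.+1%:Z)).
move: h1 h2; rewrite !ler_norml => /andP[? ?] /andP[? ?]; split; lra.
Qed.

Lemma abs_summableZ_succ u : abs_summableZ u -> abs_summableZ (fun m => u (m + 1)).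
Proof.
move=> [M uM]; exists (M + M) => -[|n].
  have := uM 0%N; rewrite /psumZ !big_ord0; lra.
rewrite (psumZ_succ (fun m => normc (u m))).
have h1 := uM n.+1; have := uM n.+2; rewrite psumZ_recr.
have p0 : 0 <= psumZ (fun m => normc (u m)) n.+1.
  by apply: sumr_ge0 => k _; rewrite addr_ge0 ?normc_ge0.
have := normc_ge0 (u (- n.+1%:Z)); have := normc_ge0 (u (- n.+2%:Z)); lra.
Qed.

Lemma sumZ_succ u : abs_summableZ u -> sumZ (fun m => u (m + 1)) = sumZ u.
Proof.
move=> su; apply: sumZ_unique; first exact: abs_summableZ_succ.
move=> e e0; have e3 : 0 < e / 3 by rewrite divr_gt0.
have [n1 h1] := sumZ_approx su e3; have [n2 h2] := abs_summableZ_lim0 su e3.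
exists (maxn n1 n2).+1 => -[//|n]; rewrite ltnS geq_max => /andP[n1n n2n].
have {}h1 := h1 n.+1 (leqW n1n).
have [_ h3] := h2 n n2n; have [h4 _] := h2 n.+1 (leqW n2n).
rewrite psumZ_succ.
have -> : sumZ u - (psumZ u n.+1 + u n.+1%:Z - u (- n.+1%:Z)) =
  (sumZ u - psumZ u n.+1) - u n.+1%:Z + u (- n.+1%:Z) by ring.
apply: le_trans (normc_le_add _ _) _.
have := normc_le_sub (sumZ u - psumZ u n.+1) (u n.+1%:Z); lra.
Qed.

Lemma sumZ_shift u (y : int) : abs_summableZ u -> sumZ (fun m => u (m + y)) = sumZ u.
Proof.
have nat_shift w (n : nat) : abs_summableZ w ->
    abs_summableZ (fun m => w (m + n%:Z)) /\ sumZ (fun m => w (m + n%:Z)) = sumZ w.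
  elim: n w => [|n IH] w sw.
    by have -> : (fun m => w (m + 0%:Z)) = w by apply/funext => m; rewrite addr0.
  have [s1 e1] := IH w sw.
  have -> : (fun m => w (m + n.+1%:Z)) = (fun m => w (m + 1 + n%:Z)).
    by apply/funext => m; congr w; lia.
  split; first exact: (abs_summableZ_succ s1).
  by rewrite -e1 -(sumZ_succ s1).
(* [psumZ_succ], applied to the family already shifted backwards, expresses its partial sums through
   those of w. *)
have pred w : abs_summableZ w -> abs_summableZ (fun m => w (m - 1)).
  move=> [M wM]; exists (M + M) => n.
  have p0 k : 0 <= psumZ (fun m => normc (w m)) k.
    by apply: sumr_ge0 => i _; rewrite addr_ge0 ?normc_ge0.
  case: n => [|n]; first by have := wM 0%N; rewrite /psumZ !big_ord0; lra.
  have := psumZ_succ (fun m => normc (w (m - 1))) n.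
  under eq_psumZ do rewrite addrK.
  have -> : - n.+1%:Z - 1 = - n.+2%:Z by lia.
  have h1 := wM n.+1; have := wM n.+2; rewrite psumZ_recr => h2 h3.
  have h4 := p0 n.+1; have h5 := normc_ge0 (w (n.+1%:Z - 1)).
  have h6 := normc_ge0 (w n.+1%:Z); lra.
have predn w (n : nat) : abs_summableZ w -> abs_summableZ (fun m => w (m - n%:Z)).
  elim: n w => [|n IH] w sw.
    by have -> : (fun m => w (m - 0%:Z)) = w by apply/funext => m; rewrite subr0.
  have -> : (fun m => w (m - n.+1%:Z)) = (fun m => w (m - 1 - n%:Z)).
    by apply/funext => m; congr w; lia.
  exact: (pred _ (IH w sw)).
move=> su; case: y => n; first by have [] := nat_shift u n su.
have -> : Negz n = - n.+1%:Z by rewrite NegzE.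
have [_ <-] := nat_shift (fun m => u (m - n.+1%:Z)) n.+1 (predn _ _ su).
by apply: eq_sumZ => m; congr u; lia.
Qed.

End BilateralSeries.

(** * Theta series *)


Section StronglyHolomorphic.
Local Open Scope complex_scope.
Import Normc.
Variable R : realType.
Implicit Types f g : R[i] -> R[i].

(* Locally uniform complex differentiability with a quadratic remainder: all that the averaging
   argument needs, and it passes to dominated series without Cauchy's formula. *)
Definition sholo f := exists g, forall r : R, exists C : R, forall x y,
  normc x <= r -> normc y <= r ->
  [/\ normc (f x) <= C, normc (g x) <= C &
      normc (f y - f x - (y - x) * g x) <= C * normc (y - x) ^+ 2].

Lemma sholo_cst (c : R[i]) : sholo (fun=> c).
Proof.
exists (fun=> 0) => r; exists (normc c) => x y _ _.
rewrite normc0 normc_ge0 subrr mulr0 subr0 normc0; split => //.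
by rewrite mulr_ge0 ?sqr_ge0 ?normc_ge0.
Qed.

Lemma sholo_id : sholo id.
Proof.
exists (fun=> 1) => r; exists (Num.max r 1) => x y xr _.
rewrite normc1 !le_max xr lexx orbT mulr1 subrr normc0; split => //.
by rewrite mulr_ge0 ?sqr_ge0// le_max ler01 orbT.
Qed.

Lemma sholo_add f1 f2 : sholo f1 -> sholo f2 -> sholo (fun z => f1 z + f2 z).
Proof.
move=> [g1 h1] [g2 h2]; exists (fun z => g1 z + g2 z) => r.
have [C1 {}h1] := h1 r; have [C2 {}h2] := h2 r; exists (C1 + C2) => x y xr yr.
have [a1 b1 c1] := h1 x y xr yr; have [a2 b2 c2] := h2 x y xr yr.
cbv beta; split; [exact: le_trans (normc_le_add _ _) (lerD a1 a2)|
        exact: le_trans (normc_le_add _ _) (lerD b1 b2)|].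
have -> : f1 y + f2 y - (f1 x + f2 x) - (y - x) * (g1 x + g2 x) =
  (f1 y - f1 x - (y - x) * g1 x) + (f2 y - f2 x - (y - x) * g2 x) by ring.
by rewrite [leRHS]mulrDl; apply: le_trans (normc_le_add _ _) (lerD c1 c2).
Qed.

(** Used for products and composites, where products and squares of increments must be of second
    order. *)
Lemma sholo_lipschitz f : sholo f -> forall r, exists C, forall x y,
  normc x <= r -> normc y <= r -> normc (f y - f x) <= C * normc (y - x).
Proof.
move=> [g h] r; have [C {}h] := h r; exists (C + C * (r + r)) => x y xr yr.
have [a b c] := h x y xr yr.
have -> : f y - f x = (f y - f x - (y - x) * g x) + (y - x) * g x by ring.
apply: le_trans (normc_le_add _ _) _; rewrite normcM.
have C0 : 0 <= C := le_trans (normc_ge0 _) a.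
have yx : normc (y - x) <= r + r := le_trans (normc_le_sub _ _) (lerD yr xr).
have n0 := normc_ge0 (y - x).
have : normc (y - x) * normc (g x) <= normc (y - x) * C by rewrite ler_wpM2l.
have : C * normc (y - x) ^+ 2 <= C * (r + r) * normc (y - x).
  by rewrite expr2 mulrA ler_wpM2r// ler_wpM2l.
lra.
Qed.

Lemma sholo_mul f1 f2 : sholo f1 -> sholo f2 -> sholo (fun z => f1 z * f2 z).
Proof.
move=> s1 s2; move: (s1) (s2) => [g1 h1] [g2 h2].
exists (fun z => g1 z * f2 z + f1 z * g2 z) => r.
have [C1 {}h1] := h1 r; have [C2 {}h2] := h2 r.
have [L1 l1] := sholo_lipschitz s1 r; have [L2 l2] := sholo_lipschitz s2 r.
exists (C1 * C2 + C1 * C2 + `|L1 * L2|) => x y xr yr.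
have [a1 b1 c1] := h1 x y xr yr; have [a2 b2 c2] := h2 x y xr yr.
have {}l1 := l1 x y xr yr; have {}l2 := l2 x y xr yr.
have p0 := @normc_ge0 R.
have C10 := le_trans (p0 _) a1; have C20 := le_trans (p0 _) a2.
have CC : 0 <= C1 * C2 by rewrite mulr_ge0.
cbv beta; split.
- rewrite normcM; have : normc (f1 x) * normc (f2 x) <= C1 * C2 by apply: ler_pM.
  have := normr_ge0 (L1 * L2); lra.
- apply: le_trans (normc_le_add _ _) _; rewrite !normcM.
  have : normc (f1 x) * normc (g2 x) <= C1 * C2 by apply: ler_pM.
  have : normc (g1 x) * normc (f2 x) <= C1 * C2 by apply: ler_pM.
  have := normr_ge0 (L1 * L2); lra.
have -> : f1 y * f2 y - f1 x * f2 x - (y - x) * (g1 x * f2 x + f1 x * g2 x) =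
  (f1 y - f1 x - (y - x) * g1 x) * f2 x + f1 x * (f2 y - f2 x - (y - x) * g2 x)
  + (f1 y - f1 x) * (f2 y - f2 x) by ring.
apply: le_trans (normc_le_add _ _) _; rewrite [leRHS]mulrDl; apply: lerD.
  apply: le_trans (normc_le_add _ _) _; rewrite !normcM [leRHS]mulrDl; apply: lerD.
    by rewrite mulrAC; apply: ler_pM.
  by rewrite -mulrA; apply: ler_pM.
rewrite normcM.
have : normc (f1 y - f1 x) * normc (f2 y - f2 x) <=
    L1 * normc (y - x) * (L2 * normc (y - x)) by apply: ler_pM.
move=> /le_trans; apply; rewrite mulrACA -expr2 ler_wpM2r ?sqr_ge0//.
exact: ler_norm.
Qed.

Lemma sholo_comp f h : sholo f -> sholo h -> sholo (f \o h).
Proof.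
move=> [g hf] sh; move: (sh) => [k hh]; exists (fun z => k z * g (h z)) => r.
have [C1 {}hh] := hh r; have [L1 l1] := sholo_lipschitz sh r.
have [C2 {}hf] := hf C1.
exists (C2 + C1 * C2 + C2 * L1 ^+ 2) => x y xr yr /=.
have [a1 b1 c1] := hh x y xr yr; have [a1' _ _] := hh y x yr xr.
have {}l1 := l1 x y xr yr.
have [a2 b2 c2] := hf (h x) (h y) a1 a1'.
have p0 := @normc_ge0 R.
have C10 := le_trans (p0 _) a1; have C20 := le_trans (p0 _) a2.
have CC : 0 <= C1 * C2 by rewrite mulr_ge0.
have CL : 0 <= C2 * L1 ^+ 2 by rewrite mulr_ge0 ?sqr_ge0.
split; first lra.
- have : normc (k x * g (h x)) <= C1 * C2 by rewrite normcM; apply: ler_pM.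
  lra.
have -> : f (h y) - f (h x) - (y - x) * (k x * g (h x)) =
  (f (h y) - f (h x) - (h y - h x) * g (h x)) +
  (h y - h x - (y - x) * k x) * g (h x) by ring.
apply: le_trans (normc_le_add _ _) _.
have e1 : normc ((h y - h x - (y - x) * k x) * g (h x)) <= C1 * C2 * normc (y - x) ^+ 2.
  by rewrite normcM mulrAC; apply: ler_pM.
have e2 : normc (h y - h x) ^+ 2 <= L1 ^+ 2 * normc (y - x) ^+ 2.
  by rewrite -exprMn; apply: lerXn2r => //; rewrite nnegrE// (le_trans (p0 _) l1).
have e3 := le_trans c2 (ler_wpM2l C20 e2).
have := mulr_ge0 C20 (sqr_ge0 (normc (y - x))); lra.
Qed.

Lemma sholo_mull (c : R[i]) f : sholo f -> sholo (fun z => c * f z).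
Proof. exact: sholo_mul (sholo_cst c). Qed.

Lemma sholo_affine f (a b : R[i]) : sholo f -> sholo (fun z => f (a * z + b)).
Proof.
move=> sf; apply: (@sholo_comp f (fun z => a * z + b)) => //.
exact: sholo_add (sholo_mull _ sholo_id) (sholo_cst b).
Qed.

Lemma sholo_sum (I : Type) (s : seq I) (F : I -> R[i] -> R[i]) :
  (forall i, sholo (F i)) -> sholo (fun z => \sum_(i <- s) F i z).
Proof.
move=> sF; elim: s => [|i s IH].
  rewrite (_ : (fun _ => _) = fun=> 0); first exact: sholo_cst.
  by apply/funext => z; rewrite big_nil.
rewrite (_ : (fun _ => _) = fun z => F i z + \sum_(j <- s) F j z).
  exact: sholo_add.
by apply/funext => z; rewrite big_cons.
Qed.

Lemma sholo_cexp : sholo (@cexp R).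
Proof.
exists (@cexp R) => r; exists (4 * expR (r + (r + r))) => x y xr yr.
have r0 := le_trans (normc_ge0 x) xr.
have ex : normc (cexp x) <= expR r.
  by apply: le_trans (normc_cexp_le x) _; rewrite ler_expR.
have er : expR r <= 4 * expR (r + (r + r)).
  have : expR r <= expR (r + (r + r)) by rewrite ler_expR; lra.
  have := expR_gt0 r; lra.
split; try exact: le_trans ex er.
have -> : cexp y - cexp x - (y - x) * cexp x = cexp x * (cexp (y - x) - 1 - (y - x)).
  by rewrite -{1}(subrK x y) cexpD; ring.
have -> : 4 * expR (r + (r + r)) * normc (y - x) ^+ 2 =
  expR r * (4 * normc (y - x) ^+ 2 * expR (r + r)) by rewrite expRD; ring.
rewrite normcM; apply: ler_pM; rewrite ?normc_ge0//.
apply: le_trans (cexp_taylor1 _) _; apply: ler_wpM2l.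
  by rewrite mulr_ge0 ?sqr_ge0.
rewrite ler_expR; exact: le_trans (normc_le_sub _ _) (lerD yr xr).
Qed.

End StronglyHolomorphic.

Section ThetaSeries.
Local Open Scope complex_scope.
Import Normc.
Variable R : realType.

Lemma psumZ_expN_abs_le n : psumZ (fun m => expR (- `|m%:~R|) : R) n <= 4.
Proof.
have pow k : expR (- k%:R) <= 2^-1 ^+ k :> R.
  have -> : - k%:R = k%:R * -1 :> R by ring.
  rewrite expRM_natl expRN.
  apply: lerXn2r; rewrite ?nnegrE ?invr_ge0 ?expR_ge0//.
  by rewrite lef_pV2 ?posrE ?expR_gt0//; have := expR_ge1Dx (1 : R); lra.
(* The sharper bound carries the induction: the n-th pair is at most 3/2 * 2^{-n}, and 4 * 2^{-n}
   decreases by 2 * 2^{-n}. *)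
suff : psumZ (fun m => expR (- `|m%:~R|) : R) n <= 4 - 4 * 2^-1 ^+ n.
  have : 0 <= 2^-1 ^+ n :> R by rewrite exprn_ge0// invr_ge0.
  lra.
elim: n => [|n IH]; first by rewrite /psumZ big_ord0 expr0; lra.
rewrite psumZ_recr.
have -> : `|n%:Z%:~R : R| = n%:R by rewrite -pmulrn ger0_norm.
have -> : `|(- n.+1%:Z)%:~R : R| = n.+1%:R.
  by rewrite mulrNz normrN -pmulrn ger0_norm.
have p0 : 0 <= 2^-1 ^+ n :> R by rewrite exprn_ge0// invr_ge0.
have := pow n; have := pow n.+1; rewrite exprS; move: (2^-1 ^+ n) IH p0 => t; lra.
Qed.

(** The constant is the maximum of e^{-a t^2 + (b + 1) t}, found by completing the square. *)
Lemma gauss_le_expN (a b : R) : 0 < a -> exists2 C, 0 < C & forall t, 0 <= t ->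
  expR (- a * t ^+ 2 + b * t) <= C * expR (- t).
Proof.
move=> a0; exists (expR ((b + 1) ^+ 2 / (4 * a))); first exact: expR_gt0.
move=> t t0; rewrite -expRD ler_expR -subr_ge0.
have -> : (b + 1) ^+ 2 / (4 * a) - t - (- a * t ^+ 2 + b * t) =
  (2 * a * t - (b + 1)) ^+ 2 / (4 * a) by field; rewrite gt_eqF.
by rewrite divr_ge0 ?sqr_ge0// mulr_ge0 ?ltW.
Qed.

Definition theta_term (beta gamma : R[i]) (m : int) : R[i] :=
  cexp (beta * m%:~R ^+ 2 + gamma * m%:~R).

Definition theta (beta gamma : R[i]) : R[i] := sumZ (theta_term beta gamma).

Lemma normc_theta_term_le beta gamma m (r : R) : normc gamma <= r ->
  normc (theta_term beta gamma m) <=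
  expR (complex.Re beta * `|m%:~R| ^+ 2 + r * `|m%:~R|).
Proof.
move=> gr; rewrite /theta_term cexpD normcM normc_cexp expRD.
have -> : complex.Re (beta * (m%:~R) ^+ 2) = complex.Re beta * `|m%:~R| ^+ 2.
  rewrite real_normK ?num_real//.
  rewrite -(rmorph_int (real_complex R)) -rmorphXn/=.
  by case: beta => x y /=; ring.
apply: ler_pM; rewrite ?expR_ge0 ?normc_ge0//.
apply: le_trans (normc_cexp_le _) _.
by rewrite ler_expR normcM normc_int ler_wpM2r.
Qed.

Lemma abs_summableZ_theta beta gamma : complex.Re beta < 0 ->
  abs_summableZ (theta_term beta gamma).
Proof.
move=> b0; have a0 : 0 < - complex.Re beta by rewrite oppr_gt0.
have [C C0 hC] := gauss_le_expN (normc gamma) a0.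
apply: (@abs_summableZ_le _ _ (fun m => C * expR (- `|m%:~R|)) (C * 4)).
  move=> m; apply: le_trans (normc_theta_term_le beta m (lexx _)) _.
  by have := hC `|m%:~R| (normr_ge0 _); rewrite opprK.
by move=> n; rewrite psumZ_mullr ler_wpM2l ?psumZ_expN_abs_le ?ltW//.
Qed.

Lemma sqr_le_expR (t : R) : 0 <= t -> t ^+ 2 <= 4 * expR t.
Proof.
move=> t0; have h := expR_ge1Dx (t / 2).
have -> : expR t = expR (t / 2) ^+ 2.
  by rewrite expr2 -expRD; congr expR; field.
move: (expR _) h => e h; nra.
Qed.

Lemma sholo_theta beta : complex.Re beta < 0 -> sholo (theta beta).
Proof.
move=> b0; have a0 : 0 < - complex.Re beta by rewrite oppr_gt0.
exists (fun x => sumZ (fun m => m%:~R * theta_term beta x m)) => r.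
pose s := `|r|.
(* The exponent reserves s for the argument x, 2 s for y - x in the Taylor remainder, and 1 to
   absorb the polynomial factors t and t^2. *)
have [C C0 hC] := gauss_le_expN (s + s + s + 1) a0.
(* 16 = 4 * 4 comes from [cexp_taylor1] and [sqr_le_expR]; the last 4 bounds the sum of all
   e^{-|m|}. *)
exists (16 * C * 4) => x y xr yr.
have s0 : 0 <= s := normr_ge0 r.
have xs : normc x <= s := le_trans xr (ler_norm r).
have ys : normc y <= s := le_trans yr (ler_norm r).
pose t (m : int) : R := `|m%:~R|.
have t0 m : 0 <= t m := normr_ge0 _.
pose b m := expR (complex.Re beta * t m ^+ 2 + (s + s + s + 1) * t m).
have b_ge0 m : 0 <= b m := expR_ge0 _.
have bC m : b m <= C * expR (- t m) by have := hC (t m) (t0 m); rewrite opprK.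
have sb (c : R) n : 0 <= c -> psumZ (fun m => c * b m) n <= c * (C * 4).
  move=> c0; rewrite psumZ_mullr ler_wpM2l//.
  apply: le_trans (psumZ_le n bC) _.
  by rewrite psumZ_mullr ler_wpM2l ?psumZ_expN_abs_le ?ltW//.
have CC : 0 <= C * 4 by rewrite mulr_ge0 ?ltW.
have tb m : normc (theta_term beta x m) <= expR (complex.Re beta * t m ^+ 2 + s * t m).
  exact: normc_theta_term_le.
have tb1 m : normc (theta_term beta x m) <= 1 * b m.
  rewrite mul1r; apply: le_trans (tb m) _; rewrite ler_expR lerD2l ler_wpM2r//; lra.
have te m : t m <= expR (t m) by have := expR_ge1Dx (t m); lra.
have tb2 m : normc (m%:~R * theta_term beta x m) <= 1 * b m.
  rewrite normcM normc_int -/(t m) mul1r.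
  apply: le_trans (ler_pM (t0 m) (normc_ge0 _) (te m) (tb m)) _.
  rewrite -expRD ler_expR; have := mulr_ge0 s0 (t0 m); lra.
have st : abs_summableZ (theta_term beta x) := abs_summableZ_le tb1 (fun n => sb _ n ler01).
have st' : abs_summableZ (fun m => m%:~R * theta_term beta x m).
  exact: abs_summableZ_le tb2 (fun n => sb _ n ler01).
have sty : abs_summableZ (theta_term beta y) := abs_summableZ_theta _ b0.
split.
- apply: le_trans (normc_sumZ_le tb1 (fun n => sb _ n ler01)) _; lra.
- apply: le_trans (normc_sumZ_le tb2 (fun n => sb _ n ler01)) _; lra.
have -> : theta beta y - theta beta x -
    (y - x) * sumZ (fun m => m%:~R * theta_term beta x m) =
  sumZ (fun m => theta_term beta x m * (cexp ((y - x) * m%:~R) - 1 - (y - x) * m%:~R)).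
  rewrite [RHS](@eq_sumZ _ _ (fun m => theta_term beta y m + -1 * theta_term beta x m
      + - (y - x) * (m%:~R * theta_term beta x m))); last first.
    move=> m; cbv beta.
    have -> : theta_term beta y m = theta_term beta x m * cexp ((y - x) * m%:~R).
      by rewrite -cexpD; congr cexp; ring.
    ring.
  have s1 := abs_summableZ_mull (-1) st; have s2 := abs_summableZ_mull (- (y - x)) st'.
  rewrite (sumZ_add (abs_summableZ_add sty s1) s2) (sumZ_add sty s1).
  by rewrite (sumZ_mull _ st) (sumZ_mull _ st') mulN1r mulNr.
have tb3 m : normc (theta_term beta x m * (cexp ((y - x) * m%:~R) - 1 - (y - x) * m%:~R))
    <= 16 * normc (y - x) ^+ 2 * b m.
  rewrite normcM.
  apply: le_trans (ler_pM (normc_ge0 _) (normc_ge0 _) (tb m) (cexp_taylor1 _)) _.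
  rewrite normcM normc_int -/(t m) exprMn.
  have e1 : expR (normc (y - x) * t m) <= expR ((s + s) * t m).
    rewrite ler_expR ler_wpM2r//; exact: le_trans (normc_le_sub _ _) (lerD ys xs).
  have -> : b m = expR (complex.Re beta * t m ^+ 2 + s * t m) * (expR ((s + s) * t m) * expR (t m)).
    by rewrite -!expRD; congr expR; ring.
  have e2 := sqr_le_expR (t0 m).
  rewrite [leRHS]mulrCA ler_wpM2l ?expR_ge0//.
  have -> : 16 * normc (y - x) ^+ 2 * (expR ((s + s) * t m) * expR (t m)) =
    4 * (normc (y - x) ^+ 2 * (4 * expR (t m))) * expR ((s + s) * t m) by ring.
  apply: ler_pM => //; rewrite ?expR_ge0 ?mulr_ge0 ?normc_ge0//.
  by rewrite ler_wpM2l// ler_wpM2l ?sqr_ge0.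
have n0 : 0 <= 16 * normc (y - x) ^+ 2 by rewrite mulr_ge0 ?sqr_ge0.
apply: le_trans (normc_sumZ_le tb3 (fun n => sb _ n n0)) _; lra.
Qed.

End ThetaSeries.

(** * Uniqueness of quasi-periodic functions *)


Section RiemannAverages.
Local Open Scope complex_scope.
Import Normc.
Variable R : realType.
Implicit Types (F : R[i] -> R[i]) (w s : R[i]).

(** A Riemann sum for the integral of F along the period from w to w + 1. *)
Definition avg (l : nat) F w : R[i] := l%:R^-1 * \sum_(r < l) F (w + r%:R / l%:R).

Definition periodic1 F := forall w, F (w + 1) = F w.

Lemma avg_shift l F w : periodic1 F ->
  avg l F (w + l%:R^-1) = avg l F w.
Proof.
move=> F1; rewrite /avg; congr (_ * _); case: l => [|l]; first by rewrite !big_ord0.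
have l0 : l.+1%:R != 0 :> R[i] by rewrite pnatr_eq0.
rewrite [LHS]big_ord_recr [RHS]big_ord_recl /= addrC; congr (_ + _).
  rewrite mul0r addr0 -(F1 w); congr F; rewrite -addrA; congr (_ + _).
  by apply: (mulIf l0); rewrite mulrDl mulfVK// mulVf// mul1r -natr1 addrC.
apply: eq_bigr => r _; congr F; rewrite -addrA; congr (_ + _).
by apply: (mulIf l0); rewrite mulrDl !mulfVK// mulVf// /bump -natr1 addrC.
Qed.

Lemma normc_nat_ratio_le (r l : nat) : (r <= l)%N -> normc (r%:R / l%:R : R[i]) <= 1.
Proof.
case: l => [|l] rl; first by rewrite invr0 mulr0 normc0.
by rewrite normcM normcV !normc_nat ler_pdivrMr ?ltr0n// mul1r ler_nat.
Qed.

(** This replaces the independence of a contour integral from its path. Cut the way from w to w + s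
    into l steps. The increments F(x + s/l) - F(x) and s (F(x + 1/l) - F(x)) have the same
    first-order term, and the second one averages to 0 by periodicity. A step thus costs O(1/l^2),
    and l steps cost O(1/l). *)
Lemma avg_shift_le F w s : sholo F -> periodic1 F ->
  exists C, forall l, (0 < l)%N -> normc (avg l F (w + s) - avg l F w) <= C / l%:R.
Proof.
move=> [g h] F1; have [C {}h] := h (normc w + normc s + 1).
have C0 : 0 <= C.
  have [] := h 0 0; rewrite ?normc0 ?addr_ge0 ?normc_ge0//.
  by move=> a _ _; apply: le_trans (normc_ge0 _) a.
(* The two parts are the quadratic remainders for the increments s/l and 1/l, the latter multiplied
   by |s|. *)
pose D := C * (normc s ^+ 2 + normc s); exists D => l l0.
have lR : 0 < l%:R :> R by rewrite ltr0n.
have lC : l%:R != 0 :> R[i] by rewrite pnatr_eq0 -lt0n.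
pose v t : R[i] := w + s * (t%:R / l%:R).
have step t : (t < l)%N -> normc (avg l F (v t.+1) - avg l F (v t)) <= D / l%:R ^+ 2.
  move=> tl.
  have -> : avg l F (v t.+1) - avg l F (v t) = l%:R^-1 * \sum_(r < l)
      (F (v t.+1 + r%:R / l%:R) - F (v t + r%:R / l%:R)
       - s * (F (v t + l%:R^-1 + r%:R / l%:R) - F (v t + r%:R / l%:R))).
    rewrite sumrB -mulr_sumr !sumrB.
    have := avg_shift l (v t) F1; rewrite /avg => /(mulfI _)->; last by rewrite invr_eq0.
    by rewrite subrr mulr0 subr0 mulrBr.
  rewrite normcM normcV normc_nat.
  suff bound (r : 'I_l) : normc (F (v t.+1 + r%:R / l%:R) - F (v t + r%:R / l%:R)
       - s * (F (v t + l%:R^-1 + r%:R / l%:R) - F (v t + r%:R / l%:R))) <= D / l%:R ^+ 2.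
    apply: le_trans (ler_wpM2l _ (normc_sum _ _ _)) _; first by rewrite invr_ge0 ler0n.
    rewrite ler_pdivrMl//; apply: le_trans (ler_sum _ (fun r _ => bound r)) _.
    by rewrite sumr_const card_ord mulr_natl.
  set x := v t + r%:R / l%:R.
  have vx (t' r' : nat) : (t' <= l)%N -> (r' <= l)%N ->
      normc (v t' + r'%:R / l%:R) <= normc w + normc s + 1.
    move=> t'l r'l; apply: le_trans (normc_le_add _ _) _; apply: lerD; last exact: normc_nat_ratio_le.
    apply: le_trans (normc_le_add _ _) _; rewrite lerD2l normcM.
    by rewrite ler_piMr ?normc_ge0// normc_nat_ratio_le.
  have y1 : v t.+1 + r%:R / l%:R = x + s / l%:R.
    by rewrite /x /v -[t.+1%:R]natr1; ring.
  have y2 : v t + l%:R^-1 + r%:R / l%:R = v t + r.+1%:R / l%:R.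
    by rewrite -[r.+1%:R]natr1; ring.
  have nx := vx t r (ltnW tl) (ltnW (ltn_ord r)).
  have [_ _ e1] := h x _ nx (vx t.+1 r tl (ltnW (ltn_ord r))).
  have [_ _ e2] := h x _ nx (vx t r.+1 (ltnW tl) (ltn_ord r)).
  rewrite -y2 in e2.
  have d1 : v t.+1 + r%:R / l%:R - x = s / l%:R by rewrite y1 addrC addKr.
  have d2 : v t + l%:R^-1 + r%:R / l%:R - x = l%:R^-1 by rewrite /x; ring.
  rewrite d1 in e1; rewrite d2 in e2.
  rewrite -/x; move: (F (v t.+1 + _)) e1 (F (v t + _ + _)) e2 => f1 e1 f2 e2.
  have -> : f1 - F x - s * (f2 - F x) = (f1 - F x - s / l%:R * g x) -
     s * (f2 - F x - l%:R^-1 * g x) by ring.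
  apply: le_trans (normc_le_sub _ _) _; rewrite normcM.
  have e3 := ler_wpM2l (normc_ge0 s) e2.
  apply: le_trans (lerD e1 e3) _.
  rewrite !normcM !normcV !normc_nat exprMn exprVn /D.
  by rewrite le_eqVlt; apply/orP; left; apply/eqP; ring.
have tel t : (t <= l)%N -> normc (avg l F (v t) - avg l F w) <= t%:R * (D / l%:R ^+ 2).
  elim: t => [|t IH] tl; first by rewrite /v mul0r mulr0 addr0 subrr normc0 mul0r.
  have -> : avg l F (v t.+1) - avg l F w = (avg l F (v t.+1) - avg l F (v t)) +
    (avg l F (v t) - avg l F w) by ring.
  apply: le_trans (normc_le_add _ _) _.
  by rewrite -natr1 mulrDl mul1r addrC; apply: lerD; [apply: IH; exact: ltnW|exact: step].
have := tel l (leqnn l); rewrite /v divff// mulr1 => /le_trans; apply.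
by rewrite le_eqVlt; apply/orP; left; apply/eqP; field; rewrite gt_eqF.
Qed.

End RiemannAverages.


(** * Discrete Fourier analysis of periodic functions *)

Section FourierCoefficients.
Local Open Scope complex_scope.
Import Normc.
Variable R : realType.
Implicit Types (F G : R[i] -> R[i]) (w : R[i]) (k : int).

Definition e2pii w : R[i] := cexp (2 * 'i * (pi : R)%:C * w).

Lemma e2piiD w w' : e2pii (w + w') = e2pii w * e2pii w'.
Proof. by rewrite /e2pii mulrDr cexpD. Qed.

Lemma e2piiN w : e2pii (- w) = (e2pii w)^-1.
Proof. by rewrite /e2pii mulrN cexpN. Qed.

Lemma e2pii_int k : e2pii k%:~R = 1.
Proof. exact: cexp_2pii_int. Qed.

Lemma e2pii_neq0 w : e2pii w != 0.
Proof. exact: cexp_neq0. Qed.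

Lemma e2pii_real (x : R) : e2pii x%:C = cos (2 * pi * x) +i* sin (2 * pi * x).
Proof.
rewrite -cexp_imaginary /e2pii; congr cexp.
by rewrite !rmorphM rmorph_nat/=; ring.
Qed.

Lemma normc_e2pii_real (x : R) : normc (e2pii x%:C) = 1.
Proof. by rewrite e2pii_real /= cos2Dsin2 sqrtr1. Qed.

Definition twist k F w : R[i] := F w * e2pii (- k%:~R * w).

(** The term of frequency k, evaluated at w, in the finite Fourier series of F on the points w +
    r/l. *)
Definition dft (l : nat) k F w : R[i] := e2pii (k%:~R * w) * avg l (twist k F) w.

Lemma twist_periodic1 k F : periodic1 F -> periodic1 (twist k F).
Proof.
move=> F1 w; rewrite /twist F1 mulrDr mulr1 e2piiD -mulrNz e2pii_int mulr1 //.
Qed.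

Lemma sum_e2pii (l : nat) (m : int) : (0 < l)%N ->
  \sum_(s < l) e2pii (s%:R * (m%:~R / l%:R)) = (if (l%:Z %| m)%Z then l%:R else 0).
Proof.
move=> l0; have lC : l%:R != 0 :> R[i] by rewrite pnatr_eq0 -lt0n.
have terms (s : 'I_l) : e2pii (s%:R * (m%:~R / l%:R)) = e2pii (m%:~R / l%:R) ^+ s.
  by rewrite /e2pii -cexpMn -mulr_natl; congr cexp; ring.
rewrite (eq_bigr _ (fun s _ => terms s)); case: ifP => [/dvdzP[t ->]|ndvd].
  have -> : e2pii ((t * l%:Z)%:~R / l%:R) = 1.
    by rewrite intrM -[l%:Z%:~R]/(l%:R) mulfK// e2pii_int.
  under eq_bigr do rewrite expr1n.
  by rewrite sumr_const card_ord.
set x := e2pii _.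
have x1 : x != 1.
  apply/eqP => /cexp_eq1[t].
  have pi0 : 2 * 'i * (pi : R)%:C != 0.
    rewrite !mulf_neq0 ?pnatr_eq0//.
      by rewrite -normc_gt0 normc_i.
    by rewrite -normc_gt0 normc_real normr_gt0 gt_eqF// pi_gt0.
  move=> /(mulfI pi0) /(congr1 (fun u => u * l%:R)); rewrite mulfVK// pmulrn -intrM.
  by move=> /eqP; rewrite eqr_int => /eqP mE; rewrite mE dvdz_mull in ndvd.
have xl : x ^+ l = 1.
  rewrite /x /e2pii -cexpMn.
  have -> : 2 * 'i * (pi : R)%:C * (m%:~R / l%:R) *+ l = 2 * 'i * (pi : R)%:C * m%:~R.
    by rewrite -mulr_natr -[LHS]mulrA mulfVK.
  exact: cexp_2pii_int.
have : (x - 1) * (\sum_(i < l) x ^+ i) = 0 by rewrite -subrX1 xl subrr.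
by move=> /eqP; rewrite mulf_eq0 subr_eq0 (negbTE x1) => /eqP.
Qed.

Lemma sum_roots_of_unity (l r : nat) (c : int) : (0 < l)%N -> (r < l)%N ->
  \sum_(i < l) e2pii (- (i%:Z + c)%:~R * (r%:R / l%:R)) = (if r == 0%N then l%:R else 0).
Proof.
move=> l0 rl; transitivity (e2pii (- c%:~R * (r%:R / l%:R)) *
    \sum_(i < l) e2pii (i%:R * ((- r%:Z)%:~R / l%:R))).
  rewrite mulr_sumr; apply: eq_bigr => i _; rewrite -e2piiD; congr e2pii; ring.
rewrite sum_e2pii// dvdzE abszN /=; case: eqP => [->|/eqP r0].
  by rewrite dvdn0 mul0r mulr0 /e2pii mulr0 cexp0 mul1r.
by rewrite gtnNdvd ?mulr0// lt0n.
Qed.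

Lemma psumZ_ord (V : nmodType) (f : int -> V) (h : nat) :
  psumZ f h = \sum_(i < h + h) f (i%:Z + - h%:Z).
Proof.
rewrite /psumZ big_split big_split_ord /= [RHS]addrC; congr (_ + _).
  by apply: eq_bigr => i _; have -> : (h + i)%N%:Z + - h%:Z = i%:Z by lia.
rewrite [LHS](reindex_inj rev_ord_inj)/=; apply: eq_bigr => i _.
by have -> : - (h - i.+1).+1%:Z = i%:Z + - h%:Z by have := ltn_ord i; lia.
Qed.

(** For l = 2 h the window [-h, h) is a complete residue system modulo l, and it keeps |k| <= l / 2,
    as [dft_bound] demands. *)
Lemma dft_inversion (h : nat) F w : (0 < h)%N ->
  F w = psumZ (fun k => dft (h + h) k F w) h.
Proof.
move=> h0; have l0 : (0 < h + h)%N by rewrite addn_gt0 h0.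
have lC : (h + h)%:R != 0 :> R[i] by rewrite pnatr_eq0 -lt0n.
have -> : psumZ (fun k => dft (h + h) k F w) h =
    \sum_(i < h + h) dft (h + h) (i%:Z + - h%:Z) F w.
  exact: (psumZ_ord (fun k => dft (h + h) k F w)).
transitivity ((h + h)%:R^-1 * \sum_(r < h + h)
    (F (w + r%:R / (h + h)%:R) * \sum_(i < h + h) e2pii (- (i%:Z + - h%:Z)%:~R * (r%:R / (h + h)%:R)))).
  rewrite [X in _ * X](eq_bigr (fun r : 'I_(h + h) =>
    F (w + r%:R / (h + h)%:R) * (if r == 0%N :> nat then (h + h)%:R else 0))).
    rewrite (bigD1 (Ordinal l0))//= mul0r addr0 big1 ?addr0.
      by rewrite mulrCA mulVf ?mulr1.
    move=> r; rewrite -(inj_eq val_inj)/= => /negbTE->; exact: mulr0.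
  by move=> r _; rewrite sum_roots_of_unity.
under [in LHS]eq_bigr do rewrite mulr_sumr.
rewrite exchange_big/= mulr_sumr; apply: eq_bigr => i _.
rewrite /dft /avg mulrCA; congr (_ * _); rewrite mulr_sumr.
apply: eq_bigr => r _; rewrite /twist [RHS]mulrCA -e2piiD; congr (_ * e2pii _).
ring.
Qed.

(** Discrete form of integrating by parts twice. Passing to the second difference multiplies the
    coefficient by m + 1/m - 2, whose modulus 4 sin^2(pi k / l) is at least (k / l)^2 for |k| <= l /
    2. The second difference itself is at most 2 C / l^2, so the powers of l cancel and the bound is
    uniform in l. *)
Lemma dft_bound F w : sholo F -> periodic1 F -> exists2 C, 0 <= C & forall (l : nat) k,
  (0 < `|k|)%N -> (`|k| * 2 <= l)%N -> normc (dft l k F w) <= C / `|k|%:R ^+ 2.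
Proof.
move=> [g hg] F1; have [C {}hg] := hg (normc w + 1 + 1).
have C0 : 0 <= C.
  have [] := hg 0 0; rewrite ?normc0 ?addr_ge0 ?normc_ge0//.
  by move=> a _ _; apply: le_trans (normc_ge0 _) a.
exists (2 * C) => [|l k k0 kl]; first by rewrite mulr_ge0.
have l0 : (0 < l)%N by lia.
have lR : 0 < l%:R :> R by rewrite ltr0n.
have lC : l%:R != 0 :> R[i] by rewrite pnatr_eq0 -lt0n.
pose D x := F (x + l%:R^-1) - F x + (F (x - l%:R^-1) - F x).
pose m := e2pii (k%:~R / l%:R).
(* The twisted average diagonalizes the second difference operator. *)
have diag : avg l (twist k D) w = (m + m^-1 - 2) * avg l (twist k F) w.
  have t1 := avg_shift l w (twist_periodic1 k F1).
  have t2 := avg_shift l (w - l%:R^-1) (twist_periodic1 k F1).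
  rewrite subrK in t2.
  have -> : (m + m^-1 - 2) * avg l (twist k F) w =
    m * avg l (twist k F) (w + l%:R^-1) + m^-1 * avg l (twist k F) (w - l%:R^-1)
     - 2 * avg l (twist k F) w by rewrite t1 -t2; ring.
  rewrite /avg !(mulrCA _ l%:R^-1) -mulrDr -mulrBr; congr (_ * _).
  rewrite !mulr_sumr -big_split/= -sumrB; apply: eq_bigr => r _.
  have -> : w + l%:R^-1 + r%:R / l%:R = w + r%:R / l%:R + l%:R^-1 by ring.
  have -> : w - l%:R^-1 + r%:R / l%:R = w + r%:R / l%:R - l%:R^-1 by ring.
  move: (w + r%:R / l%:R) => x; rewrite /twist /D.
  have -> : m * (F (x + l%:R^-1) * e2pii (- k%:~R * (x + l%:R^-1))) =
      F (x + l%:R^-1) * e2pii (- k%:~R * x).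
    by rewrite mulrCA -e2piiD; congr (_ * e2pii _); ring.
  have -> : m^-1 * (F (x - l%:R^-1) * e2pii (- k%:~R * (x - l%:R^-1))) =
      F (x - l%:R^-1) * e2pii (- k%:~R * x).
    by rewrite /m -e2piiN mulrCA -e2piiD; congr (_ * e2pii _); ring.
  ring.
have m_norm : 1 / (l%:R ^+ 2) * `|k|%:R ^+ 2 <= normc (m + m^-1 - 2).
  have mE : m = e2pii (k%:~R / l%:R : R)%:C.
    by rewrite /m rmorphM fmorphV/= rmorph_int rmorph_nat.
  rewrite {2}mE mE -e2piiN -rmorphN !e2pii_real mulrN cosN sinN.
  set y := 2 * pi * (k%:~R / l%:R).
  have -> : (cos y +i* sin y)%C + (cos y -i* sin y)%C - 2 = (- (2 * (1 - cos y)))%:C.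
    apply/eqP; rewrite eq_complex /=; apply/andP; split; apply/eqP; ring.
  rewrite normc_real normrN one_sub_cos ger0_norm; last by rewrite mulr_ge0// mulr_ge0// sqr_ge0.
  have -> : sin (y / 2) ^+ 2 = sin (pi * (`|k|%:R / l%:R)) ^+ 2.
    have -> : y / 2 = pi * (k%:~R / l%:R) by rewrite /y; field; rewrite gt_eqF.
    have [kpos|kneg] := leP 0 k.
      by rewrite -{1}(gez0_abs kpos) -pmulrn.
    have -> : k%:~R = - `|k|%:R :> R by rewrite pmulrn ltz0_abs// mulrNz opprK.
    by rewrite mulNr mulrN sinN sqrrN.
  have p2 := pi_ge2 R.
  have t0 : 0 <= `|k|%:R / l%:R :> R by rewrite divr_ge0.
  have t1 : `|k|%:R / l%:R <= 1 / 2 :> R.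
    rewrite ler_pdivrMr// mul1r mulrC -ler_pdivrMr ?invr_gt0// invrK.
    by rewrite -natrM ler_nat.
  have -> : 1 / l%:R ^+ 2 * `|k|%:R ^+ 2 = (`|k|%:R / l%:R) ^+ 2 :> R.
    by rewrite exprMn exprVn; ring.
  move: (_ / _) t0 t1 => t t0 t1.
  have : pi * t / 4 <= sin (pi * t).
    by apply: sin_ge_quarter; apply/andP; split; nra.
  move: (sin _) => u hu.
  have : t / 2 <= u by nra.
  by move=> tu; nra.
have D_bound : normc (avg l (twist k D) w) <= normc (e2pii (- k%:~R * w)) * (2 * C / l%:R ^+ 2).
  rewrite /avg normcM normcV normc_nat ler_pdivrMl//.
  apply: le_trans (normc_sum _ _ _) _.
  suff bound (r : 'I_l) : normc (twist k D (w + r%:R / l%:R)) <=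
      normc (e2pii (- k%:~R * w)) * (2 * C / l%:R ^+ 2).
    apply: le_trans (ler_sum _ (fun r _ => bound r)) _.
    by rewrite sumr_const card_ord [leRHS]mulr_natl.
  rewrite /twist normcM mulrC; apply: ler_pM; rewrite ?normc_ge0//.
    have unimodular : normc (e2pii (- k%:~R * (r%:R / l%:R))) = 1 :> R.
      have -> : - k%:~R * (r%:R / l%:R) = (- k%:~R * (r%:R / l%:R))%:C :> R[i].
        by rewrite !(rmorphM, rmorphN, fmorphV)/= rmorph_int !rmorph_nat.
      exact: normc_e2pii_real.
    by rewrite mulrDr e2piiD normcM unimodular mulr1.
  set x := w + r%:R / l%:R.
  have vR : normc (l%:R^-1 : R[i]) <= 1.
    by rewrite -[_^-1]mul1r; exact: (@normc_nat_ratio_le R 1 l l0).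
  have xw : normc x <= normc w + 1.
    apply: le_trans (normc_le_add _ _) _; rewrite lerD2l.
    by apply: normc_nat_ratio_le; exact: ltnW.
  have x0 : normc x <= normc w + 1 + 1 by lra.
  have x1 : normc (x + l%:R^-1) <= normc w + 1 + 1.
    exact: le_trans (normc_le_add _ _) (lerD xw vR).
  have x2 : normc (x - l%:R^-1) <= normc w + 1 + 1.
    exact: le_trans (normc_le_sub _ _) (lerD xw vR).
  have [_ _ e1] := hg _ _ x0 x1; have [_ _ e2] := hg _ _ x0 x2.
  rewrite (addrC x) addrK [l%:R^-1 + x]addrC normcV normc_nat in e1.
  rewrite (addrC x) addrK [- _ + x]addrC normc_opp normcV normc_nat in e2.
  (* The first-order terms at 1/l and -1/l cancel and leave two quadratic remainders. *)
  have -> : D x = (F (x + l%:R^-1) - F x - l%:R^-1 * g x) +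
     (F (x - l%:R^-1) - F x - - l%:R^-1 * g x) by rewrite /D; ring.
  apply: le_trans (normc_le_add _ _) _.
  move: e1 e2; rewrite exprVn; lra.
rewrite diag normcM in D_bound.
rewrite /dft normcM.
have e0 : 0 < normc (e2pii (- k%:~R * w)) by rewrite normc_gt0 e2pii_neq0.
have -> : normc (e2pii (k%:~R * w)) = (normc (e2pii (- k%:~R * w)))^-1.
  by rewrite -normcV -e2piiN mulNr opprK.
rewrite ler_pdivrMl//.
have kR : 0 < `|k|%:R ^+ 2 :> R by rewrite exprn_gt0// ltr0n.
have l2 : 0 < l%:R ^+ 2 :> R by rewrite exprn_gt0.
have h1 := le_trans (ler_wpM2r (normc_ge0 _) m_norm) D_bound.
rewrite mulrA ler_pdivlMr//.
move: h1; rewrite -(ler_pM2l l2).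
have -> : l%:R ^+ 2 * (1 / l%:R ^+ 2 * `|k|%:R ^+ 2 * normc (avg l (twist k F) w)) =
  normc (avg l (twist k F) w) * `|k|%:R ^+ 2 by field; rewrite gt_eqF.
move=> /le_trans; apply; rewrite le_eqVlt; apply/orP; left; apply/eqP.
by field; rewrite gt_eqF.
Qed.

End FourierCoefficients.


Section Uniqueness.
Local Open Scope complex_scope.
Import Normc.
Variable R : realType.
Implicit Types (F G : R[i] -> R[i]) (w : R[i]).

Definition quasi_periodic (tau : R[i]) (b : int -> R[i]) F :=
  forall k w, twist k F w = b k * F (w + k%:~R * tau).

Definition trunc_theta (b : int -> R[i]) K w : R[i] :=
  psumZ (fun k => e2pii (k%:~R * w) * b k) K.

(** Telescoping of k^{-2} <= 1/(k - 1) - 1/k. *)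
Lemma sum_inv_sqr_le (K h : nat) : (1 < K)%N -> (K <= h)%N ->
  \sum_(K <= k < h) k%:R ^- 2 <= K.-1%:R^-1 - h.-1%:R^-1 :> R.
Proof.
case: K => [//|[//|K]] _; elim: h => [//|h IH]; rewrite leq_eqVlt => /orP[/eqP<-|].
  by rewrite big_geq// subrr.
rewrite ltnS => Kh; rewrite big_nat_recr//=; have {}IH := IH Kh.
apply: le_trans (lerD IH (lexx _)) _.
case: h Kh {IH} => [//|h] Kh /=.
have h0 : 0 < h%:R :> R by rewrite ltr0n; lia.
rewrite -[h.+1%:R]natr1 -subr_ge0.
have -> : K.+1%:R^-1 - (h%:R + 1)^-1 - (K.+1%:R^-1 - h%:R^-1 + (h%:R + 1) ^- 2) =
  h%:R^-1 * (h%:R + 1) ^- 2 :> R.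
  have : h%:R + 1 != 0 :> R by apply: lt0r_neq0; lra.
  have : h%:R != 0 :> R by rewrite gt_eqF.
  have : K.+1%:R != 0 :> R by rewrite pnatr_eq0.
  by move: K.+1%:R => k kn hn h1; field; rewrite kn hn h1.
by rewrite mulr_ge0 ?invr_ge0 ?exprn_ge0 ?ltW//; lra.
Qed.

(** Quasi-periodicity turns a twisted average at w into b_k times the plain average at w + k tau,
    which [avg_shift_le] moves to 0. For fixed K the errors add up to a single constant. *)
Lemma trunc_theta_avg F tau b w K : sholo F -> periodic1 F -> quasi_periodic tau b F ->
  exists C, forall l, (0 < l)%N ->
    normc (psumZ (fun k => dft l k F w) K - avg l F 0 * trunc_theta b K w) <= C / l%:R.
Proof.
move=> sF F1 qF.
have term k : exists C, forall l, (0 < l)%N ->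
    normc (dft l k F w - avg l F 0 * (e2pii (k%:~R * w) * b k)) <= C / l%:R.
  have [C hC] := avg_shift_le 0 (w + k%:~R * tau) sF F1.
  exists (normc (e2pii (k%:~R * w) * b k) * C) => l l0.
  have -> : dft l k F w = e2pii (k%:~R * w) * b k * avg l F (0 + (w + k%:~R * tau)).
    rewrite /dft -mulrA add0r; congr (_ * _).
    rewrite /avg mulrCA; congr (_ * _); rewrite mulr_sumr; apply: eq_bigr => r _.
    by rewrite qF; congr (_ * F _); ring.
  rewrite [avg l F 0 * _]mulrC -mulrBr normcM -[leRHS]mulrA.
  exact: ler_wpM2l (normc_ge0 _) _ _ (hC l l0).
elim: K => [|K [C hC]].
  by exists 0 => l _; rewrite /trunc_theta /psumZ !big_ord0 mulr0 subrr normc0 mul0r.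
have [C1 h1] := term K%:Z; have [C2 h2] := term (- K.+1%:Z).
exists (C + C1 + C2) => l l0; rewrite /trunc_theta !psumZ_recr -/(trunc_theta b K w).
rewrite !mulrDr !mulrDl.
set T1 := dft l _ F w; set T2 := dft l _ F w.
set A1 := avg l F 0 * (e2pii (K%:~R * w) * _).
set A2 := avg l F 0 * (e2pii (_ * w) * b (- _)).
have -> : psumZ (fun k => dft l k F w) K + (T1 + T2) -
   (avg l F 0 * trunc_theta b K w + (A1 + A2)) =
   (psumZ (fun k => dft l k F w) K - avg l F 0 * trunc_theta b K w)
    + (T1 - A1) + (T2 - A2) by ring.
apply: le_trans (normc_le_add _ _) (lerD _ (h2 l l0)).
by apply: le_trans (normc_le_add _ _) (lerD (hC l l0) (h1 l l0)).
Qed.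

Lemma approx_trunc_theta F tau b w e : 0 < e ->
  sholo F -> periodic1 F -> quasi_periodic tau b F ->
  exists K0, forall K, (K0 <= K)%N -> exists h0, forall h, (h0 <= h)%N ->
    normc (F w - avg (h + h) F 0 * trunc_theta b K w) <= e.
Proof.
move=> e0 sF F1 qF; have [D D0 hD] := dft_bound w sF F1.
have e2 : 0 < e / 2 by rewrite divr_gt0.
(* The terms beyond K sum to at most 2 D / (K - 1), which this choice keeps below e / 2. *)
pose K0 := (Num.truncn (4 * D / e)).+2.
exists K0 => K KK; have [C hC] := trunc_theta_avg w K sF F1 qF.
(* Chosen after K, on which C depends, so that C / (2 h) <= e / 2. *)
pose h0 := (Num.truncn (`|C| / e)).+1.
exists (maxn K h0) => h; rewrite geq_max => /andP[Kh h0h].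
have h0' : (0 < h)%N by apply: leq_trans h0h.
rewrite {1}(dft_inversion F w h0').
set d := fun k => dft _ k _ _.
have -> : psumZ d h = psumZ d K + \sum_(K <= k < h) (d k%:Z + d (- k.+1%:Z)).
  by rewrite /psumZ -!(big_mkord xpredT (fun k => d k%:Z + d (- k.+1%:Z))) -big_cat_nat.
rewrite addrAC [e](splitr e).
apply: le_trans (normc_le_add _ _) (lerD _ _).
  apply: le_trans (hC _ _) _; first by rewrite addn_gt0 h0'.
  rewrite ler_pdivrMr ?ltr0n ?addn_gt0 ?h0'//.
  apply: le_trans (ler_norm _) _.
  have -> : e / 2 * (h + h)%:R = h%:R * e by rewrite natrD; field.
  rewrite -ler_pdivrMr//.
  apply: ltW; apply: lt_le_trans (truncnS_gt _) _.
  by rewrite ler_nat.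
have tail k : (K <= k < h)%N -> normc (d k%:Z + d (- k.+1%:Z)) <= 2 * D * k%:R ^- 2.
  move=> /andP[Kk kh]; apply: le_trans (normc_le_add _ _) _.
  have k0 : (0 < k)%N by lia.
  have b1 := hD (h + h)%N k%:Z k0 _.
  have b2 := hD (h + h)%N (- k.+1%:Z) _ _.
  have {}b1 : normc (d k%:Z) <= D * k%:R ^- 2 by apply: b1; lia.
  have {}b2 : normc (d (- k.+1%:Z)) <= D * k.+1%:R ^- 2 by apply: b2; lia.
  have b3 : D * k.+1%:R ^- 2 <= D * k%:R ^- 2.
    apply: ler_wpM2l => //; rewrite lef_pV2 ?posrE ?exprn_gt0 ?ltr0n//.
    by apply: lerXn2r; rewrite ?nnegrE ?ler0n// ler_nat.
  by move: b1 b2 b3; move: (_ ^- 2) (_ ^- 2) => x y; lra.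
apply: le_trans (normc_sum _ _ _) _.
rewrite big_nat; apply: le_trans (ler_sum _ tail) _; rewrite -big_nat -mulr_sumr.
have K1 : (1 < K)%N by apply: leq_trans KK.
apply: le_trans (ler_wpM2l _ (sum_inv_sqr_le K1 Kh)) _; first by rewrite mulr_ge0.
have KR : 0 < K.-1%:R :> R by rewrite ltr0n; lia.
have hR : 0 <= h.-1%:R^-1 :> R by rewrite invr_ge0.
have : 2 * D * K.-1%:R^-1 <= e / 2.
  have : 4 * D / e <= K.-1%:R.
    apply: ltW; apply: lt_le_trans (truncnS_gt _) _.
    by rewrite ler_nat; move: KK; rewrite /K0; move: (Num.truncn _) => n; lia.
  by rewrite !ler_pdivrMr//; lra.
have := mulr_ge0 D0 hR; lra.
Qed.

(* Both functions are multiples of the same truncated theta series, up to small errors. *)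
Theorem quasi_periodic_proportional F G tau b w w' :
  sholo F -> periodic1 F -> quasi_periodic tau b F ->
  sholo G -> periodic1 G -> quasi_periodic tau b G ->
  F w * G w' = F w' * G w.
Proof.
move=> sF F1 qF sG G1 qG; apply/eqP; rewrite -subr_eq0; apply/eqP.
apply: eq0_of_normc_le => e0 e0_gt0.
(* The four summands are the cofactors of the errors in the expansion below. Capping e at 1 is what
   gives |c T| <= |F w| + 1, and likewise at w'. *)
pose M := normc (G w') + (normc (F w) + 1) + normc (G w) + (normc (F w') + 1).
have M0 : 0 < M by rewrite /M; have := @normc_ge0 R; move=> p; have := p (G w');
  have := p (F w); have := p (G w); have := p (F w'); lra.
pose e := Num.min 1 (e0 / M).
have e_gt0 : 0 < e by rewrite lt_min ltr01 divr_gt0.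
have e_le1 : e <= 1 by rewrite ge_min lexx.
have [K1 h1] := approx_trunc_theta w e_gt0 sF F1 qF.
have [K2 h2] := approx_trunc_theta w' e_gt0 sF F1 qF.
have [K3 h3] := approx_trunc_theta w e_gt0 sG G1 qG.
have [K4 h4] := approx_trunc_theta w' e_gt0 sG G1 qG.
pose K := maxn (maxn K1 K2) (maxn K3 K4).
have [|n1 {}h1] := h1 K; first by rewrite /K; lia.
have [|n2 {}h2] := h2 K; first by rewrite /K; lia.
have [|n3 {}h3] := h3 K; first by rewrite /K; lia.
have [|n4 {}h4] := h4 K; first by rewrite /K; lia.
pose h := maxn (maxn n1 n2) (maxn n3 n4).
have {}h1 : normc _ <= e := h1 h ltac:(rewrite /h; lia).
have {}h2 : normc _ <= e := h2 h ltac:(rewrite /h; lia).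
have {}h3 : normc _ <= e := h3 h ltac:(rewrite /h; lia).
have {}h4 : normc _ <= e := h4 h ltac:(rewrite /h; lia).
move: (avg _ F 0) (avg _ G 0) (trunc_theta b K w) (trunc_theta b K w') h1 h2 h3 h4.
move=> c c' T T' h1 h2 h3 h4.
have -> : F w * G w' - F w' * G w = (F w - c * T) * G w' + c * T * (G w' - c' * T')
   - ((F w' - c * T') * G w + c * T' * (G w - c' * T)) by ring.
have cT : normc (c * T) <= normc (F w) + 1.
  by have := normc_le_sub (F w) (F w - c * T); rewrite opprB addrC subrK; lra.
have cT' : normc (c * T') <= normc (F w') + 1.
  by have := normc_le_sub (F w') (F w' - c * T'); rewrite opprB addrC subrK; lra.
have e_ge0 := ltW e_gt0.
have : e * M <= e0 by rewrite -ler_pdivlMr// ge_min lexx orbT.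
apply: le_trans.
apply: le_trans (normc_le_sub _ _) _.
have s1 := normc_le_add ((F w - c * T) * G w') (c * T * (G w' - c' * T')).
have s2 := normc_le_add ((F w' - c * T') * G w) (c * T' * (G w - c' * T)).
move: s1 s2; rewrite !normcM -!(normcM c) => s1 s2.
have m1 := ler_wpM2r (normc_ge0 (G w')) h1.
have m2 := ler_pM (normc_ge0 _) (normc_ge0 _) cT h4.
have m3 := ler_wpM2r (normc_ge0 (G w)) h2.
have m4 := ler_pM (normc_ge0 _) (normc_ge0 _) cT' h3.
rewrite /M; lra.
Qed.

End Uniqueness.

(** * The Jacobi triple product *)


Section QBinomial.
Variable K : fieldType.
Implicit Types p y : K.

(** Gaussian binomial coefficients by a Pascal rule, which avoids dividing by 1 - p^i. The exponent
    is truncated only in front of a coefficient that vanishes. *)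
Fixpoint qbin p (M j : nat) : K :=
  match M, j with
  | _, 0 => 1
  | 0, _.+1 => 0
  | M'.+1, j'.+1 => qbin p M' j'.+1 + p ^+ (M' - j') * qbin p M' j'
  end.

Definition qpoch p (n : nat) : K := \prod_(i < n) (1 - p ^+ i.+1).

Lemma qbin_n0 p M : qbin p M 0 = 1. Proof. by case: M. Qed.

Lemma qbin_gt p M j : (M < j)%N -> qbin p M j = 0.
Proof.
elim: M j => [|M IH] [|j]//= Mj.
by rewrite !IH ?mulr0 ?addr0//; exact: ltnW.
Qed.

Lemma qbin_qpoch p M j : (j <= M)%N ->
  qbin p M j * (qpoch p j * qpoch p (M - j)) = qpoch p M.
Proof.
elim: M j => [|M IH] [|j]//=.
- by rewrite /qpoch !big_ord0 !mul1r.
- by rewrite /qpoch big_ord0 subn0 !mul1r.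
rewrite ltnS subSS => jM.
have qS n : qpoch p n.+1 = qpoch p n * (1 - p ^+ n.+1) by rewrite /qpoch big_ord_recr.
have IHj := IH j jM.
have := jM; rewrite leq_eqVlt => /orP[/eqP e|lt_jM].
  rewrite -{}e in IHj *; rewrite subnn in IHj *.
  by rewrite qbin_gt// add0r expr0 mul1r !qS -[in RHS]IHj; ring.
have IHj1 := IH j.+1 lt_jM.
have qMj : qpoch p (M - j) = qpoch p (M - j.+1) * (1 - p ^+ (M - j)).
  by rewrite -subnSK// qS.
rewrite mulrDl.
have -> : qbin p M j.+1 * (qpoch p j.+1 * qpoch p (M - j)) = qpoch p M * (1 - p ^+ (M - j)).
  by rewrite qMj -IHj1; ring.
have -> : p ^+ (M - j) * qbin p M j * (qpoch p j.+1 * qpoch p (M - j)) =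
    qpoch p M * (p ^+ (M - j) * (1 - p ^+ j.+1)).
  by rewrite qS -IHj; ring.
rewrite qS -mulrDr; congr (_ * _).
have -> : p ^+ M.+1 = p ^+ (M - j) * p ^+ j.+1 by rewrite -exprD; congr (_ ^+ _); lia.
ring.
Qed.

(** Rothe's identity; multiplication by the last factor is the Pascal rule of [qbin]. *)
Lemma qbinomial_theorem p y M : \prod_(k < M) (1 + y * p ^+ k) =
  \sum_(j < M.+1) p ^+ 'C(j, 2) * qbin p M j * y ^+ j.
Proof.
elim: M => [|M IH]; first by rewrite big_ord0 big_ord1 /= !mulr1.
have shift : \sum_(j < M.+1) p ^+ 'C(j, 2) * qbin p M j * y ^+ j =
    1 + \sum_(j < M.+1) p ^+ 'C(j.+1, 2) * qbin p M j.+1 * y ^+ j.+1.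
  rewrite [LHS]big_ord_recl [in RHS]big_ord_recr/= qbin_n0.
  rewrite (qbin_gt _ (ltnSn M)).
  by rewrite !expr0 !mulr1 mulr0 mul0r addr0.
rewrite big_ord_recr/= IH [RHS]big_ord_recl/= !expr0 !mulr1 mulrDr mulr1 {1}shift.
rewrite -addrA; congr (_ + _); rewrite mulr_suml -big_split/=.
apply: eq_bigr => j _; rewrite [in RHS]mulrDr [in RHS]mulrDl; congr (_ + _).
rewrite binS bin1 exprD [y ^+ j.+1]exprS.
have -> : p ^+ M = p ^+ (M - j) * p ^+ j.
  by rewrite -exprD; congr (_ ^+ _); have := ltn_ord j; lia.
by rewrite add0n; move: (p ^+ (M - j)) => e; ring.
Qed.

End QBinomial.

Section JacobiProduct.
Local Open Scope complex_scope.
Import Normc.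
Variable R : realType.
Implicit Types (beta gamma : R[i]).

(** This is e^gamma p^{k + 1/2} for p = e^{2 beta}, written so that no square root of p has to be
    chosen. *)
Definition jacobi_factor beta gamma (k : nat) : R[i] :=
  cexp (gamma + (2 * k%:R + 1) * beta).

Definition jacobi_prod beta gamma (n : nat) : R[i] :=
  \prod_(k < n) ((1 + jacobi_factor beta gamma k) * (1 + jacobi_factor beta (- gamma) k)).

(** The finite triple product: take 2 n factors in the q-binomial theorem and y = e^gamma p^{1/2 -
    n}, which centres the exponents. Extracting the leading monomial from each of the first n
    factors turns them into the factors for - gamma. *)
Lemma jacobi_prod_sum beta gamma n : jacobi_prod beta gamma n =
  \sum_(j < (n + n).+1) qbin (cexp (2 * beta)) (n + n) j *
     theta_term beta gamma (j%:Z - n%:Z).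
Proof.
set p := cexp (2 * beta); pose y := cexp (gamma + (1 - 2 * n%:R) * beta).
have pX k : p ^+ k = cexp (2 * k%:R * beta).
  by rewrite /p -cexpMn; congr cexp; rewrite -mulr_natr; ring.
have half m : \prod_(k < m) (1 + cexp (gamma + (1 - 2 * m%:R) * beta) * p ^+ k) =
    cexp (m%:R * gamma - m%:R ^+ 2 * beta) * \prod_(k < m) (1 + jacobi_factor beta (- gamma) k).
  rewrite (reindex_inj rev_ord_inj)/=.
  transitivity (\prod_(k < m) (cexp (gamma - (2 * k%:R + 1) * beta) * (1 + jacobi_factor beta (- gamma) k))).
    apply: eq_bigr => k _; rewrite pX -cexpD mulrDr mulr1 /jacobi_factor -cexpD.
    rewrite [RHS]addrC; congr (_ + cexp _).
      by rewrite -cexp0; congr cexp; ring.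
    rewrite natrB// -natr1; ring.
  rewrite big_split/=; congr (_ * _); elim: m => [|m IH].
    by rewrite big_ord0 mul0r expr0n mul0r subrr cexp0.
  by rewrite big_ord_recr/= IH -cexpD; congr cexp; rewrite -natr1; ring.
have prodE : \prod_(k < n + n) (1 + y * p ^+ k) =
    cexp (n%:R * gamma - n%:R ^+ 2 * beta) * jacobi_prod beta gamma n.
  rewrite big_split_ord/= half /jacobi_prod big_split/=.
  rewrite -mulrA; congr (_ * _); rewrite mulrC; congr (_ * _).
  apply: eq_bigr => k _; rewrite pX -cexpD /jacobi_factor.
  by congr (1 + cexp _); rewrite natrD; ring.
apply: (mulfI (cexp_neq0 (n%:R * gamma - n%:R ^+ 2 * beta))).
rewrite -prodE qbinomial_theorem mulr_sumr; apply: eq_bigr => j _.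
rewrite [RHS]mulrCA mulrAC [LHS]mulrC; congr (_ * _).
rewrite pX /y -cexpMn -!cexpD /theta_term; congr cexp.
have -> : (2 * ('C(j, 2))%:R * beta) = (j%:R ^+ 2 - j%:R) * beta.
  congr (_ * _); elim: (nat_of_ord j) => [|i IHi]; first by rewrite bin0n mulr0 expr0n subrr.
  by rewrite binS bin1 natrD mulrDr IHi -natr1; ring.
rewrite -mulr_natr; ring.
Qed.

End JacobiProduct.


(** * Infinite products dominated by a geometric series *)

Section GeometricProducts.
Local Open Scope complex_scope.
Import Normc.
Variable R : realType.
Variables (a : nat -> R[i]) (c rho : R).
Hypotheses (c0 : 0 <= c) (rho0 : 0 <= rho) (rho1 : rho < 1).
Hypothesis a_le : forall k, normc (a k) <= c * rho ^+ k.

Lemma geometric_small (C e : R) : 0 <= C -> 0 < e -> exists n0, forall n, (n0 <= n)%N ->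
  C * rho ^+ n <= e.
Proof.
move=> C0 e0; have C1 : 0 < C + 1 by lra.
have : (fun n => rho ^+ n) @ \oo --> (0 : R) by apply: cvg_expr; rewrite ger0_norm.
move=> /cvgrPdist_le/(_ _ (divr_gt0 e0 C1))[n0 _ h].
exists n0 => n /h; rewrite /= sub0r normrN ger0_norm ?exprn_ge0// => le_e.
apply: le_trans (ler_wpM2l C0 le_e) _.
by rewrite mulrA ler_pdivrMr// mulrC ler_wpM2l ?ltW//; lra.
Qed.

Lemma geometric_sum_le (K n : nat) :
  (1 - rho) * \sum_(K <= k < K + n) c * rho ^+ k <= c * rho ^+ K.
Proof.
suff -> : (1 - rho) * \sum_(K <= k < K + n) c * rho ^+ k = c * rho ^+ K - c * rho ^+ (K + n).
  by rewrite gerBl mulr_ge0 ?exprn_ge0.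
elim: n => [|n IH]; first by rewrite addn0 big_geq// mulr0 subrr.
by rewrite addnS big_nat_recr ?leq_addr//= mulrDr IH exprS; ring.
Qed.

Lemma geometric_prod_le : exists2 B, 0 < B & forall n, normc (\prod_(k < n) (1 + a k)) <= B.
Proof.
exists (expR (c / (1 - rho))); first exact: expR_gt0.
move=> n; have r1 : 0 < 1 - rho by rewrite subr_gt0.
apply: (@le_trans _ _ (expR (\sum_(k < n) c * rho ^+ k))).
  elim: n => [|n IH]; first by rewrite !big_ord0 normc1 expR0.
  rewrite !big_ord_recr/= normcM expRD; apply: ler_pM; rewrite ?normc_ge0//.
  apply: le_trans (normc_le_add _ _) _; rewrite normc1.
  apply: le_trans (expR_ge1Dx _); by rewrite lerD2l.
rewrite ler_expR ler_pdivlMr// mulrC.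
by have := geometric_sum_le 0 n; rewrite add0n big_mkord expr0 mulr1.
Qed.

(** Beyond some K the bounds sum to at most 1/2, so the Weierstrass inequality keeps the product of
    the tail above 1/2. The finitely many earlier partial products have a positive minimum because
    no factor vanishes. *)
Lemma geometric_prod_ge : (forall k, 1 + a k != 0) ->
  exists2 d, 0 < d & forall n, d <= normc (\prod_(k < n) (1 + a k)).
Proof.
move=> a_neq; have r1 : 0 < 1 - rho by rewrite subr_gt0.
have gc : 0 <= c / (1 - rho) by rewrite divr_ge0// ltW.
have half : 0 < 2^-1 :> R by rewrite invr_gt0.
have [K hK] := geometric_small gc half.
have [d d0 hd] : exists2 d, 0 < d & forall n, (n <= K)%N -> d <= normc (\prod_(k < n) (1 + a k)).
  elim: K {hK} => [|K [d d0 IH]].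
    by exists 1 => // n; rewrite leqn0 => /eqP->; rewrite big_ord0 normc1.
  exists (Num.min d (normc (\prod_(k < K.+1) (1 + a k)))).
    rewrite lt_min d0 normc_gt0; apply/prodf_neq0 => k _; exact: a_neq.
  move=> n; rewrite leq_eqVlt => /orP[/eqP->|]; first by rewrite ge_min lexx orbT.
  by rewrite ltnS => /IH; rewrite ge_min => ->.
have tail n : 1 - \sum_(K <= k < K + n) c * rho ^+ k <= normc (\prod_(K <= k < K + n) (1 + a k)) .
  elim: n => [|n IH]; first by rewrite addn0 !big_geq// normc1 subr0.
  rewrite addnS !big_nat_recr ?leq_addr//=.
  set s := \sum_(_ <= k < _) _ in IH *; set P := \prod_(_ <= k < _) _ in IH *.
  have s0 : 0 <= s by apply: sumr_ge0 => k _; rewrite mulr_ge0 ?exprn_ge0.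
  have := a_le (K + n); set t := c * _ => at_.
  have t0 := le_trans (normc_ge0 _) at_.
  have : 1 - t <= normc (1 + a (K + n)%N).
    have := normc_le_sub (1 + a (K + n)%N) (a (K + n)%N); rewrite addrK normc1; lra.
  rewrite normcM; have := normc_ge0 P; have := normc_ge0 (1 + a (K + n)%N).
  move: (normc P) (normc (1 + _)) IH => u v hu v0 u0 hv.
  have [t1|t1] := leP 1 t; first by have := mulr_ge0 u0 v0; lra.
  have := ler_wpM2l u0 hv.
  have [s1|s1] := leP 1 s; first by have := mulr_ge0 u0 v0; lra.
  nra.
exists (d / 2); first by rewrite divr_gt0.
move=> n; have [nK|Kn] := leqP n K; first by have := hd n nK; lra.
have -> : \prod_(k < n) (1 + a k) = (\prod_(k < K) (1 + a k)) * \prod_(K <= k < n) (1 + a k).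
  by rewrite -!(big_mkord xpredT (fun k => 1 + a k)) -big_cat_nat// ltnW.
rewrite normcM; apply: ler_pM => //; first exact: ltW; first exact: hd.
have := tail (n - K)%N; rewrite subnKC 1?ltnW//.
have := geometric_sum_le K (n - K); rewrite subnKC 1?ltnW// mulrC -ler_pdivlMr//.
have := hK K (leqnn K); rewrite mulrAC; clear a_le a_neq hd; lra.
Qed.

End GeometricProducts.

Section Tannery.
Local Open Scope complex_scope.
Import Normc.
Variable R : realType.

(** Dominated convergence for series: beyond a fixed K the tail of |u| times B + 1 controls the
    difference, and below K only finitely many coefficients have to converge. *)
Lemma tannery (u : int -> R[i]) (d : nat -> int -> R[i]) (B : R) :
  abs_summableZ u -> (forall n m, normc (d n m) <= B) ->
  (forall m e, 0 < e -> exists n0, forall n, (n0 <= n)%N -> normc (d n m - 1) <= e) ->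
  forall e, 0 < e -> exists n0, forall n, (n0 <= n)%N ->
    normc (psumZ (fun m => d n m * u m) n - sumZ u) <= e.
Proof.
move=> su dB d1 e e0; have [M uM] := su.
have B0 : 0 <= B := le_trans (normc_ge0 _) (dB 0%N 0).
pose v k := normc (u k%:Z) + normc (u (- k.+1%:Z)).
have v0 k : 0 <= v k by rewrite addr_ge0 ?normc_ge0.
have [|l hl] := @real_abs_series R v M.
  by move=> n; apply: le_trans (uM n); apply: ler_sum => k _; rewrite ger0_norm.
have e1 : 0 < e / 4 / (B + 1) by rewrite !divr_gt0//; lra.
have [K {}hl] := hl _ e1.
have e4 : 0 < e / 4 by rewrite divr_gt0.
have [n1 h1] := sumZ_approx su e4.
have [n2 h2] : exists n0, forall n, (n0 <= n)%N ->
    normc (psumZ (fun m => (d n m - 1) * u m) K) <= e / 4.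
  have small m e' : 0 < e' -> exists n0, forall n, (n0 <= n)%N -> normc ((d n m - 1) * u m) <= e'.
    move=> e'0; have um : 0 < normc (u m) + 1 by have := normc_ge0 (u m); lra.
    have [n0 h] := d1 m _ (divr_gt0 e'0 um); exists n0 => n /h; rewrite normcM => h'.
    apply: le_trans (ler_wpM2r (normc_ge0 _) h') _.
    by rewrite mulrAC ler_pdivrMr// ler_wpM2l ?ltW//; lra.
  elim: K (e / 4) e4 {hl h1} => [|k IH] e' e'0.
    by exists 0%N => n _; rewrite /psumZ big_ord0 normc0 ltW.
  have e'3 : 0 < e' / 3 by rewrite divr_gt0.
  have [m1 g1] := IH _ e'3; have [m2 g2] := small k%:Z _ e'3.
  have [m3 g3] := small (- k.+1%:Z) _ e'3.
  exists (maxn m1 (maxn m2 m3)) => n; rewrite !geq_max => /and3P[/g1 {}g1 /g2 {}g2 /g3 {}g3].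
  rewrite psumZ_recr; apply: le_trans (normc_le_add _ _) _.
  have := normc_le_add ((d n k%:Z - 1) * u k%:Z) ((d n (- k.+1%:Z) - 1) * u (- k.+1%:Z)).
  lra.
exists (maxn K (maxn n1 n2)) => n; rewrite !geq_max => /and3P[Kn /h1 {}h1 /h2 {}h2].
have -> : psumZ (fun m => d n m * u m) n - sumZ u =
   psumZ (fun m => (d n m - 1) * u m) n - (sumZ u - psumZ u n).
  have -> : psumZ (fun m => d n m * u m) n = psumZ (fun m => (d n m - 1) * u m) n + psumZ u n.
    by rewrite /psumZ -big_split/=; apply: eq_bigr => k _; ring.
  ring.
apply: le_trans (normc_le_sub _ _) _.
suff : normc (psumZ (fun m => (d n m - 1) * u m) n) <= e / 4 + e / 2 by lra.
pose f k := (d n k%:Z - 1) * u k%:Z + (d n (- k.+1%:Z) - 1) * u (- k.+1%:Z).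
have -> : psumZ (fun m => (d n m - 1) * u m) n =
   psumZ (fun m => (d n m - 1) * u m) K + \sum_(K <= k < n) f k.
  by rewrite /psumZ -!(big_mkord xpredT f) -big_cat_nat.
apply: le_trans (normc_le_add _ _) (lerD h2 _).
have f_le k : normc (f k) <= (B + 1) * v k.
  apply: le_trans (normc_le_add _ _) _; rewrite !normcM /v mulrDr.
  have d_le m : normc (d n m - 1) <= B + 1.
    by apply: le_trans (normc_le_sub _ _) _; rewrite normc1 lerD2r.
  by apply: lerD; apply: ler_wpM2r (d_le _); apply: normc_ge0.
apply: le_trans (normc_sum _ _ _) _.
apply: le_trans (ler_sum _ (fun k _ => f_le k)) _; rewrite -mulr_sumr.
have tail : \sum_(K <= k < n) v k = \sum_(k < n) v k - \sum_(k < K) v k.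
  by rewrite -!(big_mkord xpredT v) (big_cat_nat (leq0n K) Kn)/= addrC addrK.
have B1 : 0 < B + 1 by lra.
rewrite -ler_pdivlMl// tail.
have := hl n Kn; have := hl K (leqnn K); rewrite !ler_norml => /andP[a1 a2] /andP[a3 a4].
have -> : (B + 1)^-1 * (e / 2) = e / 4 / (B + 1) + e / 4 / (B + 1).
  by field; rewrite gt_eqF.
lra.
Qed.

End Tannery.


(** * Zeros of the theta series, read off from its product *)

Section ThetaZeros.
Local Open Scope complex_scope.
Import Normc.
Variable R : realType.
Variable beta : R[i].
Hypothesis Re_beta : complex.Re beta < 0.
Implicit Types gamma : R[i].

Let p := cexp (2 * beta).
Let rho := normc p.
Let Q := qpoch p.

Local Lemma rho0 : 0 <= rho. Proof. exact: normc_ge0. Qed.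

Local Lemma rho1 : rho < 1.
Proof.
rewrite /rho normc_cexp -expR0 ltr_expR.
have -> : 2 * beta = beta + beta by ring.
by rewrite raddfD/=; move: Re_beta; lra.
Qed.

Let poch_term (k : nat) : R[i] := - p ^+ k.+1.

Local Lemma poch_term_le k : normc (poch_term k) <= rho * rho ^+ k.
Proof. by rewrite normc_opp normcX exprS. Qed.

Local Lemma Q_prod n : Q n = \prod_(k < n) (1 + poch_term k).
Proof. by []. Qed.

Local Lemma Q_le : exists2 B, 0 < B & forall n, normc (Q n) <= B.
Proof. exact: geometric_prod_le rho0 rho0 rho1 poch_term_le. Qed.

Local Lemma Q_ge : exists2 d, 0 < d & forall n, d <= normc (Q n).
Proof.
apply: (geometric_prod_ge rho0 rho0 rho1 poch_term_le) => k.
apply/eqP => /eqP; rewrite subr_eq0 eq_sym => /eqP /(congr1 (@normc R)).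
rewrite normcX normc1 => pk1.
have : rho ^+ k.+1 < 1 by rewrite exprn_ilt1// ?rho0 ?rho1.
by rewrite pk1 ltxx.
Qed.

Local Lemma Q_neq0 n : Q n != 0.
Proof. by have [d d0 hd] := Q_ge; rewrite -normc_gt0 (lt_le_trans d0). Qed.

Local Lemma Q_cauchy e : 0 < e ->
  exists n0, forall m n, (n0 <= m)%N -> (n0 <= n)%N -> normc (Q m - Q n) <= e.
Proof.
move=> e0; have [B B0 hB] := Q_le.
have Br : 0 <= B * rho / (1 - rho).
  by rewrite divr_ge0 ?mulr_ge0 ?rho0 ?subr_ge0 ?(ltW B0) ?(ltW rho1).
have [n0 h] := geometric_small rho0 rho1 Br e0.
exists n0 => m n; wlog mn : m n / (m <= n)%N.
  move=> H; have [/H//|/ltnW nm] := leqP m n.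
  by move=> hm hn; rewrite normc_distrC; exact: H.
move=> n0m _; rewrite normc_distrC -(subnKC mn).
apply: le_trans (h m n0m); rewrite mulrAC ler_pdivlMr ?subr_gt0 ?rho1// mulrC.
apply: le_trans (geometric_sum_le (mulr_ge0 (ltW B0) rho0) rho0 m (n - m)).
apply: ler_wpM2l; first by rewrite subr_ge0 ltW ?rho1.
elim: (n - m)%N => [|j IH]; first by rewrite addn0 subrr normc0 big_geq.
rewrite addnS big_nat_recr ?leq_addr//=.
have -> : Q (m + j).+1 - Q m = (Q (m + j) - Q m) + Q (m + j) * poch_term (m + j).
  by rewrite !Q_prod big_ord_recr/=; ring.
apply: le_trans (normc_le_add _ _) (lerD IH _); rewrite normcM -mulrA.
by apply: ler_pM; rewrite ?normc_ge0 ?hB ?poch_term_le.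
Qed.

(** For |m| <= n this is the q-binomial coefficient of (2 n, n + m) times Q_n^2 / Q_{2n}. Outside
    that range [absz] merely totalises it, so that the uniform bound asked for by [tannery] holds
    for all m. *)
Let d n (m : int) : R[i] := Q n ^+ 2 / (Q (absz (n%:Z + m)%R) * Q (absz (n%:Z - m)%R)).

Local Lemma d_le : exists B, forall n m, normc (d n m) <= B.
Proof.
have [B B0 hB] := Q_le; have [c c0 hc] := Q_ge.
exists (B ^+ 2 / (c * c)) => n m; rewrite /d normcM normcX normcV normcM.
apply: ler_pM; rewrite ?exprn_ge0 ?invr_ge0 ?mulr_ge0 ?normc_ge0//.
  by apply: lerXn2r; rewrite ?nnegrE ?normc_ge0 ?hB// ltW.
rewrite lef_pV2 ?posrE ?mulr_gt0// ?(lt_le_trans c0)//.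
by apply: ler_pM; rewrite ?hc// ltW.
Qed.

Local Lemma d_to1 (m : int) e : 0 < e ->
  exists n0, forall n, (n0 <= n)%N -> normc (d n m - 1) <= e.
Proof.
move=> e0; have [B B0 hB] := Q_le; have [c c0 hc] := Q_ge.
have cc : 0 < c * c by rewrite mulr_gt0.
have e1 : 0 < e * (c * c) / (B + B) by rewrite divr_gt0 ?mulr_gt0 ?addr_gt0.
have [n0 h] := Q_cauchy e1; exists (n0 + absz m)%N => n n0n.
have ha := h n (absz (n%:Z + m)%R) ltac:(lia) ltac:(lia).
have hb := h n (absz (n%:Z - m)%R) ltac:(lia) ltac:(lia).
rewrite /d; move: (absz (_ + _)%R) ha => a ha; move: (absz (_ - _)%R) hb => b hb.
have -> : Q n ^+ 2 / (Q a * Q b) - 1 = (Q n * (Q n - Q a) + Q a * (Q n - Q b)) / (Q a * Q b).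
  by field; rewrite !Q_neq0.
rewrite normcM normcV normcM ler_pdivrMr ?mulr_gt0 ?normc_gt0 ?Q_neq0//.
apply: (@le_trans _ _ (e * (c * c))); last first.
  apply: ler_wpM2l; first exact: ltW.
  by apply: ler_pM; rewrite ?hc// ltW.
apply: le_trans (normc_le_add _ _) _; rewrite !normcM.
have -> : e * (c * c) = B * (e * (c * c) / (B + B)) + B * (e * (c * c) / (B + B)).
  by field; rewrite gt_eqF// addr_gt0.
by apply: lerD; apply: ler_pM; rewrite ?normc_ge0.
Qed.

Lemma jacobi_prod_limit gamma e : 0 < e -> exists n0, forall n, (n0 <= n)%N ->
  normc (jacobi_prod beta gamma n * (Q n ^+ 2 / Q (n + n)%N) - theta beta gamma) <= e.
Proof.
move=> e0; have e2 : 0 < e / 2 by rewrite divr_gt0.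
have st := abs_summableZ_theta gamma Re_beta.
have [B hB] := d_le.
have B0 : 0 <= B := le_trans (normc_ge0 _) (hB 0%N 0).
have B1 : 0 < B + 1 by lra.
have [n1 h1] := tannery st hB d_to1 e2.
(* The product has the indices -n, ..., n; the last one lies outside the window of [psumZ] and is
   estimated separately. *)
have [n2 h2] := abs_summableZ_lim0 st (divr_gt0 e2 B1).
exists (maxn n1 n2) => n; rewrite geq_max => /andP[/h1 {}h1 /h2[{}h2 _]].
have -> : jacobi_prod beta gamma n * (Q n ^+ 2 / Q (n + n)%N) =
   psumZ (fun m => d n m * theta_term beta gamma m) n + d n n%:Z * theta_term beta gamma n%:Z.
  rewrite psumZ_ord jacobi_prod_sum -/p mulr_suml big_ord_recr/=.
  have coef (j : nat) : (j <= n + n)%N ->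
      qbin p (n + n) j * theta_term beta gamma (j%:Z - n%:Z) * (Q n ^+ 2 / Q (n + n)%N) =
      d n (j%:Z - n%:Z) * theta_term beta gamma (j%:Z - n%:Z).
    move=> jn; rewrite /d.
    have -> : (absz (n%:Z + (j%:Z - n%:Z))%R) = j by lia.
    have -> : (absz (n%:Z - (j%:Z - n%:Z))%R) = (n + n - j)%N by lia.
    rewrite mulrAC; congr (_ * _).
    have := qbin_qpoch p jn; rewrite -/Q => <-.
    have q0 : qbin p (n + n) j != 0.
      have := Q_neq0 (n + n)%N; rewrite /Q -(qbin_qpoch p jn) mulf_eq0.
      by rewrite negb_or => /andP[].
    by field; rewrite q0 !Q_neq0.
  congr (_ + _); first by apply: eq_bigr => j _; apply: coef; apply: ltnW.
  by rewrite coef//; congr (d n _ * theta_term _ _ _); lia.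
rewrite addrAC [e]splitr; apply: le_trans (normc_le_add _ _) (lerD h1 _).
rewrite normcM; apply: le_trans (ler_pM (normc_ge0 _) (normc_ge0 _) (hB _ _) h2) _.
rewrite mulrCA; apply: ler_piMr; first exact: ltW.
by rewrite ler_pdivrMr// mul1r lerDl.
Qed.

(** If no factor vanishes, [geometric_prod_ge] keeps the normalised products above a positive
    constant, so their limit is not 0. *)
Lemma theta_eq0_factor gamma : theta beta gamma = 0 <->
  exists k, 1 + jacobi_factor beta gamma k = 0 \/ 1 + jacobi_factor beta (- gamma) k = 0.
Proof.
split=> [th0|[k hk]]; last first.
  apply: eq0_of_normc_le => e e0; have [n0 h] := jacobi_prod_limit gamma e0.
  have := h (maxn n0 k.+1) (leq_maxl _ _).
  have k_lt : (k < maxn n0 k.+1)%N by rewrite leq_maxr.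
  have -> : jacobi_prod beta gamma (maxn n0 k.+1) = 0.
    rewrite /jacobi_prod (bigD1 (Ordinal k_lt))//=.
    by case: hk => ->; rewrite ?(mul0r, mulr0).
  by rewrite mul0r sub0r normc_opp.
apply: contrapT => nofactor.
have factor_le g k : normc (jacobi_factor beta g k) <= normc (cexp (g + beta)) * rho ^+ k.
  rewrite /rho -normcX -normcM /p -cexpMn -cexpD le_eqVlt; apply/orP; left.
  by apply/eqP; congr (normc (cexp _)); rewrite -mulr_natr; ring.
have n1 k : 1 + jacobi_factor beta gamma k != 0.
  by apply/eqP => h; apply: nofactor; exists k; left.
have n2 k : 1 + jacobi_factor beta (- gamma) k != 0.
  by apply/eqP => h; apply: nofactor; exists k; right.
have [d1 d10 h1] := geometric_prod_ge (normc_ge0 _) rho0 rho1 (factor_le gamma) n1.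
have [d2 d20 h2] := geometric_prod_ge (normc_ge0 _) rho0 rho1 (factor_le (- gamma)) n2.
have [c c0 hc] := Q_ge; have [B B0 hB] := Q_le.
pose e := d1 * d2 * (c ^+ 2 / B).
have e0 : 0 < e by rewrite /e mulr_gt0 ?(mulr_gt0 d10)// divr_gt0// exprn_gt0.
have e2 : 0 < e / 2 by rewrite divr_gt0.
have [n h] := jacobi_prod_limit gamma e2.
have := h n (leqnn n); rewrite th0 subr0 /jacobi_prod big_split/= normcM normcM [normc (_ / _)]normcM normcX normcV.
suff : e <= normc (\prod_(k < n) (1 + jacobi_factor beta gamma k)) *
  normc (\prod_(k < n) (1 + jacobi_factor beta (- gamma) k)) *
  (normc (Q n) ^+ 2 / normc (Q (n + n)%N)) by clear th0; lra.
apply: ler_pM; rewrite ?mulr_ge0 ?invr_ge0 ?exprn_ge0 ?(ltW d10) ?(ltW d20) ?(ltW c0) ?(ltW B0)//.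
  by apply: ler_pM; rewrite ?(ltW d10) ?(ltW d20).
apply: ler_pM; rewrite ?exprn_ge0 ?invr_ge0 ?(ltW c0) ?(ltW B0)//.
  by apply: lerXn2r; rewrite ?nnegrE ?normc_ge0 ?hc ?ltW.
by rewrite lef_pV2 ?posrE ?hB ?normc_gt0 ?Q_neq0.
Qed.

Theorem theta_eq0 gamma : theta beta gamma = 0 <-> exists k l : int,
  gamma = (2 * k%:~R + 1) * beta + (2 * l%:~R + 1) * ('i * (pi : R)%:C).
Proof.
rewrite theta_eq0_factor; split.
  (* The factors for gamma supply the negative indices -k - 1, those for - gamma the indices k >=
     0. *)
  case=> k; rewrite /jacobi_factor => -[] /eqP; rewrite addrC addr_eq0 => /eqP;
    rewrite -(cexp_pii R) => /cexp_inj[l].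
    move=> /eqP; rewrite -subr_eq0 => /eqP h; exists (- k.+1%:Z), l.
    apply/eqP; rewrite -subr_eq0; apply/eqP; rewrite -[RHS]h mulrNz -pmulrn -natr1; ring.
  move=> /eqP; rewrite -subr_eq0 => /eqP h; exists k%:Z, (- l - 1).
  apply/eqP; rewrite -subr_eq0; apply/eqP; rewrite -[RHS]oppr0 -[in RHS]h -pmulrn rmorphB rmorphN/=; ring.
case=> k [l ->]; case: k => k; exists k; [right|left]; rewrite /jacobi_factor.
  have -> : - ((2 * k%:~R + 1) * beta + (2 * l%:~R + 1) * ('i * (pi : R)%:C)) +
     (2 * k%:R + 1) * beta = 'i * (pi : R)%:C + 2 * 'i * (pi : R)%:C * (- l - 1)%:~R.
    by rewrite rmorphB rmorphN/= -pmulrn; ring.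
  by rewrite cexpD_2pii_int cexp_pii subrr.
have -> : (2 * (Negz k)%:~R + 1) * beta + (2 * l%:~R + 1) * ('i * (pi : R)%:C) +
     (2 * k%:R + 1) * beta = 'i * (pi : R)%:C + 2 * 'i * (pi : R)%:C * l%:~R.
  by rewrite NegzE mulrNz -pmulrn -natr1; ring.
by rewrite cexpD_2pii_int cexp_pii subrr.
Qed.

End ThetaZeros.

(** * Translations and Gaussian waves *)


Section TwoByTwo.
Variable A : comNzRingType.

Lemma sum_ord2 (V : nmodType) (F : 'I_2 -> V) : \sum_(i < 2) F i = F 0 + F 1.
Proof.
rewrite !big_ord_recl big_ord0 addr0; congr (F _ + F _); exact: val_inj.
Qed.

Lemma ord2P (i : 'I_2) : {i = 0} + {i = 1}.
Proof. by case: i => -[|[|//]] lt_i; [left|right]; apply: val_inj. Qed.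

Lemma det_mx22 (M : 'M[A]_2) : \det M = M 0 0 * M 1 1 - M 0 1 * M 1 0.
Proof.
rewrite (expand_det_row _ 0) sum_ord2 /cofactor !det_mx11 !mxE /= expr0 expr1.
rewrite mul1r mulN1r mulrN; congr (M _ _ * M _ _ - M _ _ * M _ _); exact: val_inj.
Qed.

End TwoByTwo.

Section Waves.
Local Open Scope complex_scope.
Import Normc.
Variable R : realType.
Variable N : nat.
Hypothesis N_gt0 : (0 < N)%N.
Implicit Types (S : 'M[R]_2) (z : R[i]) (q y p x : R).

Definition a_ic S : R[i] := (S 0 0)%:C - 'i * (S 1 0)%:C.

(** The exponent of [kernel_U], with 1 / (2 hbar) = pi N. *)
Definition gexp S z q : R[i] := (pi * N%:R)%:C / i_b_plus_d S *
  (- ((S 1 1)%:C - 'i * (S 0 1)%:C) * z ^+ 2 - a_ic S * q%:C ^+ 2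
   + 2 * (Num.sqrt 2)%:C * z * q%:C).

Definition wave S (k1 q : R) z : R[i] := sumZ (fun m : int =>
  cexp (2 * 'i * pi%:C * m%:~R * k1%:C) * cexp (gexp S z (q + m%:~R))).

(* The sign in [zeta] is the conjugation in the definition of affine strings. *)
Definition zeta (v : 'cV[R]_2) : R[i] := (v 0 0)%:C - 'i * (v 1 0)%:C.
Definition zetac (v : 'cV[R]_2) : R[i] := (v 0 0)%:C + 'i * (v 1 0)%:C.

Definition transl (v : 'cV[R]_2) (f : R[i] -> R[i]) z : R[i] :=
  cexp (- ((pi * N%:R)%:C * ((Num.sqrt 2)%:C * zetac v * z + zetac v * zeta v / 2)))
  * f (z + zeta v / (Num.sqrt 2)%:C).

Lemma i_b_plus_dE S : i_b_plus_d S = 'i * (S 0 1)%:C + (S 1 1)%:C.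
Proof. by []. Qed.

Lemma sqrt2_sqr : (Num.sqrt 2)%:C ^+ 2 = 2 :> R[i].
Proof. by rewrite -rmorphXn/= sqr_sqrtr// rmorph_nat. Qed.

Lemma sqrt2_neq0 : (Num.sqrt 2)%:C != 0 :> R[i].
Proof. by rewrite -sqrf_eq0 sqrt2_sqr pnatr_eq0. Qed.

Lemma i_b_plus_d_neq0 S : \det S = 1 -> i_b_plus_d S != 0.
Proof.
move=> detS; apply/eqP => D0.
have d0 : S 1 1 = 0.
  by move/(congr1 (@complex.Re R)): D0; rewrite /i_b_plus_d/=; lra.
have b0 : S 0 1 = 0.
  by move/(congr1 (@complex.Im R)): D0; rewrite /i_b_plus_d/=; lra.
by move: detS; rewrite det_mx22 b0 d0 mulr0 mul0r subrr => /eqP; rewrite eq_sym oner_eq0.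
Qed.

Definition vec2 (x y : R) : 'cV[R]_2 := \col_i (if i == 0 then x else y).

Lemma mul_vec2 S x y :
  S *m vec2 x y = vec2 (S 0 0 * x + S 0 1 * y) (S 1 0 * x + S 1 1 * y).
Proof.
apply/matrixP => i j; rewrite !mxE sum_ord2 !mxE.
by case: (ord2P i) => ->.
Qed.

Lemma zeta_vec2 x y : zeta (vec2 x y) = x%:C - 'i * y%:C.
Proof. by rewrite /zeta !mxE. Qed.

Lemma zetac_vec2 x y : zetac (vec2 x y) = x%:C + 'i * y%:C.
Proof. by rewrite /zetac !mxE. Qed.

Lemma i_sqr : 'i * 'i = -1 :> R[i].
Proof. by rewrite -expr2 sqr_i. Qed.

Lemma zeta_mul S y p : zeta (S *m vec2 y p) = y%:C * a_ic S - 'i * p%:C * i_b_plus_d S.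
Proof.
rewrite mul_vec2 zeta_vec2 /a_ic i_b_plus_dE !rmorphD !rmorphM/=.
apply/eqP; rewrite -subr_eq0; apply/eqP.
set a := (S 0 0)%:C; set b := (S 0 1)%:C; set c := (S 1 0)%:C; set d := (S 1 1)%:C.
transitivity (('i * 'i + 1) * (p%:C * b)); first by ring.
by rewrite i_sqr addNr mul0r.
Qed.

Lemma zeta_conj_relation S y p : \det S = 1 ->
  ((S 1 1)%:C - 'i * (S 0 1)%:C) * zeta (S *m vec2 y p)
    + zetac (S *m vec2 y p) * i_b_plus_d S = 2 * y%:C.
Proof.
rewrite det_mx22 => detS.
rewrite mul_vec2 zeta_vec2 zetac_vec2 i_b_plus_dE.
have detC : (S 0 0)%:C * (S 1 1)%:C - (S 0 1)%:C * (S 1 0)%:C = 1 :> R[i].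
  by rewrite -!rmorphM -rmorphB detS.
rewrite !rmorphD !rmorphM/=; move: detC.
set a := (S 0 0)%:C; set b := (S 0 1)%:C; set c := (S 1 0)%:C; set d := (S 1 1)%:C => detC.
apply/eqP; rewrite -subr_eq0; apply/eqP.
transitivity (2 * y%:C * (a * d - b * c - 1) + 2 * ('i * 'i + 1) * b * (c * y%:C + d * p%:C)); first by ring.
by rewrite detC i_sqr subrr addNr; ring.
Qed.

(** The middle term is exactly what the Gaussian prefactor of [transl] cancels; the last one does
    not involve S. *)
Lemma gexp_transl S y p z q : \det S = 1 ->
  gexp S (z + zeta (S *m vec2 y p) / (Num.sqrt 2)%:C) (q + y) =
  gexp S z q
  + (pi * N%:R)%:C * ((Num.sqrt 2)%:C * zetac (S *m vec2 y p) * z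
       + zetac (S *m vec2 y p) * zeta (S *m vec2 y p) / 2)
  - 'i * (pi * N%:R)%:C * p%:C * (2 * q%:C + y%:C).
Proof.
move=> detS; have D0 := i_b_plus_d_neq0 detS.
have rel := zeta_conj_relation y p detS; have rel2 := zeta_mul S y p.
have s0 := sqrt2_neq0; have s2 := sqrt2_sqr.
rewrite /gexp rmorphD/=.
set n := (pi * N%:R)%:C; set s := (Num.sqrt 2)%:C in s0 s2 *.
set zt := zeta _ in rel rel2 *; set zc := zetac _ in rel *.
set D := i_b_plus_d S in D0 rel rel2 *; set Dc := _ - _ in rel *.
set A := a_ic S in rel2 *; set Q := q%:C; set Y := y%:C in rel rel2 *; set P := p%:C in rel2 *.
have su : zt / s * s = zt by rewrite divfK.
set u := zt / s in su *.
have Dcu : Dc * u * s = 2 * Y - zc * D by rewrite -mulrA su -rel addrK.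
apply: (mulfI D0).
have e1 : D * (n / D * (- Dc * (z + u) ^+ 2 - A * (Q + Y) ^+ 2 + 2 * s * (z + u) * (Q + Y))) =
  n * (- Dc * (z + u) ^+ 2 - A * (Q + Y) ^+ 2 + 2 * s * (z + u) * (Q + Y)).
  by rewrite !mulrA [D * n]mulrC mulfK.
rewrite {}e1 [RHS]mulrBr [D * (_ + _)]mulrDr.
have e2 : D * (n / D * (- Dc * z ^+ 2 - A * Q ^+ 2 + 2 * s * z * Q)) =
  n * (- Dc * z ^+ 2 - A * Q ^+ 2 + 2 * s * z * Q).
  by rewrite !mulrA [D * n]mulrC mulfK.
rewrite {}e2.
(* multiply by [2 = s ^+ 2] to remove the remaining denominators *)
have two0 : 2 != 0 :> R[i] by rewrite pnatr_eq0.
apply: (mulfI two0); apply/eqP; rewrite -subr_eq0; apply/eqP.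
have Dcu2 : 2 * (Dc * u) = s * (2 * Y - zc * D) by rewrite -Dcu -s2; ring.
have zcz : 2 * (zc * zt / 2) = zc * zt by field.
(* This writes the difference as a combination of the four relations [Dcu2], [su], [rel2] and
   [zcz]. *)
transitivity (n * (- (2 * (Dc * u) - s * (2 * Y - zc * D)) * (2 * z + u)
   + (4 * (Q + Y) - 2 * Y + zc * D) * (u * s - zt)
   + (4 * Q + 2 * Y) * (zt - (Y * A - 'i * P * D)) - D * (2 * (zc * zt / 2) - zc * zt))).
  ring.
by rewrite Dcu2 zcz su rel2 !subrr; ring.
Qed.

End Waves.


Section WaveProperties.
Local Open Scope complex_scope.
Import Normc.
Variable R : realType.
Variable N : nat.
Hypothesis N_gt0 : (0 < N)%N.
Implicit Types (S : 'M[R]_2) (z : R[i]) (q y p x : R).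

Definition wave_beta S : R[i] := - ((pi * N%:R)%:C / i_b_plus_d S * a_ic S).

Definition wave_gamma S k1 q z : R[i] := (pi * N%:R)%:C / i_b_plus_d S *
  (2 * (Num.sqrt 2)%:C * z - 2 * a_ic S * q%:C) + 2 * 'i * pi%:C * k1%:C.

Definition wave_term S k1 q z (m : int) : R[i] :=
  cexp (2 * 'i * pi%:C * m%:~R * k1%:C) * cexp (gexp N S z (q + m%:~R)).

Lemma waveE S k1 q z : wave N S k1 q z = sumZ (wave_term S k1 q z).
Proof. by []. Qed.

Lemma wave_termE S k1 q z m : wave_term S k1 q z m =
  cexp (gexp N S z q) * theta_term (wave_beta S) (wave_gamma S k1 q z) m.
Proof.
rewrite /wave_term /theta_term -!cexpD; congr cexp.
rewrite /gexp /wave_beta /wave_gamma; move: (@pi R) => P.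
by rewrite rmorphD rmorph_int/=; ring.
Qed.

Lemma a_ic_relation S : \det S = 1 ->
  ((S 1 1)%:C - 'i * (S 0 1)%:C) * a_ic S + ((S 0 0)%:C + 'i * (S 1 0)%:C) * i_b_plus_d S = 2.
Proof.
rewrite det_mx22 => detS.
have detC : (S 0 0)%:C * (S 1 1)%:C - (S 0 1)%:C * (S 1 0)%:C = 1 :> R[i].
  by rewrite -!rmorphM -rmorphB detS.
rewrite /a_ic i_b_plus_dE; move: detC.
set a := (S 0 0)%:C; set b := (S 0 1)%:C; set c := (S 1 0)%:C; set d := (S 1 1)%:C => detC.
apply/eqP; rewrite -subr_eq0; apply/eqP.
transitivity (2 * (a * d - b * c - 1) + 2 * ('i * 'i + 1) * b * c); first by ring.
by rewrite detC i_sqr subrr addNr; ring.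
Qed.

(** Since Re((d - i b)(a - i c)) = ad - bc = 1, clearing the denominator gives the real part -pi N /
    (b^2 + d^2). *)
Lemma Re_wave_beta S : \det S = 1 -> complex.Re (wave_beta S) < 0.
Proof.
move=> detS; have D0 := i_b_plus_d_neq0 detS.
pose D2 := S 1 1 ^+ 2 + S 0 1 ^+ 2.
have DD : i_b_plus_d S * ((S 1 1)%:C - 'i * (S 0 1)%:C) = D2%:C.
  rewrite i_b_plus_dE /D2 rmorphD !rmorphXn/=.
  transitivity ((S 1 1)%:C ^+ 2 - 'i * 'i * (S 0 1)%:C ^+ 2); first by ring.
  by rewrite i_sqr mulN1r opprK.
have D2_gt0 : 0 < D2.
  rewrite lt_def addr_ge0 ?sqr_ge0// andbT; apply/eqP => D20.
  move: D20 detS => /eqP; rewrite paddr_eq0 ?sqr_ge0// !sqrf_eq0 det_mx22.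
  by move=> /andP[/eqP-> /eqP->]; rewrite mulr0 mul0r subrr => /eqP; rewrite eq_sym oner_eq0.
have -> : wave_beta S = - ((pi * N%:R / D2)%:C *
    (((S 1 1)%:C - 'i * (S 0 1)%:C) * a_ic S)).
  rewrite /wave_beta !rmorphM fmorphV /= -DD.
  have Dc0 : (S 1 1)%:C - 'i * (S 0 1)%:C != 0 :> R[i].
    apply: contraTneq D2_gt0 => Dc0; move: DD; rewrite Dc0 mulr0 => /esym.
    by rewrite -[0]/(0%:C) => /complexI->; rewrite ltxx.
  by field; rewrite D0 Dc0.
have re1 : complex.Re (((S 1 1)%:C - 'i * (S 0 1)%:C) * a_ic S) = 1.
  rewrite -detS det_mx22 /a_ic/=; ring.
move: (_ * a_ic S) re1 => w re1.
have : 0 < pi * N%:R / D2 by rewrite divr_gt0 ?mulr_gt0 ?pi_gt0 ?ltr0n.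
move: (pi * _ / _) => t t0; case: w re1 => x y /= ->; nra.
Qed.

Lemma abs_summableZ_wave S k1 q z : \det S = 1 -> abs_summableZ (wave_term S k1 q z).
Proof.
move=> detS.
rewrite (_ : wave_term S k1 q z = fun m => cexp (gexp N S z q) *
   theta_term (wave_beta S) (wave_gamma S k1 q z) m); last first.
  by apply/funext => m; apply: wave_termE.
by apply: abs_summableZ_mull; apply: abs_summableZ_theta; apply: Re_wave_beta.
Qed.

Lemma wave_theta S k1 q z : \det S = 1 -> wave N S k1 q z =
  cexp (gexp N S z q) * theta (wave_beta S) (wave_gamma S k1 q z).
Proof.
move=> detS; rewrite waveE -sumZ_mull; last exact/abs_summableZ_theta/Re_wave_beta.
by apply: eq_sumZ => m; apply: wave_termE.
Qed.

Lemma wave_shift S k1 q (y : int) z : \det S = 1 ->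
  wave N S k1 (q + y%:~R) z = cexp (- (2 * 'i * pi%:C * y%:~R * k1%:C)) * wave N S k1 q z.
Proof.
move=> detS; have sw := abs_summableZ_wave k1 q z detS.
rewrite !waveE -(sumZ_shift y sw) -sumZ_mull.
  apply: eq_sumZ => m; rewrite /wave_term [RHS]mulrA -[in RHS]cexpD; congr (cexp _ * cexp _).
    by rewrite intrD; ring.
  by rewrite intrD (addrC m%:~R) addrA.
have [M hM] := abs_summableZ_wave k1 (q + y%:~R) z detS.
have -> : (fun m => wave_term S k1 q z (m + y)) =
   fun m => cexp (2 * 'i * pi%:C * y%:~R * k1%:C) * wave_term S k1 (q + y%:~R) z m.
  apply/funext => m; rewrite /wave_term [RHS]mulrA -[in RHS]cexpD; congr (cexp _ * cexp _).
    by rewrite intrD; ring.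
  by rewrite intrD (addrC m%:~R) addrA.
by apply: abs_summableZ_mull; exists M.
Qed.

(** A momentum in Z/N makes the phase of the m-th term differ from that of the term m = 0 by 2 pi s
    m, hence trivially, and one common factor comes out of the sum. *)
Lemma transl_wave S k1 q y (s : int) z : \det S = 1 ->
  transl N (S *m vec2 y (s%:~R / N%:R)) (wave N S k1 (q + y)) z =
  cexp (- (2 * 'i * pi%:C * s%:~R * q%:C) - 'i * pi%:C * s%:~R * y%:C) * wave N S k1 q z.
Proof.
move=> detS; have NR : N%:R != 0 :> R by rewrite pnatr_eq0 -lt0n.
have NC : N%:R != 0 :> R[i] by rewrite pnatr_eq0 -lt0n.
set v := S *m _; rewrite /transl.
rewrite !waveE -!sumZ_mull; try exact: abs_summableZ_wave.
apply: eq_sumZ => m; rewrite /wave_term.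
have -> : q + y + m%:~R = q + m%:~R + y by ring.
rewrite gexp_transl// -!cexpD.
rewrite -/v; move: (zetac v) (zeta v) => zc zt.
rewrite -[RHS](cexpD_2pii_int _ (- (s * m))); congr cexp.
move: (@pi R) => P.
rewrite rmorphN !rmorphM rmorphD fmorphV /= !rmorph_int !rmorph_nat.
by field.
Qed.

Definition chi k1 q (y s : int) : R[i] := cexp (2 * 'i * pi%:C * y%:~R * k1%:C
  - 2 * 'i * pi%:C * s%:~R * q%:C - 'i * pi%:C * s%:~R * y%:~R).

Definition lattice_eigen S k1 q (f : R[i] -> R[i]) := forall (y s : int) z,
  transl N (S *m vec2 y%:~R (s%:~R / N%:R)) f z = chi k1 q y s * f z.

Lemma wave_lattice_eigen S k1 q : \det S = 1 -> lattice_eigen S k1 q (wave N S k1 q).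
Proof.
move=> detS y s z; have := transl_wave k1 q y%:~R s z detS.
have -> : wave N S k1 (q + y%:~R) =
   fun z => cexp (- (2 * 'i * pi%:C * y%:~R * k1%:C)) * wave N S k1 q z.
  by apply/funext => w; apply: wave_shift.
rewrite /transl mulrCA => h.
apply: (mulfI (cexp_neq0 (- (2 * 'i * pi%:C * y%:~R * k1%:C)))).
rewrite {}h mulrA /chi -cexpD; congr (cexp _ * _).
by rewrite rmorph_int; ring.
Qed.

Lemma sholo_gexp S q : sholo (fun z => gexp N S z q).
Proof.
rewrite /gexp; apply: sholo_mull; apply: sholo_add.
  apply: sholo_add; last exact: sholo_cst.
  by apply: sholo_mull; apply: sholo_mul; apply: sholo_id.
rewrite (_ : (fun z => _) = fun z => (2 * (Num.sqrt 2)%:C * q%:C) * z).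
  by apply: sholo_mull; apply: sholo_id.
by apply/funext => z; ring.
Qed.

Lemma sholo_wave S k1 q : \det S = 1 -> sholo (wave N S k1 q).
Proof.
move=> detS.
rewrite (_ : wave N S k1 q = fun z => cexp (gexp N S z q) *
   theta (wave_beta S) (wave_gamma S k1 q z)); last first.
  by apply/funext => z; apply: wave_theta.
apply: sholo_mul; first exact: (sholo_comp (@sholo_cexp R) (sholo_gexp S q)).
apply: (@sholo_comp _ (theta (wave_beta S)) (wave_gamma S k1 q)).
  exact/sholo_theta/Re_wave_beta.
rewrite (_ : wave_gamma S k1 q = fun z =>
  ((pi * N%:R)%:C / i_b_plus_d S * (2 * (Num.sqrt 2)%:C)) * z
  + ((pi * N%:R)%:C / i_b_plus_d S * (- (2 * a_ic S * q%:C)) + 2 * 'i * pi%:C * k1%:C)).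
  apply: sholo_add; last exact: sholo_cst.
  by apply: sholo_mull; apply: sholo_id.
by apply/funext => z; rewrite /wave_gamma; ring.
Qed.

Lemma wave_eq0 S k1 q z : \det S = 1 -> wave N S k1 q z = 0 <->
  exists k l : int, N%:R * (Num.sqrt 2)%:C * z =
    N%:R * a_ic S * (q - k%:~R - 2^-1)%:C + 'i * i_b_plus_d S * (l%:~R + 2^-1 - k1)%:C.
Proof.
move=> detS; have D0 := i_b_plus_d_neq0 detS.
have NC : N%:R != 0 :> R[i] by rewrite pnatr_eq0 -lt0n.
have pi0 : pi%:C != 0 :> R[i].
  by rewrite -normc_gt0 normc_real normr_gt0 gt_eqF// pi_gt0.
rewrite wave_theta//; split.
  move/eqP; rewrite mulf_eq0 (negbTE (cexp_neq0 _)) => /eqP.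
  move=> /(theta_eq0 (Re_wave_beta detS))[k [l h]]; exists k, l.
  have c0 : 2 * pi%:C / i_b_plus_d S != 0 :> R[i].
    by rewrite !mulf_neq0 ?invr_eq0 ?pnatr_eq0.
  apply: (mulfI c0).
  move: h; rewrite /wave_gamma /wave_beta => /eqP; rewrite -subr_eq0 => /eqP h.
  apply/eqP; rewrite -subr_eq0 -[X in _ == X]h; apply/eqP.
  move: (@pi R) pi0 {h c0} => P pi0.
  rewrite !rmorphB !rmorphD !rmorphM fmorphV /= !rmorph_int !rmorph_nat.
  by field.
move=> [k [l h]]; apply/eqP; rewrite mulf_eq0 (negbTE (cexp_neq0 _))/=.
apply/eqP/(theta_eq0 (Re_wave_beta detS)); exists k, l.
move: h => /eqP; rewrite -subr_eq0 => /eqP h.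
apply/eqP; rewrite -subr_eq0; apply/eqP.
transitivity (2 * pi%:C / i_b_plus_d S * 0 : R[i]); last by rewrite mulr0.
rewrite -[in RHS]h /wave_gamma /wave_beta.
move: (@pi R) pi0 {h} => P pi0.
rewrite !rmorphB !rmorphD !rmorphM fmorphV /= !rmorph_int !rmorph_nat.
by field.
Qed.

Lemma wave_neq0 S k1 q : \det S = 1 -> exists z, wave N S k1 q z != 0.
Proof.
move=> detS; have D0 := i_b_plus_d_neq0 detS.
have s0 := sqrt2_neq0 R; have NC : N%:R != 0 :> R[i] by rewrite pnatr_eq0 -lt0n.
(* A point between zeros: k = 0 and l = -1/2 in [wave_eq0]. Were it a zero, either half an odd
   integer would vanish or [wave_beta S] would be imaginary, against [Re_wave_beta]. *)
pose z := (N%:R * a_ic S * (q - 2^-1)%:C + 'i * i_b_plus_d S * (- k1)%:C) / (N%:R * (Num.sqrt 2)%:C).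
exists z; apply/eqP => /(wave_eq0 k1 q z detS)[k [l]].
rewrite /z mulrC divfK ?mulf_neq0// => h.
have {}h : N%:R * a_ic S * (k%:~R)%:C = 'i * i_b_plus_d S * (l%:~R + 2^-1)%:C.
  apply/eqP; rewrite -subr_eq0; apply/eqP.
  move/eqP: h; rewrite -subr_eq0 => /eqP h; rewrite -[RHS]h.
  by rewrite !rmorphB !rmorphD rmorphN/=; ring.
have := Re_wave_beta detS; rewrite /wave_beta.
have ll : (l%:~R + 2^-1 : R) != 0.
  apply/eqP => l0; have : (l * 2 + 1)%:~R = 0 :> R.
    by rewrite intrD intrM; move: l0; lra.
  by move=> /eqP; rewrite intr_eq0 => /eqP; lia.
have [k0|k0] := eqVneq (k%:~R : R) 0.
  move: h; rewrite k0 mulr0 => /esym /eqP.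
  have i_neq0 : 'i != 0 :> R[i] by rewrite -normc_gt0 normc_i.
  rewrite !mulf_eq0 (negbTE D0) (negbTE i_neq0)/=.
  by rewrite -[0]/(0%:C) (inj_eq (@complexI R)) (negbTE ll).
have kC : (k%:~R : R)%:C != 0 by rewrite -[0]/(0%:C) (inj_eq (@complexI R)).
have -> : - ((pi * N%:R)%:C / i_b_plus_d S * a_ic S) = (- pi * (l%:~R + 2^-1) / k%:~R)%:C * 'i.
  move: (@pi R) => P.
  rewrite !rmorphM rmorphN fmorphV /= rmorph_nat.
  apply: (mulIf kC); apply: (mulIf D0).
  transitivity (- P%:C * (N%:R * a_ic S * (k%:~R)%:C)); first by field; rewrite D0.
  by rewrite h; field; move: k0; rewrite !intr_eq0.
by rewrite ReiNIm /= oppr0 ltxx.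
Qed.

End WaveProperties.


(** * Uniqueness of joint eigenfunctions of lattice translations *)

Section LatticeUniqueness.
Local Open Scope complex_scope.
Import Normc.
Variable R : realType.
Variable N : nat.
Hypothesis N_gt0 : (0 < N)%N.
Implicit Types (S : 'M[R]_2) (z : R[i]) (f g : R[i] -> R[i]).

Lemma cexp_combine (x y z w : R[i]) :
  cexp x * (cexp y * w) * cexp z = w * cexp (x + y + z).
Proof. by rewrite !cexpD; ring. Qed.

Lemma cexp_merge (w x y : R[i]) : w * cexp x * cexp y = w * cexp (x + y).
Proof. by rewrite cexpD mulrA. Qed.

Lemma zetac_mul S y p : zetac (S *m vec2 y p) =
  y%:C * ((S 0 0)%:C + 'i * (S 1 0)%:C) + 'i * p%:C * ((S 1 1)%:C - 'i * (S 0 1)%:C).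
Proof.
rewrite mul_vec2 zetac_vec2 !rmorphD !rmorphM/=.
apply/eqP; rewrite -subr_eq0; apply/eqP.
transitivity (('i * 'i + 1) * (p%:C * (S 0 1)%:C)); first by ring.
by rewrite i_sqr addNr mul0r.
Qed.

Lemma lattice_eigen_shift S k1 q f : lattice_eigen N S k1 q f -> forall (y s : int) z,
  f (z + zeta (S *m vec2 y%:~R (s%:~R / N%:R)) / (Num.sqrt 2)%:C) =
  cexp ((pi * N%:R)%:C * ((Num.sqrt 2)%:C * zetac (S *m vec2 y%:~R (s%:~R / N%:R)) * z
     + zetac (S *m vec2 y%:~R (s%:~R / N%:R)) * zeta (S *m vec2 y%:~R (s%:~R / N%:R)) / 2))
  * (chi k1 q y s * f z).
Proof. by move=> ef y s z; rewrite -ef /transl mulrA -cexpD subrr cexp0 mul1r. Qed.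

(* In the coordinate [w] the direction [S (0, 1/N)] becomes the period [1]; the Gaussian
   factor turns quasi-periodicity along it into periodicity. *)
Definition unroll S q f (w : R[i]) : R[i] :=
  f ('i * i_b_plus_d S / (N%:R * (Num.sqrt 2)%:C) * w) *
  cexp (- (pi%:C * i_b_plus_d S * ((S 1 1)%:C - 'i * (S 0 1)%:C) / (2 * N%:R)) * w ^+ 2
        - 2 * 'i * pi%:C * q%:C * w).

Lemma sholo_unroll S q f : sholo f -> sholo (unroll S q f).
Proof.
move=> sf; rewrite /unroll; set c := _ / _; set a := - _; set e := 2 * 'i * _ * _.
apply: sholo_mul.
  rewrite (_ : (fun w => f (c * w)) = fun w => f (c * w + 0)); first exact: sholo_affine.
  by apply/funext => w; rewrite addr0.
apply: (@sholo_comp _ (@cexp R) (fun w => a * w ^+ 2 - e * w) (@sholo_cexp R)).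
rewrite (_ : (fun w => _) = fun w => a * (w * w) + (- e) * w).
  apply: sholo_add; apply: sholo_mull; last exact: sholo_id.
  by apply: sholo_mul; apply: sholo_id.
by apply/funext => w; ring.
Qed.

(** The vector S (0, -1/N) moves w by 1, and the term -2 pi i q w cancels its eigenvalue e^{2 pi i
    q}. *)
Lemma unroll_periodic1 S k1 q f : \det S = 1 -> lattice_eigen N S k1 q f ->
  periodic1 (unroll S q f).
Proof.
move=> detS ef w; rewrite /unroll.
have NC : N%:R != 0 :> R[i] by rewrite pnatr_eq0 -lt0n.
have s0 := sqrt2_neq0 R; have s2 := sqrt2_sqr R.
have := lattice_eigen_shift ef 0 (- 1) ('i * i_b_plus_d S / (N%:R * (Num.sqrt 2)%:C) * w).
rewrite zeta_mul zetac_mul (_ : (0%:~R)%:C = 0 :> R[i])// !mul0r !add0r.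
set D := i_b_plus_d S; set Dc := _ - _; set s := (Num.sqrt 2)%:C in s0 s2 *.
have -> : ((-1)%:~R / N%:R)%:C = - N%:R^-1 :> R[i].
  by rewrite rmorphM fmorphV/= rmorph_int rmorph_nat mulN1r.
have -> : 'i * D / (N%:R * s) * w + - ('i * - N%:R^-1 * D) / s = 'i * D / (N%:R * s) * (w + 1).
  by field; rewrite s0 NC.
move=> ->; rewrite /chi; set F0 := f _; rewrite cexp_combine; congr (_ * _); congr cexp.
move: (@pi R) => P {F0 ef}; rewrite rmorphM rmorph_nat/=.
apply/eqP; rewrite -subr_eq0; apply/eqP.
transitivity (- ('i * 'i + 1) * (P%:C * D * Dc / N%:R * w + P%:C * D * Dc / (2 * N%:R))).
  by field; rewrite s0 NC.
by rewrite i_sqr addNr oppr0 mul0r.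
Qed.

Definition unroll_tau S : R[i] := 'i * N%:R * a_ic S / i_b_plus_d S.

(** The multiplier left over once e^{-2 pi i k w} is split off. It does not depend on f, which is
    what allows two eigenfunctions to be compared. *)
Definition unroll_b S k1 q (k : int) : R[i] :=
  cexp (- ((pi * N%:R)%:C * (k%:~R ^+ 2 * ((S 0 0)%:C + 'i * (S 1 0)%:C) * a_ic S / 2)
   - 2 * 'i * pi%:C * k%:~R * k1%:C
   - (pi%:C * i_b_plus_d S * ((S 1 1)%:C - 'i * (S 0 1)%:C) / (2 * N%:R)) * (k%:~R * unroll_tau S) ^+ 2
        - 2 * 'i * pi%:C * q%:C * (k%:~R * unroll_tau S))).

Lemma unroll_quasi_periodic S k1 q f : \det S = 1 -> lattice_eigen N S k1 q f ->
  quasi_periodic (unroll_tau S) (unroll_b S k1 q) (unroll S q f).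
Proof.
move=> detS ef k w; rewrite /twist /unroll.
have NC : N%:R != 0 :> R[i] by rewrite pnatr_eq0 -lt0n.
have D0 := i_b_plus_d_neq0 detS.
have s0 := sqrt2_neq0 R; have s2 := sqrt2_sqr R.
have rel := a_ic_relation detS.
(* The vector S (-k, 0) moves w by k tau. *)
have := lattice_eigen_shift ef (- k) 0 ('i * i_b_plus_d S / (N%:R * (Num.sqrt 2)%:C) * w).
rewrite zeta_mul zetac_mul mul0r (_ : 0%:C = 0 :> R[i])// !mulr0 !mul0r subr0 addr0.
rewrite /unroll_b /unroll_tau.
set D := i_b_plus_d S in D0 rel *; set Dc := (S 1 1)%:C - _ in rel *.
set A := a_ic S in rel *; set Ac := (S 0 0)%:C + _ in rel *; set s := (Num.sqrt 2)%:C in s0 s2 *.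
have -> : ((- k)%:~R)%:C = - k%:~R :> R[i] by rewrite rmorph_int mulrNz.
have -> : 'i * D / (N%:R * s) * w + - k%:~R * A / s =
    'i * D / (N%:R * s) * (w + k%:~R * ('i * N%:R * A / D)).
  apply/eqP; rewrite -subr_eq0; apply/eqP.
  transitivity (- (('i * 'i + 1) * (k%:~R * A / s))); first by field; rewrite D0 s0 NC.
  by rewrite i_sqr addNr mul0r oppr0.
move=> ->; rewrite /chi /e2pii.
set F0 := f _; rewrite [RHS]mulrC cexp_combine !cexp_merge; congr (_ * _); congr cexp.
move: (@pi R) => P {F0 ef}; rewrite rmorphM rmorph_nat/=.
apply/eqP; rewrite -subr_eq0; apply/eqP.
transitivity ('i * P%:C * k%:~R * w * (Dc * A + Ac * D - 2)).
  by field; rewrite D0 s0 NC.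
by rewrite rel subrr mulr0.
Qed.

Lemma lattice_eigen_proportional S k1 q f g z z' : \det S = 1 ->
  sholo f -> lattice_eigen N S k1 q f -> sholo g -> lattice_eigen N S k1 q g ->
  f z * g z' = f z' * g z.
Proof.
move=> detS sf ef sg eg.
have NC : N%:R != 0 :> R[i] by rewrite pnatr_eq0 -lt0n.
have D0 := i_b_plus_d_neq0 detS.
have i_neq0 : 'i != 0 :> R[i] by rewrite -normc_gt0 normc_i.
pose c : R[i] := 'i * i_b_plus_d S / (N%:R * (Num.sqrt 2)%:C).
have c0 : c != 0 by rewrite !mulf_neq0 ?invr_neq0 ?mulf_neq0 ?sqrt2_neq0.
have := quasi_periodic_proportional (z / c) (z' / c)
  (sholo_unroll S q sf) (unroll_periodic1 detS ef) (unroll_quasi_periodic detS ef)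
  (sholo_unroll S q sg) (unroll_periodic1 detS eg) (unroll_quasi_periodic detS eg).
rewrite /unroll -/c !(mulrC c) !divfK//.
set e := cexp _; set e' := cexp _ => h.
apply: (mulIf (mulf_neq0 (cexp_neq0 _ : e != 0) (cexp_neq0 _ : e' != 0))).
by rewrite mulrACA h mulrACA [e' * e]mulrC.
Qed.

Lemma transl_comp v w f z : transl N v (transl N w f) z =
  cexp (- ('i * (pi * N%:R * (v 0 0 * w 1 0 - w 0 0 * v 1 0))%:C)) * transl N (v + w) f z.
Proof.
rewrite /transl.
have -> : zeta (v + w) = zeta v + zeta w by rewrite /zeta !mxE !rmorphD/=; ring.
have -> : zetac (v + w) = zetac v + zetac w by rewrite /zetac !mxE !rmorphD/=; ring.
have s0 := sqrt2_neq0 R.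
have -> : z + (zeta v + zeta w) / (Num.sqrt 2)%:C =
  z + zeta v / (Num.sqrt 2)%:C + zeta w / (Num.sqrt 2)%:C by ring.
rewrite [LHS]mulrA [RHS]mulrA -!cexpD; congr (cexp _ * _).
have -> : (Num.sqrt 2)%:C * zetac w * (z + zeta v / (Num.sqrt 2)%:C) =
  (Num.sqrt 2)%:C * zetac w * z + zetac w * zeta v by field.
rewrite /zeta /zetac; move: (@pi R) => P.
rewrite !(rmorphM, rmorphB, rmorph_nat)/=.
set v0 := (v 0 0)%:C; set v1 := (v 1 0)%:C; set w0 := (w 0 0)%:C; set w1 := (w 1 0)%:C.
by field.
Qed.


End LatticeUniqueness.

(** * States with prescribed quasi-periodicity *)


Section LatticeDecomposition.
Local Open Scope complex_scope.
Import Normc.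
Variable R : realType.
Variable N : nat.
Hypothesis N_gt0 : (0 < N)%N.
Implicit Types (S : 'M[R]_2) (z : R[i]) (f g : R[i] -> R[i]).

Let NR : N%:R != 0 :> R. Proof. by rewrite pnatr_eq0 -lt0n. Qed.
Let NC : N%:R != 0 :> R[i]. Proof. by rewrite pnatr_eq0 -lt0n. Qed.

Lemma sum_periodicZ (V : zmodType) (h : int -> V) (s : int) :
  (forall t, h (t + N%:Z) = h t) -> \sum_(t < N) h (t%:Z + s) = \sum_(t < N) h t%:Z.
Proof.
move=> hN; have step r : \sum_(t < N) h (t%:Z + (r + 1)) = \sum_(t < N) h (t%:Z + r).
  case: N N_gt0 hN => [//|M] _ hM.
  rewrite big_ord_recr [RHS]big_ord_recl/= [RHS]addrC; congr (_ + _).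
    by apply: eq_bigr => t _; congr h; rewrite /bump/=; lia.
  by rewrite -(hM (0%:Z + r)); congr h; lia.
elim/int_rec: s => [|s IH|s IH].
- by apply: eq_bigr => t _; rewrite addr0.
- by rewrite -IH -(step s%:Z); apply: eq_bigr => t _; congr h; lia.
- by rewrite -IH -(step (- s.+1%:Z)); apply: eq_bigr => t _; congr h; lia.
Qed.

Lemma translZ v (c : R[i]) f z : transl N v (fun w => c * f w) z = c * transl N v f z.
Proof. by rewrite /transl mulrCA. Qed.

Lemma transl_sum (I : Type) (r : seq I) v (F : I -> R[i] -> R[i]) z :
  transl N v (fun w => \sum_(i <- r) F i w) z = \sum_(i <- r) transl N v (F i) z.
Proof. by rewrite /transl mulr_sumr. Qed.

Lemma eq_transl v f g : f =1 g -> transl N v f =1 transl N v g.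
Proof. by move=> /funext->. Qed.

Lemma sholo_transl v f : sholo f -> sholo (transl N v f).
Proof.
move=> sf; rewrite /transl.
set n := (pi * N%:R)%:C; set s := (Num.sqrt 2)%:C; set zc := zetac v; set zt := zeta v.
apply: sholo_mul.
  rewrite (_ : (fun z => _) = fun z => cexp (- (n * s * zc) * z + - (n * (zc * zt / 2)))).
    exact/sholo_affine/sholo_cexp.
  by apply/funext => z; congr cexp; ring.
rewrite (_ : (fun z => _) = fun z => f (1 * z + zt / s)); first exact: sholo_affine.
by apply/funext => z; rewrite mul1r.
Qed.

Lemma transl_comp_vec2 S x y x' y' f z : \det S = 1 ->
  transl N (S *m vec2 x y) (transl N (S *m vec2 x' y') f) z =
  cexp (- ('i * (pi * N%:R * (x * y' - x' * y))%:C)) *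
    transl N (S *m vec2 (x + x') (y + y')) f z.
Proof.
rewrite det_mx22 => detS; rewrite transl_comp !mul_vec2.
have -> : vec2 (S 0 0 * x + S 0 1 * y) (S 1 0 * x + S 1 1 * y) +
  vec2 (S 0 0 * x' + S 0 1 * y') (S 1 0 * x' + S 1 1 * y') =
  vec2 (S 0 0 * (x + x') + S 0 1 * (y + y')) (S 1 0 * (x + x') + S 1 1 * (y + y')).
  by apply/matrixP => i j; rewrite !mxE; case: ifP => _; ring.
congr (cexp (- ('i * (_ * _)%:C)) * _); rewrite !mxE/=.
transitivity ((x * y' - x' * y) * (S 0 0 * S 1 1 - S 0 1 * S 1 0)); first by ring.
by rewrite detS mulr1.
Qed.

Lemma transl0 f z : transl N 0 f z = f z.
Proof.
by rewrite /transl /zeta /zetac !mxE !(mulr0, mul0r, addr0, subr0, oppr0) cexp0 mul1r.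
Qed.

(** On f the translation by S (0, 1) is a scalar, so those by S (0, t/N) act as a cyclic group of
    order N up to a phase. The projections of f to the N eigenspaces add up to f and are joint
    eigenfunctions for Z x Z/N, hence multiples of single waves. *)
Lemma lattice_decomposition S (k1 k2 : R) f : \det S = 1 -> sholo f ->
  (forall (y p : int) z, transl N (S *m vec2 y%:~R p%:~R) f z =
     chi k1 (k2 / N%:R) y (p * N%:Z) * f z) ->
  exists c : 'I_N -> R[i], forall z,
    f z = \sum_(k < N) c k * wave N S k1 ((k2 + k%:R) / N%:R) z.
Proof.
move=> detS sf ef.
pose q k : R := (k2 + k%:R) / N%:R.
pose T (t : int) := transl N (S *m vec2 0 (t%:~R / N%:R)) f.
(* The factor is the inverse of [chi k1 (q k) 0 t], so averaging over t projects onto that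
   eigenvalue. *)
pose h k (t : int) z := cexp (2 * 'i * pi%:C * t%:~R * (q k)%:C) * T t z.
pose fk k z := N%:R^-1 * \sum_(t < N) h k t%:Z z.
have T_period t z : T (t + N%:Z) z = cexp (- (2 * 'i * pi%:C * k2%:C)) * T t z.
  rewrite /T; have := transl_comp_vec2 0 (t%:~R / N%:R) 0 1 f z detS.
  rewrite !(mulr0, mul0r, subr0, oppr0, addr0) cexp0 mul1r.
  have -> : t%:~R / N%:R + 1 = (t + N%:Z)%:~R / N%:R :> R.
    by rewrite intrD mulrDl divff.
  move=> <-.
  have e1 := ef 0 1; rewrite /= in e1.
  rewrite (eq_transl _ (g := fun w => cexp (- (2 * 'i * pi%:C * k2%:C)) * f w)); first exact: translZ.
  move=> w; rewrite -[in LHS](mulr0z 1) -[X in vec2 _ X](mulr1z 1) e1 /chi; congr (cexp _ * _).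
  move: (@pi R) => P; rewrite mul1r -[N%:Z%:~R]/(N%:R) !(rmorphM, fmorphV, rmorph_nat)/=.
  by field.
have h_period k z t : h k (t + N%:Z) z = h k t z.
  rewrite /h T_period mulrA -cexpD; congr (_ * _).
  rewrite -[RHS](cexpD_2pii_int _ k%:Z); congr cexp; rewrite /q.
  move: (@pi R) => P; rewrite intrD -![_%:Z%:~R]/(_%:R) !(rmorphM, rmorphD, fmorphV, rmorph_nat)/=.
  by field.
have fk_eigen k : lattice_eigen N S k1 (q k) (fk k).
  move=> y s z; rewrite /fk translZ transl_sum [RHS]mulrCA; congr (_ * _).
  rewrite -(sum_periodicZ s (h_period k z)) mulr_sumr; apply: eq_bigr => t _.
  rewrite /h translZ /T transl_comp_vec2//.
  have := transl_comp_vec2 0 ((s + t%:Z)%:~R / N%:R) y%:~R 0 f z detS.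
  rewrite mul0r sub0r add0r addr0 intrD mulrDl.
  rewrite (eq_transl _ (g := fun w => chi k1 (k2 / N%:R) y (0 * N%:Z) * f w)); last first.
    by move=> w; rewrite -ef.
  rewrite translZ => e2.
  have -> : transl N (S *m vec2 (y%:~R + 0) (s%:~R / N%:R + t%:~R / N%:R)) f z =
    cexp ('i * (pi * N%:R * - (y%:~R * (s%:~R / N%:R + t%:~R / N%:R)))%:C) *
    (chi k1 (k2 / N%:R) y (0 * N%:Z) * transl N (S *m vec2 0 (s%:~R / N%:R + t%:~R / N%:R)) f z).
    by rewrite e2 addr0 mulrA -cexpD subrr cexp0 mul1r.
  have -> : (t%:Z + s)%:~R / N%:R = s%:~R / N%:R + t%:~R / N%:R :> R.
    by rewrite intrD; ring.
  rewrite mul0r /chi; move: (transl N _ f z) => X.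
  rewrite [LHS]mulrA [LHS]mulrA [LHS]mulrA [RHS]mulrA -!cexpD; congr (_ * X).
  rewrite -[RHS](cexpD_2pii_int _ (- (y * t%:Z))); congr cexp; rewrite /q.
  move: (@pi R) => P; rewrite !(rmorphM, rmorphD, rmorphN, fmorphV, rmorph_int, rmorph_nat)/=.
  by field.
have fk_sholo k : sholo (fk k).
  apply: sholo_mull; apply: (@sholo_sum R 'I_N _ (fun (t : 'I_N) z => h k (nat_of_ord t)%:Z z)) => t.
  exact: (sholo_mull _ (sholo_transl _ sf)).
have f_sum z : f z = \sum_(k < N) fk k z.
  rewrite /fk -mulr_sumr exchange_big/=.
  transitivity (N%:R^-1 * \sum_(t < N) (T t%:Z z * (cexp (2 * 'i * pi%:C * t%:R * (k2 / N%:R)%:C) *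
      \sum_(k < N) e2pii (k%:R * (t%:Z%:~R / N%:R))))).
    rewrite [X in _ * X](eq_bigr (fun t : 'I_N => T t%:Z z *
      (cexp (2 * 'i * pi%:C * t%:R * (k2 / N%:R)%:C) * (if t == 0%N :> nat then N%:R else 0)))).
      rewrite (bigD1 (Ordinal N_gt0))//= big1 ?addr0; last first.
        by move=> t; rewrite -(inj_eq val_inj)/= => /negbTE->; rewrite !mulr0.
      rewrite mulr0 mul0r cexp0 mul1r mulrCA mulVf// mulr1 /T mul0r.
      rewrite (_ : vec2 0 0 = 0) ?mulmx0 ?transl0//.
      by apply/matrixP => i j; rewrite !mxE if_same.
    move=> t _; rewrite sum_e2pii// dvdzE/=; congr (_ * (_ * _)).
    case: (nat_of_ord t) (ltn_ord t) => [|m] mN; first by rewrite dvdn0.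
    by rewrite gtnNdvd.
  congr (_ * _); apply: eq_bigr => t _; rewrite !mulr_sumr; apply: eq_bigr => k _.
  rewrite /h mulrC; congr (_ * _); rewrite /e2pii -cexpD; congr cexp; rewrite /q.
  move: (@pi R) => P; rewrite !(rmorphM, rmorphD, rmorphN, fmorphV, rmorph_int, rmorph_nat)/=.
  by ring.
have coef k : exists c, forall z, fk k z = c * wave N S k1 (q k) z.
  have [z0 w0] := wave_neq0 N_gt0 k1 (q k) detS.
  exists (fk k z0 / wave N S k1 (q k) z0) => z.
  apply: (mulIf w0).
  rewrite (lattice_eigen_proportional N_gt0 z z0 detS (fk_sholo k) (fk_eigen k)
    (sholo_wave N_gt0 k1 (q k) detS) (wave_lattice_eigen N_gt0 k1 (q k) detS)).
  by rewrite [RHS]mulrAC divfK.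
have [c hc] := choice coef.
by exists (fun k => c k) => z; rewrite f_sum; apply: eq_bigr => k _; apply: hc.
Qed.

End LatticeDecomposition.


(** * Combinations of waves and the intertwining relation *)

Section WaveCombinations.
Local Open Scope complex_scope.
Import Normc.
Variable R : realType.
Variable N : nat.
Hypothesis N_gt0 : (0 < N)%N.
Variables k1 k2 : R.
Implicit Types (S : 'M[R]_2) (z : R[i]) (c d : 'I_N -> R[i]).

Let NR : N%:R != 0 :> R. Proof. by rewrite pnatr_eq0 -lt0n. Qed.
Let NC : N%:R != 0 :> R[i]. Proof. by rewrite pnatr_eq0 -lt0n. Qed.

Definition wave_comb S c z : R[i] :=
  \sum_(k < N) c k * wave N S k1 ((k2 + k%:R) / N%:R) z.

(** The waves have distinct eigenvalues under the translations by S (0, s/N); summing over s against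
    the inverse of the l-th eigenvalue isolates the l-th coefficient. *)
Lemma wave_comb_inj S c d : \det S = 1 -> wave_comb S c =1 wave_comb S d -> c =1 d.
Proof.
move=> detS cd l; pose e k := c k - d k.
have e0 z : wave_comb S e z = 0.
  rewrite /wave_comb; under eq_bigr do rewrite mulrBl.
  by rewrite sumrB; have := cd z; rewrite /wave_comb => ->; rewrite subrr.
pose q k : R := (k2 + k%:R) / N%:R.
have [z0 w0] := wave_neq0 N_gt0 k1 (q l) detS.
suff : N%:R * (e l * wave N S k1 (q l) z0) = 0.
  by move/eqP; rewrite !mulf_eq0 (negbTE NC) (negbTE w0) orbF subr_eq0 => /eqP.
have twisted (s : nat) : \sum_(k < N) e k * wave N S k1 (q k) z0 *
    e2pii (s%:R * ((l%:Z - k%:Z)%:~R / N%:R)) = 0.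
  have : transl N (S *m vec2 0%:~R (s%:Z%:~R / N%:R)) (wave_comb S e) z0 = 0.
    by rewrite /transl e0 mulr0.
  rewrite /wave_comb transl_sum.
  under eq_bigr do rewrite translZ (wave_lattice_eigen N_gt0)//.
  move=> h; rewrite -[RHS](mulr0 (cexp (2 * 'i * pi%:C * s%:R * (q l)%:C))) -[X in _ = _ * X]h.
  rewrite mulr_sumr; apply: eq_bigr => k _.
  rewrite [RHS]mulrCA -[LHS]mulrA; congr (_ * _).
  rewrite [RHS]mulrA [LHS]mulrC /chi /e2pii -cexpD; congr (cexp _ * _); rewrite /q.
  move: (@pi R) => P; rewrite intrB -![_%:Z%:~R]/(_%:R).
  rewrite !(rmorphM, rmorphD, rmorphN, fmorphV, rmorph_int, rmorph_nat)/=.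
  by field.
have : \sum_(s < N) \sum_(k < N) e k * wave N S k1 (q k) z0 *
    e2pii (s%:R * ((l%:Z - k%:Z)%:~R / N%:R)) = 0.
  by apply: big1 => s _; apply: twisted.
rewrite exchange_big/= (bigD1 l)//= [X in _ + X]big1 ?addr0.
  rewrite -mulr_sumr sum_e2pii// subrr dvdz0 => <-; ring.
move=> k kl; rewrite -mulr_sumr sum_e2pii//.
rewrite (_ : (N%:Z %| l%:Z - k%:Z)%Z = false) ?mulr0//.
apply/negP => /dvdzP[t tE]; move/negP: kl; apply; apply/eqP/val_inj => /=.
have := ltn_ord k; have := ltn_ord l; move: tE => /= tE lN kN.
have t0 : t = 0 by nia.
by move: tE; rewrite t0 mul0r; lia.
Qed.

(* The coefficients [d] do not depend on [S]: this is the intertwining U_S T_v = T_{Sv} U_S. *)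
Lemma transl_wave_comb (r s : int) c : exists d, forall S z, \det S = 1 ->
  transl N (S *m vec2 (r%:~R / N%:R) (s%:~R / N%:R)) (wave_comb S c) z = wave_comb S d z.
Proof.
(* Extends c to all integers with the multiplier inverse to that of [wave_shift], so that [h] below
   is N-periodic and its sum can be reindexed by r. *)
pose ext (n : int) : R[i] := (\sum_(k < N | k%:Z == (n %% N%:Z)%Z) c k) *
  cexp (2 * 'i * pi%:C * k1%:C * (n %/ N%:Z)%Z%:~R).
pose phase (n : int) : R[i] := cexp (- (2 * 'i * pi%:C * s%:~R * ((k2 + n%:~R) / N%:R)%:C)
  - 'i * pi%:C * s%:~R * (r%:~R / N%:R)%:C).
exists (fun k : 'I_N => ext (k%:Z + r) * phase k%:Z) => S z detS.
pose w (n : int) := wave N S k1 ((k2 + n%:~R) / N%:R) z.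
pose h n := ext (n + r) * phase n * w n.
have h_period n : h (n + N%:Z) = h n.
  have extN m : ext (m + N%:Z) = ext m * cexp (2 * 'i * pi%:C * k1%:C).
    have N0 : N%:Z != 0 by lia.
    rewrite /ext modzDr divzDr// divzz N0 intrD mulrDr mulr1 cexpD; ring.
  have phaseN m : phase (m + N%:Z) = phase m.
    rewrite /phase -[RHS](cexpD_2pii_int _ (- s)); congr cexp.
    move: (@pi R) => P; rewrite intrD -[N%:Z%:~R]/(N%:R).
    rewrite !(rmorphM, rmorphD, rmorphN, fmorphV, rmorph_int, rmorph_nat)/=.
    by field.
  have wN m : w (m + N%:Z) = cexp (- (2 * 'i * pi%:C * k1%:C)) * w m.
    have qE : (k2 + (m + N%:Z)%:~R) / N%:R = (k2 + m%:~R) / N%:R + 1%:~R.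
      by rewrite intrD -[N%:Z%:~R]/(N%:R); field.
    rewrite /w qE (wave_shift N_gt0)//.
    have -> // : 2 * 'i * pi%:C * 1%:~R * k1%:C = 2 * 'i * pi%:C * k1%:C :> R[i].
    by ring.
  rewrite /h addrAC extN phaseN wN.
  set E := cexp _; have -> : cexp (- (2 * 'i * pi%:C * k1%:C)) = E^-1 by rewrite cexpN.
  by field; exact: cexp_neq0.
transitivity (\sum_(k < N) h (k%:Z - r)).
  rewrite /wave_comb transl_sum; apply: eq_bigr => k _; rewrite translZ.
  have -> : (k2 + k%:R) / N%:R = (k2 + (k%:Z - r)%:~R) / N%:R + r%:~R / N%:R :> R.
    by rewrite intrB -[k%:Z%:~R]/(k%:R); ring.
  rewrite (transl_wave N_gt0)// /h subrK mulrA; congr (_ * _ * _).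
  rewrite /ext modz_small; last by rewrite /= ltz_nat ltn_ord.
  rewrite divz_small ?mulr0 ?cexp0 ?mulr1; last by rewrite /= ltz_nat ltn_ord.
  by rewrite (big_pred1 k)// => j; rewrite eqz_nat.
by rewrite sum_periodicZ.
Qed.

(** At S0 injectivity identifies the translated coefficients with lambda c, and these coefficients
    are the same for every S. *)
Lemma transl_wave_comb_eigen (r s : int) c (lambda : R[i]) S0 S : \det S0 = 1 -> \det S = 1 ->
  (forall z, transl N (S0 *m vec2 (r%:~R / N%:R) (s%:~R / N%:R)) (wave_comb S0 c) z =
     lambda * wave_comb S0 c z) ->
  forall z, transl N (S *m vec2 (r%:~R / N%:R) (s%:~R / N%:R)) (wave_comb S c) z =
     lambda * wave_comb S c z.
Proof.
move=> det0 detS eig z; have [d hd] := transl_wave_comb r s c.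
have scale T w : lambda * wave_comb T c w = wave_comb T (fun k => lambda * c k) w.
  by rewrite /wave_comb mulr_sumr; apply: eq_bigr => k _; rewrite mulrA.
have dE : d =1 (fun k => lambda * c k).
  by apply: (wave_comb_inj det0) => w; rewrite -hd// eig scale.
by rewrite hd// scale; apply: eq_bigr => k _; rewrite dE.
Qed.

Lemma sholo_wave_comb S c : \det S = 1 -> sholo (wave_comb S c).
Proof.
move=> detS; rewrite /wave_comb.
apply: (@sholo_sum R 'I_N _ (fun k z => c k * wave N S k1 ((k2 + k%:R) / N%:R) z)) => k.
exact: (sholo_mull _ (sholo_wave N_gt0 _ _ detS)).
Qed.

End WaveCombinations.

(** * Strings and the final argument *)


Section CharacterInvariance.
Local Open Scope complex_scope.
Variable R : realType.

Lemma mul_succ_even (x : int) : exists h, x * (x + 1) = 2 * h.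
Proof.
have /orP[/dvdzP[k ->]|/dvdzP[k kE]] : (2 %| x)%Z || (2 %| x + 1)%Z by lia.
  by exists (k * (k * 2 + 1)); ring.
by exists (x * k); rewrite kE; ring.
Qed.

(* The quadratic form [y + s + y s] mod 2 is invariant under SL(2, Z). *)
Lemma SL2_parity (al be g de y s : int) : al * de - be * g = 1 -> exists t,
  y * (g + de - 1) - s * (al + be - 1) - (al * s - g * y) * (de * y - be * s) + s * y = 2 * t.
Proof.
move=> det1.
have [d' dE] := mul_succ_even de; have [g' gE] := mul_succ_even g.
have [a' aE] := mul_succ_even al; have [b' bE] := mul_succ_even be.
have [y' yE] := mul_succ_even y; have [s' sE] := mul_succ_even s.
(* The identity displayed below reduces the expression by det = 1 and by x (x + 1) = 2 h for the six
   integers; halving what remains gives this witness. *)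
exists (- y * (al * (1 + g) * d' - be * (1 + de) * g' - g - de) + g * de * y'
  - s * (de * (1 + be) * a' - g * (1 + al) * b' - 1) + al * be * s' - g * be * s * y).
rewrite !(mulrDr 2) !mulrN !(mulrCA 2).
apply/eqP; rewrite -subr_eq0; apply/eqP.
transitivity (
  (al * de - be * g - 1) * (- s * y + y * (1 + g) * (1 + de) + s * (1 + al) * (1 + be))
  + y * al * (1 + g) * (2 * d' - de * (de + 1)) - y * be * (1 + de) * (2 * g' - g * (g + 1))
  - g * de * (2 * y' - y * (y + 1))
  + s * de * (1 + be) * (2 * a' - al * (al + 1)) - s * g * (1 + al) * (2 * b' - be * (be + 1))
  - al * be * (2 * s' - s * (s + 1))).
  ring.
by rewrite det1 dE gE aE bE yE sE !subrr; ring.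
Qed.

(** The new arguments are M^{-1} (y, s/N) for M with rows (al, N be) and (ga, de). Since M w0 = w0 +
    (N e, f), the linear phase det(M^{-1} v, w0) = det(v, M w0) changes by the integer y f - s e;
    [SL2_parity] takes care of the sign. *)
Lemma chi_invariant (k1 q : R) (N : nat) (al be ga de e f y s : int) :
  (0 < N)%N -> al * de - be * (N%:Z * ga) = 1 ->
  al%:~R * (q - 2^-1) + be%:~R * (k1 - 2^-1) = q - 2^-1 + e%:~R ->
  ga%:~R * (N%:R * (q - 2^-1)) + de%:~R * (k1 - 2^-1) = k1 - 2^-1 + f%:~R ->
  chi k1 q (de * y - be * s) (al * s - N%:Z * ga * y) = chi k1 q y s.
Proof.
move=> N0 det1 rel1 rel2; have [t tE] := SL2_parity y s det1.
rewrite /chi -[RHS](cexpD_2pii_int _ (y * f - s * e + t)); congr cexp.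
have r1 : al%:~R * (q%:C - 2^-1) + be%:~R * (k1%:C - 2^-1) = q%:C - 2^-1 + e%:~R.
  move/(congr1 (real_complex R)): rel1.
  by rewrite !(rmorphM, rmorphD, rmorphN, fmorphV, rmorph_int, rmorph_nat).
have r2 : ga%:~R * (N%:R * (q%:C - 2^-1)) + de%:~R * (k1%:C - 2^-1) = k1%:C - 2^-1 + f%:~R.
  move/(congr1 (real_complex R)): rel2.
  by rewrite !(rmorphM, rmorphD, rmorphN, fmorphV, rmorph_int, rmorph_nat).
have tC : (y%:~R * ((N%:Z * ga)%:~R + de%:~R - 1) - s%:~R * (al%:~R + be%:~R - 1)
   - (al%:~R * s%:~R - (N%:Z * ga)%:~R * y%:~R) * (de%:~R * y%:~R - be%:~R * s%:~R)
   + s%:~R * y%:~R) = 2 * t%:~R :> R[i].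
  move/(congr1 (fun x : int => x%:~R : R[i])): tE.
  by rewrite !(intrM, intrD, intrB, mulrNz).
move: tC; rewrite !(intrM, intrD, intrB, mulrNz) -[N%:Z%:~R]/(N%:R) => tC.
move: (@pi R) => P.
apply/eqP; rewrite -subr_eq0; apply/eqP.
rewrite -[t%:~R](mulKf (_ : 2 != 0)) ?pnatr_eq0// -tC.
move/eqP: r1; rewrite -subr_eq0 => /eqP r1; move/eqP: r2; rewrite -subr_eq0 => /eqP r2.
transitivity (2 * 'i * P%:C *
  (y%:~R * (ga%:~R * (N%:R * (q%:C - 2^-1)) + de%:~R * (k1%:C - 2^-1) - (k1%:C - 2^-1 + f%:~R))
   - s%:~R * (al%:~R * (q%:C - 2^-1) + be%:~R * (k1%:C - 2^-1) - (q%:C - 2^-1 + e%:~R)))).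
  by field.
by rewrite r1 r2; ring.
Qed.

End CharacterInvariance.


Section BargmannStates.
Local Open Scope complex_scope.
Import Normc.
Variable R : realType.
Variable N : nat.
Hypothesis N_gt0 : (0 < N)%N.
Implicit Types (S : 'M[R]_2) (j z : R[i]) (kappa : R * R) (c : 'I_N -> R[i]).

Definition U_cst j : R[i] := ((pi * hbar R N) `^ (4^-1))%:C^-1 * j^-1.

Lemma hbar_gt0 : 0 < hbar R N.
Proof. by rewrite invr_gt0 !mulr_gt0 ?pi_gt0 ?ltr0n. Qed.

Lemma U_cst_neq0 j : j != 0 -> U_cst j != 0.
Proof.
move=> j0; rewrite /U_cst mulf_neq0 ?invr_neq0//.
rewrite -normc_gt0 normc_real normr_gt0 gt_eqF// powR_gt0//.
by rewrite mulr_gt0 ?pi_gt0 ?hbar_gt0.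
Qed.

Lemma is_jS_neq0 S j : \det S = 1 -> is_jS S j -> j != 0.
Proof.
by move=> detS hj; rewrite -sqrf_eq0 hj i_b_plus_d_neq0.
Qed.

Lemma kernel_U_gexp S j z q : \det S = 1 ->
  kernel_U N S j z q = U_cst j * cexp (gexp N S z q).
Proof.
move=> detS; rewrite /kernel_U /U_cst; congr (_ * cexp _).
rewrite /gexp /a_ic; congr (_ * _).
have NC : N%:R != 0 :> R[i] by rewrite pnatr_eq0 -lt0n.
have pi0 : pi%:C != 0 :> R[i].
  by rewrite -normc_gt0 normc_real normr_gt0 gt_eqF// pi_gt0.
have D0 := i_b_plus_d_neq0 detS.
rewrite /hbar; move: (@pi R) pi0 => P pi0.
rewrite !(rmorphM, fmorphV, rmorph_nat)/=.
by field; rewrite D0 NC pi0.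
Qed.

Lemma U_basis_wave S j kappa (k : 'I_N) z : \det S = 1 ->
  U_basis kappa S j k z = U_cst j * wave N S kappa.1 ((kappa.2 + k%:R) / N%:R) z.
Proof.
move=> detS; rewrite waveE -sumZ_mull; last exact: abs_summableZ_wave.
apply: eq_sumZ => m; rewrite kernel_U_gexp// /wave_term mulrCA.
by [].
Qed.

Lemma lincomb_U_basis S j kappa c z : \det S = 1 ->
  lincomb c (U_basis kappa S j) z = U_cst j * wave_comb kappa.1 kappa.2 S c z.
Proof.
move=> detS; rewrite /lincomb /wave_comb mulr_sumr; apply: eq_bigr => k _.
by rewrite U_basis_wave// mulrCA.
Qed.

Lemma lincomb_basis kappa c z :
  lincomb c (Defs.basis kappa) z = U_cst 1 * wave_comb kappa.1 kappa.2 1%:M c z.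
Proof. by apply: lincomb_U_basis; rewrite det1. Qed.

Lemma coordsP kappa psi : Hspace N kappa psi -> psi = lincomb (coords (N := N) kappa psi) (Defs.basis kappa).
Proof. by move=> Hpsi; apply: (@xgetPex _ (fun=> 0) _ Hpsi). Qed.

Lemma wave_comb_Hspace kappa (psi : R[i] -> R[i]) c :
  (forall z, psi z = wave_comb kappa.1 kappa.2 1%:M c z) -> Hspace N kappa psi.
Proof.
move=> hpsi; exists (fun k => (U_cst 1)^-1 * c k); apply/funext => z.
rewrite lincomb_basis hpsi /wave_comb !mulr_sumr; apply: eq_bigr => k _.
by rewrite !mulrA mulfV ?mul1r// U_cst_neq0 ?oner_eq0.
Qed.

Lemma in_SL2Z_det (T : 'M[int]_2) : in_SL2Z T -> \det (intmx R T) = 1.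
Proof. by move=> detT; rewrite det_map_mx detT. Qed.

Lemma vec2_inj (x y x' y' : R) : vec2 x y = vec2 x' y' -> x = x' /\ y = y'.
Proof.
by move=> e; have := congr1 (fun v : 'cV[R]_2 => (v 0 0, v 1 0)) e; rewrite !mxE/= => -[].
Qed.

Lemma vec_of_complexE z : vec_of_complex z = vec2 (complex.Re z) (complex.Im z).
Proof. by []. Qed.

(** By [zeta_mul] the prescribed value is [zeta (S *m vec2 x y)], and [zeta v] is the conjugate of v
    read as a complex number. *)
Lemma conj_coordinate S (x y : R) z : N%:R * (Num.sqrt 2)%:C * z =
    a_ic S * x%:C - 'i * i_b_plus_d S * y%:C <->
  vec_of_complex (N%:R * (Num.sqrt 2)%:C * z^*) = S *m vec2 x y.
Proof.
have realNs : N%:R * (Num.sqrt 2)%:C = (N%:R * Num.sqrt 2)%:C :> R[i].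
  by rewrite rmorphM rmorph_nat.
rewrite realNs mul_vec2 vec_of_complexE; move: (N%:R * Num.sqrt 2) => t.
case: z => u v; split=> [/eqP|/vec2_inj[]]; rewrite /a_ic i_b_plus_dE.
  rewrite eq_complex /= => /andP[/eqP e1 /eqP e2].
  by congr vec2; lra.
move=> /= e1 e2; apply/eqP; rewrite eq_complex /=; apply/andP; split; apply/eqP; lra.
Qed.

Lemma affine_string_wave_comb (T : 'M[int]_2) (k1 q : R) (mu : R[i]) (v : 'cV[R]_2) :
  in_SL2Z T -> mu != 0 ->
  affine_string N (fun z => mu * wave N (intmx R T) k1 q z) v <->
  exists k l : int, v = intmx R T *m vec2 (N%:R * (q - 2^-1) + N%:R * k%:~R) (k1 - 2^-1 + l%:~R).
Proof.
move=> detT mu0; have detT' := in_SL2Z_det detT.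
have zeros z : mu * wave N (intmx R T) k1 q z = 0 <-> exists k l : int,
    vec_of_complex (N%:R * (Num.sqrt 2)%:C * z^*) =
    intmx R T *m vec2 (N%:R * (q - 2^-1) + N%:R * k%:~R) (k1 - 2^-1 + l%:~R).
  split.
    move=> /eqP; rewrite mulf_eq0 (negbTE mu0) => /eqP /(wave_eq0 N_gt0 k1 q z detT')[k [l h]].
    exists (- k), (- l); apply/conj_coordinate; rewrite h.
    rewrite !(rmorphM, rmorphD, rmorphN, fmorphV, rmorph_int, rmorph_nat)/=.
    by field.
  move=> [k [l /conj_coordinate h]]; apply/eqP; rewrite mulf_eq0 (negbTE mu0); apply/eqP.
  apply/(wave_eq0 N_gt0 k1 q z detT'); exists (- k), (- l); rewrite h.
  rewrite !(rmorphM, rmorphD, rmorphN, fmorphV, rmorph_int, rmorph_nat)/=.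
  by field.
split.
  move=> [z [u [/zeros[k [l ->]] ->]]].
  (* T is unimodular, so N u = T (N w) with w integral, and N w lies in N Z x Z. *)
  pose w := invmx T *m u.
  have uE : u = T *m w by rewrite mulKVmx// unitmxE detT.
  exists (k + w 0 0), (l + N%:Z * w 1 0).
  rewrite uE map_mxM -/(intmx R T) scalemxAr -mulmxDr; congr (_ *m _).
  apply/matrixP => i m; rewrite !mxE (ord1 m); case: (ord2P i) => -> /=.
    by rewrite intrD; ring.
  by rewrite intrD intrM; ring.
move=> [k [l ->]].
pose x := N%:R * (q - 2^-1) + N%:R * k%:~R; pose y := k1 - 2^-1 + l%:~R.
pose z := (a_ic (intmx R T) * x%:C - 'i * i_b_plus_d (intmx R T) * y%:C) / (N%:R * (Num.sqrt 2)%:C).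
have zE : vec_of_complex (N%:R * (Num.sqrt 2)%:C * z^*) = intmx R T *m vec2 x y.
  apply/conj_coordinate; rewrite /z mulrC divfK// mulf_neq0 ?sqrt2_neq0//.
  by rewrite pnatr_eq0 -lt0n.
exists z, 0; split; last by rewrite map_mx0 scaler0 addr0.
by apply/zeros; exists k, l.
Qed.

End BargmannStates.


Section Strings.
Local Open Scope complex_scope.
Variable R : realType.
Implicit Types (S T : 'M[int]_2).

Lemma mulmx_unimodular_inj T : in_SL2Z T -> injective (fun v : 'cV[R]_2 => intmx R T *m v).
Proof.
move=> detT v w vw; have inv : intmx R (invmx T) *m intmx R T = 1%:M.
  by rewrite -map_mxM mulVmx ?unitmxE ?detT// map_mx1.
by have := congr1 (mulmx (intmx R (invmx T))) vw; rewrite /= !mulmxA inv !mul1mx.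
Qed.

Lemma string_invariance (N : nat) S T (k1 q : R) (mu : R[i]) :
  (0 < N)%N -> in_SL2Z S -> in_SL2Z T -> mu != 0 ->
  mx_invariant (intmx R S) (affine_string N (fun z => mu * wave N (intmx R T) k1 q z)) ->
  exists (M : 'M[int]_2) (be e f : int), [/\ T *m M = S *m T,
    M 0 0 * M 1 1 - be * (N%:Z * M 1 0) = 1, M 0 1 = N%:Z * be,
    (M 0 0)%:~R * (q - 2^-1) + be%:~R * (k1 - 2^-1) = q - 2^-1 + e%:~R &
    (M 1 0)%:~R * (N%:R * (q - 2^-1)) + (M 1 1)%:~R * (k1 - 2^-1) = k1 - 2^-1 + f%:~R].
Proof.
move=> N0 detS detT mu0 hinv.
have NR : N%:R != 0 :> R by rewrite pnatr_eq0 -lt0n.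
have [M [TM detM]] : exists M, T *m M = S *m T /\ \det M = 1.
  exists (invmx T *m S *m T); rewrite -mulmxA mulKVmx ?unitmxE ?detT//.
  by rewrite !det_mulmx det_inv detT detS invr1 !mul1r.
pose w : R := N%:R * (q - 2^-1); pose u : R := k1 - 2^-1.
have image (l : int) : exists k' l' : int, intmx R M *m vec2 w (u + l%:~R) =
    vec2 (w + N%:R * k'%:~R) (u + l'%:~R).
  have : affine_string N (fun z => mu * wave N (intmx R T) k1 q z)
      (intmx R S *m (intmx R T *m vec2 w (u + l%:~R))).
    rewrite -[X in X _]hinv; eexists; last by [].
    apply/affine_string_wave_comb => //; exists 0, l.
    by rewrite mulr0 addr0.
  move/affine_string_wave_comb => /(_ N0 detT mu0)[k' [l']].
  rewrite mulmxA -map_mxM -TM map_mxM -mulmxA => /(mulmx_unimodular_inj detT).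
  by exists k', l'.
(* Two points suffice: their difference puts the first entry of M (0, 1) in N Z, and the first one
   alone gives the two relations for w0. *)
have [e [f E0]] := image 0; have [e1 [f1 E1]] := image 1.
move: E0 E1; rewrite !mul_vec2 => /vec2_inj[h2 h3] /vec2_inj[h1 _].
rewrite !mxE mulr0z addr0 in h2 h3; rewrite !mxE mulr1z in h1.
have be_eq : M 0 1 = N%:Z * (e1 - e).
  apply/eqP; rewrite -(eqr_int R) intrM intrB -[N%:Z%:~R]/(N%:R); apply/eqP.
  by move: h1 h2; rewrite mulrDr mulrBr mulr1; lra.
exists M, (e1 - e), e, f; split => //.
- by rewrite -detM det_mx22 be_eq; ring.
- apply: (mulfI NR); move: h2; rewrite be_eq /w /u intrM -[N%:Z%:~R]/(N%:R) => h2.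
  by rewrite [RHS]mulrDr -h2; ring.
Qed.

End Strings.

(** * From affine strings to their linear parts *)

Section LinearString.
Local Open Scope complex_scope.
Variable R : realType.

Lemma affine_string_translate (N : nat) (psi : R[i] -> R[i]) z0 (n m : int) :
  (0 < N)%N -> zeros_on_string N psi z0 n m ->
  forall v, affine_string N psi v <-> exists2 l, linear_string N n m l &
    v = vec_of_complex (N%:R * (Num.sqrt 2)%:C * z0^*) + map_mx intr l.
Proof.
move=> N0 [_ hz] v.
have NR : N%:R != 0 :> R by rewrite pnatr_eq0 -lt0n.
have realNs : N%:R * (Num.sqrt 2)%:C = (N%:R * Num.sqrt 2)%:C :> R[i].
  by rewrite rmorphM rmorph_nat.
have s0 : Num.sqrt 2 != 0 :> R by rewrite sqrtr_eq0 -ltNge.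
pose t : R := N%:R * Num.sqrt 2.
have t0 : t != 0 by rewrite mulf_neq0.
have vecE (k a b : int) : vec_of_complex (N%:R * (Num.sqrt 2)%:C *
    (z0 + k%:~R * (n%:~R + 'i * m%:~R) / (N%:R * (Num.sqrt 2)%:C)
      + (a%:~R + 'i * b%:~R) / (Num.sqrt 2)%:C)^*) =
   vec_of_complex (N%:R * (Num.sqrt 2)%:C * z0^*) +
   map_mx intr (k *: (\col_i (if i == 0 then n else - m)) + N%:Z *: (\col_i (if i == 0 then a else - b))).
  pose x : R := (k%:~R * n%:~R + N%:R * a%:~R) / t.
  pose y : R := (k%:~R * m%:~R + N%:R * b%:~R) / t.
  have -> : z0 + k%:~R * (n%:~R + 'i * m%:~R) / (N%:R * (Num.sqrt 2)%:C)
      + (a%:~R + 'i * b%:~R) / (Num.sqrt 2)%:C = z0 + (x%:C + 'i * y%:C).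
    rewrite -addrA; congr (_ + _); rewrite /x /y /t.
    rewrite !(rmorphM, rmorphD, rmorphN, fmorphV, rmorph_int, rmorph_nat)/=.
    by field; rewrite sqrt2_neq0 pnatr_eq0 -lt0n N0.
  have xt : t * x = k%:~R * n%:~R + N%:R * a%:~R by rewrite mulrC divfK.
  have yt : t * y = k%:~R * m%:~R + N%:R * b%:~R by rewrite mulrC divfK.
  rewrite realNs -/t !vec_of_complexE; case: z0 {hz} => x0 y0 /=.
  apply/matrixP => i l; rewrite !mxE ?(ord1 l); case: (ord2P i) => -> /=.
    by rewrite intrD !intrM -[N%:Z%:~R]/(N%:R) -xt; ring.
  rewrite intrD !intrM !mulrNz -[N%:Z%:~R]/(N%:R).
  by transitivity (- (t * y0) - t * y); [ring|rewrite yt; ring].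
have linE (v1 : 'cV[int]_2) : v1 = \col_i (if i == 0 then v1 0 0 else - - v1 1 0).
  by apply/matrixP => i l; rewrite !mxE ?(ord1 l); case: (ord2P i) => -> //=; rewrite opprK.
have natZ (k : nat) : k%:~R = k%:R :> R[i] by [].
split.
  move=> [z [u [/hz[k [a [b ->]]] ->]]].
  have := vecE k%:Z a b; rewrite natZ => ->.
  set w := \col_i _; set w' := \col_i _; exists (k%:Z *: w + N%:Z *: (w' + u)).
    by exists k%:Z, (w' + u); rewrite natz.
  rewrite -addrA; congr (_ + _); rewrite scalerDr addrA !map_mxD; congr (_ + _).
  by apply/matrixP => i l; rewrite !mxE/= intrM.
move=> [_ [k [u ->]] ->].
have N0Z : N%:Z != 0 by lia.
have r0 := modz_ge0 k N0Z; have rN := ltz_pmod k (_ : 0 < N%:Z).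
pose r := absz (k %% N%:Z)%Z.
have rE : r%:Z = (k %% N%:Z)%Z by rewrite /r gez0_abs.
have r_lt : (r < N)%N by rewrite -ltz_nat rE rN// ltz_nat.
(* The zeros are indexed by 0 <= k < N only; the quotient of k by N becomes a period of the
   torus. *)
pose q := (k %/ N%:Z)%Z.
have kE : k = q * N%:Z + r%:Z by rewrite rE -divz_eq.
exists (z0 + r%:R * (n%:~R + 'i * m%:~R) / (N%:R * (Num.sqrt 2)%:C)
   + ((q * n + u 0 0)%:~R + 'i * (q * m - u 1 0)%:~R) / (Num.sqrt 2)%:C), 0; split.
  apply/hz; exists (Ordinal r_lt) => /=.
  by exists (q * n + u 0 0), (q * m - u 1 0).
have := vecE r%:Z (q * n + u 0 0) (q * m - u 1 0); rewrite natZ => ->.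
rewrite map_mx0 scaler0 addr0; congr (_ + map_mx intr _).
apply/matrixP => i l; rewrite !mxE ?(ord1 l) kE natz; case: (ord2P i) => -> /=; ring.
Qed.

(** The linear part consists of differences of points of the string. With S v0 = v0 + l0 the image
    of v0 + l is v0 + l', whence S l = l' - l0. *)
Lemma linear_string_invariance (N : nat) (psi : R[i] -> R[i]) (S : 'M[int]_2) z0 (n m : int) :
  (0 < N)%N -> zeros_on_string N psi z0 n m ->
  mx_invariant (intmx R S) (affine_string N psi) ->
  mx_invariant S (linear_string N n m).
Proof.
move=> N0 hz inv; have trE := affine_string_translate N0 hz.
set v0 := vec_of_complex _ in trE.
have lin0 : linear_string N n m 0 by exists 0, 0; rewrite scale0r scaler0 addr0.
have linB l l' : linear_string N n m l -> linear_string N n m l' -> linear_string N n m (l - l').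
  move=> [k [u ->]] [k' [u' ->]]; exists (k - k'), (u - u').
  by rewrite scalerBl scalerBr opprD addrACA.
have linD l l' : linear_string N n m l -> linear_string N n m l' -> linear_string N n m (l + l').
  move=> hl hl'; rewrite -[l']opprK; apply: (linB _ _ hl).
  by rewrite -sub0r; exact: (linB _ _ lin0 hl').
have map_inj : injective (fun l : 'cV[int]_2 => map_mx (intr : int -> R) l).
  move=> l l' /matrixP e; apply/matrixP => i j; apply/eqP; rewrite -(eqr_int R).
  by have := e i j; rewrite !mxE => ->.
have image l : linear_string N n m l -> exists2 l', linear_string N n m l' &
    intmx R S *m v0 + map_mx intr (S *m l) = v0 + map_mx intr l'.
  move=> hl; have : affine_string N psi (intmx R S *m (v0 + map_mx intr l)).
    by rewrite -[X in X _]inv; eexists; last by []; apply/trE; exists l.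
  by move/trE => [l' hl' e]; exists l' => //; rewrite -e mulmxDr map_mxM.
have [l0 hl0 e0] := image 0 lin0; rewrite mulmx0 map_mx0 addr0 in e0.
apply/seteqP; split=> [_ [l hl <-]|l hl].
  have [l' hl' e'] := image l hl.
  have -> : S *m l = l' - l0; last exact: linB.
  apply: map_inj; rewrite /= map_mxB; apply: (addrI (intmx R S *m v0)).
  by rewrite e' e0 addrACA subrr addr0.
(* For surjectivity the preimage of v0 + l0 + l is taken, so that the offset S v0 = v0 + l0
   cancels. *)
have : affine_string N psi (v0 + map_mx intr (l0 + l)).
  by apply/trE; exists (l0 + l) => //; apply: linD.
rewrite -{1}inv => -[_ /trE[l1 hl1 ->]] e1; exists l1 => //.
apply: map_inj; apply: (addrI (v0 + map_mx intr l0)).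
by rewrite -{1}e0 /= map_mxM -mulmxDr e1 map_mxD addrA.
Qed.

End LinearString.


Section IntegerTranslations.
Local Open Scope complex_scope.
Variable R : realType.
Variable N : nat.
Hypothesis N_gt0 : (0 < N)%N.
Variables k1 k2 : R.

(** On integer translations the eigenvalues at (k2 + k) / N differ by e^{2 pi i p k} = 1, so all the
    waves share one eigenvalue. *)
Lemma wave_comb_integer_eigen (S : 'M[R]_2) (c : 'I_N -> R[i]) (y p : int) z :
  \det S = 1 -> transl N (S *m vec2 y%:~R p%:~R) (wave_comb k1 k2 S c) z =
    chi k1 (k2 / N%:R) y (p * N%:Z) * wave_comb k1 k2 S c z.
Proof.
move=> detS; rewrite /wave_comb transl_sum mulr_sumr; apply: eq_bigr => k _.
have NR : N%:R != 0 :> R by rewrite pnatr_eq0 -lt0n.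
have NC : N%:R != 0 :> R[i] by rewrite pnatr_eq0 -lt0n.
have pE : p%:~R = (p * N%:Z)%:~R / N%:R :> R by rewrite intrM -[N%:Z%:~R]/(N%:R) mulfK.
rewrite translZ [RHS]mulrCA pE (wave_lattice_eigen N_gt0)//; congr (_ * (_ * _)).
rewrite /chi -[RHS](cexpD_2pii_int _ (- (p * k%:Z))); congr cexp.
move: (@pi R) => P; rewrite mulrNz !intrM -![_%:Z%:~R]/(_%:R).
rewrite !(rmorphM, rmorphD, fmorphV, rmorph_nat)/=.
by field.
Qed.

End IntegerTranslations.

Section Proposition.
Local Open Scope complex_scope.
Variable R : realType.
Variable N : nat.
Hypothesis N_gt0 : (0 < N)%N.
Variables (S T : 'M[int]_2) (kappa : R * R) (k1 q : R) (c : 'I_N -> R[i]) (nu : R[i]).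
Hypotheses (detS : in_SL2Z S) (detT : in_SL2Z T) (nu_neq0 : nu != 0).
Let psi z := nu * wave N (intmx R T) k1 q z.
Hypothesis psi_comb : forall z, psi z = wave_comb kappa.1 kappa.2 1%:M c z.
Hypothesis string_inv : mx_invariant (intmx R S) (affine_string N psi).

Let detS' : \det (intmx R S) = 1. Proof. exact: in_SL2Z_det. Qed.
Let detT' : \det (intmx R T) = 1. Proof. exact: in_SL2Z_det. Qed.
Let det1' : \det (1%:M : 'M[R]_2) = 1. Proof. exact: det1. Qed.
Let NR : N%:R != 0 :> R. Proof. by rewrite pnatr_eq0 -lt0n. Qed.

Lemma conjugate_chi_invariant : exists M : 'M[int]_2, T *m M = S *m T /\
  forall y s : int, exists y' s' : int,
    intmx R M *m vec2 y'%:~R (s'%:~R / N%:R) = vec2 y%:~R (s%:~R / N%:R) /\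
    chi k1 q y' s' = chi k1 q y s.
Proof.
have [M [be [e [f [TM detM M01 rel1 rel2]]]]] :=
  string_invariance N_gt0 detS detT nu_neq0 string_inv.
exists M; split=> // y s.
exists (M 1 1 * y - be * s), (M 0 0 * s - N%:Z * M 1 0 * y); split; last exact: chi_invariant rel1 rel2.
rewrite mul_vec2 !mxE M01; congr vec2.
  transitivity (((M 0 0 * M 1 1 - be * (N%:Z * M 1 0)) * y)%:~R : R); last by rewrite detM mul1r.
  rewrite !(intrM, intrB, intrD, mulrNz) -[N%:Z%:~R]/(N%:R); by field.
transitivity (((M 0 0 * M 1 1 - be * (N%:Z * M 1 0)) * s)%:~R / N%:R : R); last by rewrite detM mul1r.
rewrite !(intrM, intrB, intrD, mulrNz) -[N%:Z%:~R]/(N%:R); by field.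
Qed.

Lemma wave_comb_eigen y s z :
  transl N (intmx R T *m vec2 y%:~R (s%:~R / N%:R)) (wave_comb kappa.1 kappa.2 1%:M c) z =
  chi k1 q y s * wave_comb kappa.1 kappa.2 1%:M c z.
Proof.
rewrite -(@eq_transl _ _ _ _ _ psi_comb) -psi_comb /psi translZ.
by rewrite (wave_lattice_eigen N_gt0)// mulrCA.
Qed.

(** If v = M v', then T v = S T v'. The eigenvalue of psi under the translation by T v' passes to
    the translation of its transform by S T v', and by invariance it is [chi] at v. *)
Lemma transformed_eigen :
  lattice_eigen N (intmx R T) k1 q (wave_comb kappa.1 kappa.2 (intmx R S) c).
Proof.
have [M [TM hM]] := conjugate_chi_invariant.
move=> y s z; have [y' [s' [Mv <-]]] := hM y s.
rewrite -Mv mulmxA -map_mxM TM map_mxM -mulmxA.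
(* Both coordinates are put over N, the form in which the intertwining is available. *)
have Tv : intmx R T *m vec2 y'%:~R (s'%:~R / N%:R) =
    vec2 ((T 0 0 * (N%:Z * y') + T 0 1 * s')%:~R / N%:R)
         ((T 1 0 * (N%:Z * y') + T 1 1 * s')%:~R / N%:R).
  rewrite mul_vec2 !mxE !(intrD, intrM) -[N%:Z%:~R]/(N%:R).
  by congr vec2; field.
rewrite -/(intmx R T) -/(intmx R S) Tv.
apply: (@transl_wave_comb_eigen _ _ N_gt0 _ _ _ _ _ _ 1%:M) => // w.
by rewrite mul1mx -Tv; apply: wave_comb_eigen.
Qed.

Lemma transformed_proportional : exists lambda, forall z,
  wave_comb kappa.1 kappa.2 (intmx R S) c z = lambda * psi z.
Proof.
have [z0 w0] := wave_neq0 N_gt0 k1 q detT'.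
exists (wave_comb kappa.1 kappa.2 (intmx R S) c z0 / (nu * wave N (intmx R T) k1 q z0)) => z.
apply: (mulIf w0).
rewrite (lattice_eigen_proportional N_gt0 z z0 detT' (sholo_wave_comb N_gt0 _ _ _ detS')
  transformed_eigen (sholo_wave N_gt0 _ _ detT') (wave_lattice_eigen N_gt0 _ _ detT')).
by rewrite /psi; field; rewrite w0 nu_neq0.
Qed.

(** Both numbers are the eigenvalue of one and the same translation on the nonzero function psi. *)
Lemma chi_agree (y p y' p' : int) :
  intmx R T *m vec2 y'%:~R p'%:~R = vec2 y%:~R p%:~R ->
  chi kappa.1 (kappa.2 / N%:R) y (p * N%:Z) = chi k1 q y' (p' * N%:Z).
Proof.
move=> Tv; have [z0 w0] := wave_neq0 N_gt0 k1 q detT'.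
have psi0 : wave_comb kappa.1 kappa.2 1%:M c z0 != 0.
  by rewrite -psi_comb mulf_neq0.
have e1 := wave_comb_integer_eigen N_gt0 kappa.1 kappa.2 c y p z0 det1'.
have e2 := wave_comb_eigen y' (p' * N%:Z) z0.
have pN : (p' * N%:Z)%:~R / N%:R = p'%:~R :> R by rewrite intrM -[N%:Z%:~R]/(N%:R) mulfK.
rewrite pN Tv in e2; rewrite mul1mx in e1.
by apply: (mulIf psi0); rewrite -e1 e2.
Qed.

Lemma SL2Z_preimage (A : 'M[int]_2) (y p : int) : in_SL2Z A -> exists y' p' : int,
  intmx R A *m vec2 y'%:~R p'%:~R = vec2 y%:~R p%:~R.
Proof.
move=> detA; exists (A 1 1 * y - A 0 1 * p), (A 0 0 * p - A 1 0 * y).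
move: detA; rewrite /in_SL2Z det_mx22 => detA.
rewrite mul_vec2 !mxE -!intrM -!intrD.
have -> : A 0 0 * (A 1 1 * y - A 0 1 * p) + A 0 1 * (A 0 0 * p - A 1 0 * y) = y.
  by rewrite -[RHS]mul1r -detA; ring.
have -> // : A 1 0 * (A 1 1 * y - A 0 1 * p) + A 1 1 * (A 0 0 * p - A 1 0 * y) = p.
by rewrite -[RHS]mul1r -detA; ring.
Qed.

(** The coefficients d are arbitrary. [chi_agree] identifies the scalars by which integer
    translations act with eigenvalues of psi; invariance of the latter under M shows that the
    transform keeps the quasi-periodicity, and [lattice_decomposition] turns it back into
    membership. *)
Lemma transformed_Hspace (d : 'I_N -> R[i]) (lambda : R[i]) :
  Hspace N kappa (fun z => lambda * wave_comb kappa.1 kappa.2 (intmx R S) d z).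
Proof.
have [M [TM hM]] := conjugate_chi_invariant.
have sf : sholo (wave_comb kappa.1 kappa.2 (intmx R S) d) by apply: sholo_wave_comb.
have [|g hg] := lattice_decomposition N_gt0 (k1 := kappa.1) (k2 := kappa.2) det1' sf.
  move=> y p z; rewrite mul1mx.
  have [y1 [p1 Su]] := SL2Z_preimage y p detS.
  rewrite -Su wave_comb_integer_eigen//; congr (_ * _).
  have [y2 [p2 Tu]] := SL2Z_preimage y p detT; rewrite (chi_agree Tu).
  have [y3 [s3 [Mv <-]]] := hM y2 (p2 * N%:Z).
  have pN : (p2 * N%:Z)%:~R / N%:R = p2%:~R :> R by rewrite intrM -[N%:Z%:~R]/(N%:R) mulfK.
  rewrite pN in Mv.
  have Tv : intmx R T *m vec2 y3%:~R (s3%:~R / N%:R) = vec2 y1%:~R p1%:~R.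
    apply: (mulmx_unimodular_inj detS); rewrite /= Su -Tu -Mv.
    by rewrite !mulmxA -!map_mxM TM.
  (* T is unimodular, so the integrality of T (y3, s3/N) forces s3 to be a multiple of N. *)
  have [y4 [p4 Tv']] := SL2Z_preimage y1 p1 detT.
  have [y34 s34] : y4%:~R = y3%:~R :> R /\ p4%:~R = s3%:~R / N%:R :> R.
    by apply: vec2_inj; apply: (mulmx_unimodular_inj detT); rewrite /= Tv' Tv.
  have <- : y4 = y3 by apply/eqP; rewrite -(eqr_int R) y34.
  have <- : p4 * N%:Z = s3.
    by apply/eqP; rewrite -(eqr_int R) intrM s34 -[N%:Z%:~R]/(N%:R) divfK.
  exact: chi_agree.
apply: (@wave_comb_Hspace _ _ N_gt0 kappa _ (fun k => lambda * g k)) => z.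
by rewrite hg /wave_comb mulr_sumr; apply: eq_bigr => k _; rewrite mulrA.
Qed.

End Proposition.

Theorem proposition2 (R : realType) (S : 'M[int]_2) (jS : R[i]%C)
    (N : nat) (kappa : R * R) (psi : R[i]%C -> R[i]%C)
    (hS : in_Gamma12 S) (htr : 2 < \tr S)
    (hjS : is_jS (intmx R S) jS)
    (hN : (1 <= N)%N) (hkappa : in_unit_square kappa)
    (hpsi : Hspace N kappa psi) (hpure : pure_theta N psi)
    (hinv : mx_invariant (intmx R S) (affine_string N psi)) :
  [/\ eigenstate (U_op N kappa S jS) psi,
      [set U_op N kappa S jS phi | phi in Hspace N kappa] `<=` Hspace N kappa
    & forall (z0 : R[i]%C) (n m : int), zeros_on_string N psi z0 n m ->
        mx_invariant S (linear_string N n m)].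
Proof.
have [detS _] := hS; have detS' := in_SL2Z_det R detS.
have [T [j' [kap [k [mu [detT hj' _ mu0 psiE]]]]]] := hpure.
have detT' := in_SL2Z_det R detT.
have cst1 : U_cst N 1 != 0 :> R[i]%C by rewrite U_cst_neq0 ?oner_eq0.
pose q := (kap.2 + k%:R) / N%:R.
pose nu := mu * U_cst N j'.
have nu0 : nu != 0 by rewrite mulf_neq0 ?U_cst_neq0 ?(is_jS_neq0 detT' hj').
have psiW : psi = fun z => nu * wave N (intmx R T) kap.1 q z.
  by rewrite psiE; apply/funext => z; rewrite U_basis_wave// mulrA.
pose c := coords (N := N) kappa psi.
(* The prefactor at the identity moves into the coefficients, which makes psi a bare [wave_comb];
   the eigenvalue below divides it out again. *)
pose c1 := fun l : 'I_N => U_cst N 1 * c l.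
have psi_comb z : nu * wave N (intmx R T) kap.1 q z = wave_comb kappa.1 kappa.2 1%:M c1 z.
  have -> : nu * wave N (intmx R T) kap.1 q z = psi z by rewrite psiW.
  rewrite {1}(coordsP hpsi) lincomb_basis// /wave_comb mulr_sumr.
  by apply: eq_bigr => l _; rewrite mulrA.
rewrite psiW in hinv.
have U_opE phi : U_op N kappa S jS phi =
    fun z => U_cst N jS * wave_comb kappa.1 kappa.2 (intmx R S) (coords (N := N) kappa phi) z.
  by apply/funext => z; rewrite /U_op lincomb_U_basis.
split.
- split.
    have [z0 w0] := wave_neq0 hN kap.1 q detT'.
    by rewrite psiW => /(congr1 (@^~ z0))/eqP; rewrite mulf_eq0 (negbTE nu0) (negbTE w0).
  have [lambda hl] := transformed_proportional hN detS detT nu0 psi_comb hinv.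
  exists (U_cst N jS * (U_cst N 1)^-1 * lambda); rewrite U_opE; apply/funext => z.
  have -> : psi z = nu * wave N (intmx R T) kap.1 q z by rewrite psiW.
  rewrite -[RHS]mulrA -hl -mulrA; congr (_ * _).
  rewrite /wave_comb mulr_sumr; apply: eq_bigr => l _.
  by rewrite /c1; move: (U_cst N 1) cst1 => C C0; rewrite !mulrA mulVf// mul1r.
- move=> _ [phi _ <-]; rewrite U_opE.
  exact: (transformed_Hspace hN detS detT nu0 psi_comb hinv).
- move=> z0 n m hz; apply: (linear_string_invariance hN hz).
  by rewrite psiW.
Qed.
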